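(* For all integers $n,k\ge1$ and every $\rho\in[0,1]$ there exists an optimally stable function $f:\mathbb{R}^n\to B^k$ with parameter $\rho$. Moreover, if $k\le n$ and $\rho\in(0,1)$, then for every optimally stable $f$ with parameter $\rho$ there exist an orthogonal $n\times n$ matrix $M$ and a measurable $h:\mathbb{R}^k\to B^k$ such that $f(x)=h\big((Mx)_1,\dots,(Mx)_k\big)$ for almost every $x\in\mathbb{R}^n$.
   Context: $\gamma$ is the standard Gaussian measure on $\mathbb{R}^n$ and $\mathbf{x}\sim_\rho\mathbf{y}$ means $(\mathbf{x},\mathbf{y})\sim\mathcal N\big(0,\begin{bmatrix}I_n&\rho I_n\\\rho I_n&I_n\end{bmatrix}\big)$. A measurable $f:\mathbb{R}^n\to B^k$ (closed unit ball of $\mathbb{R}^k$) is optimally stable with parameter $\rho\in[0,1]$ if $\mathbb{E}_{\mathbf{x}\sim\gamma}[f(\mathbf{x})]=0$ and $\mathbb{E}_{\mathbf{x}\sim_\rho\mathbf{y}}\langle f(\mathbf{x}),f(\mathbf{y})\rangle$ is maximal among all measurable $g:\mathbb{R}^n\to B^k$ with $\mathbb{E}_\gamma[g]=0$. *)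

(* Defs.v *)
From HB Require Import structures.
From mathcomp Require Import all_boot all_order all_algebra.
From mathcomp Require Import all_classical all_reals all_analysis.
Set Implicit Arguments. Unset Strict Implicit. Unset Printing Implicit Defensive.
Import Order.TTheory GRing.Theory Num.Theory.
Local Open Scope classical_set_scope.
Local Open Scope ring_scope.

(* R^n is modelled as n.-tuple R, with its library sigma-algebra
   (generated by the coordinate projections = Borel sigma-algebra of R^n). *)

Definition tdot (R : realType) (k : nat) (u v : k.-tuple R) : R :=
  \sum_(i < k) tnth u i * tnth v i.

Definition in_ball (R : realType) (k : nat) (v : k.-tuple R) : Prop :=
  tdot v v <= 1.

Definition tadd (R : realType) (n : nat) (u v : n.-tuple R) : n.-tuple R :=
  [tuple tnth u i + tnth v i | i < n].
Definition tscale (R : realType) (n : nat) (a : R) (u : n.-tuple R) : n.-tuple R :=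
  [tuple a * tnth u i | i < n].

Definition std_gaussian (R : realType) (n : nat)
    (P : probability (n.-tuple R) R) : Prop :=
  forall A : 'I_n -> set R, (forall i, measurable (A i)) ->
    P [set x | forall i, A i (tnth x i)] =
    (\prod_(i < n) normal_prob (0:R) 1 (A i))%E.

Definition ball_valued (R : realType) (n k : nat)
    (g : n.-tuple R -> k.-tuple R) : Prop :=
  measurable_fun [set: n.-tuple R] g /\ forall x, in_ball (g x).

Definition mean_zero (R : realType) (n k : nat)
    (P : probability (n.-tuple R) R) (g : n.-tuple R -> k.-tuple R) : Prop :=
  forall i : 'I_k, (\int[P]_x (tnth (g x) i)%:E = 0)%E.

(* E_{x ~_rho y} <g(x), g(y)>, where (x, y) ~_rho is realised as
   (x, rho x + sqrt(1 - rho^2) z) with (x, z) ~ gamma (x) gamma. *)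
Definition noise_stab (R : realType) (n k : nat)
    (P : probability (n.-tuple R) R) (rho : R)
    (g : n.-tuple R -> k.-tuple R) : \bar R :=
  (\int[P \x P]_p
     (tdot (g p.1) (g (tadd (tscale rho p.1)
                            (tscale (Num.sqrt (1 - rho ^+ 2)) p.2))))%:E)%E.

Definition optimally_stable (R : realType) (n k : nat)
    (P : probability (n.-tuple R) R) (rho : R)
    (f : n.-tuple R -> k.-tuple R) : Prop :=
  [/\ ball_valued f, mean_zero P f &
      forall g : n.-tuple R -> k.-tuple R, ball_valued g -> mean_zero P g ->
        (noise_stab P rho g <= noise_stab P rho f)%E].

Definition first_coords (R : realType) (n k : nat) (hk : (k <= n)%N)
    (M : 'M[R]_n) (x : n.-tuple R) : k.-tuple R :=
  [tuple \sum_(l < n) M (widen_ord hk j) l * tnth x l | j < k].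

Definition orthogonal_mx (R : realType) (n : nat) (M : 'M[R]_n) : Prop :=
  M *m M^T = 1%:M.

(* Main.v *)
Require Import Defs.
From HB Require Import structures.
From mathcomp Require Import all_boot all_order all_algebra.
From mathcomp Require Import all_classical all_reals all_analysis.
From mathcomp Require Import measurable_realfun.
From mathcomp Require Import ring lra.
Import Order.TTheory GRing.Theory Num.Theory.
Import numFieldNormedType.Exports.
Local Open Scope classical_set_scope.
Local Open Scope ring_scope.
Set Implicit Arguments.
Unset Strict Implicit.
Unset Printing Implicit Defensive.

(** Existence.  For rho < 1 the noise operator T sends a maximizing sequence to
    equi-Lipschitz functions, so T f_N converges pointwise along a subsequence to
    some u.  The linear functional <., u> attains its maximum f on the (convex,
    L2-closed) set of admissible maps, and 2 <f, T f_N> <= J(f) + J(f_N) forces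
    J(f) to be maximal, where J(f) = <f, T f>.

    Structure.  An optimal f has |f| = 1 almost everywhere, because J is positive
    definite and may not increase in either direction along a perturbation
    supported where |f| < 1.  Call a direction v free if E[f(x) <x, v>] = 0.
    Shrinking x_v and shifting it by t or -t changes the mean by O(t^3) only, and
    the average of J over the two signs is, up to O(t^3), the stability D of f
    with the correlation in direction v raised from rho to rho + t^2 (1 - rho).
    Optimality thus bounds the growth of D at rho, and the convexity of D in
    the logarithm of the correlation turns this into D(rho) <= D(rho^2).  Hence
    the average of f over a partial resampling of x_v is optimal too; it has
    modulus one, so f does not depend on x_v.  Since E[f_i(x) x] are k vectors,
    all directions orthogonal to their span are free, and a rotation moves
    these to the coordinates k, ..., n - 1. *)

(** * Measure-preserving maps and one-dimensional Gaussians *)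

(** A two-point shift replaces it, at the price of an error cubic in t. That order is what makes the
    comparison succeed: the drop from rho to rho^2 is at most N times the increment over one step
    just above rho, this step has t^2 of order 1/N, and N t^3 tends to 0. The mean constraint has to
    be met to the same order, since recentring a map costs a multiple of its mean. The moment
    condition on a free direction removes the odd part of the drift up to t^3, and invariance of the
    Gaussian law removes the even part. As f is only bounded and measurable, all expansions in t
    differentiate the Gaussian weight instead of f. At rho = 1 the stability is E|f|^2, so the
    unimodular optimizer found for rho = 1/2 serves. *)

Definition pfm d d' (T1 : measurableType d) (T2 : measurableType d')
    (R : realType) (m : {measure set T1 -> \bar R}) (f : T1 -> T2)
    (mf : measurable_fun [set: T1] f) : {measure set T2 -> \bar R} :=
  measure_function_pushforward__canonical__measure_function_Measure m mf.

Definition mpres d d' (T1 : measurableType d) (T2 : measurableType d')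
    (R : realType) (mu : {measure set T1 -> \bar R})
    (nu : {measure set T2 -> \bar R}) (f : T1 -> T2) : Prop :=
  measurable_fun [set: T1] f /\
  forall A, measurable A -> mu (f @^-1` A) = nu A.

Section MeasurePreserving.
Context d d' (T1 : measurableType d) (T2 : measurableType d') (R : realType).
Variables (mu : {measure set T1 -> \bar R}) (nu : {measure set T2 -> \bar R}).
Variables (f : T1 -> T2).
Hypothesis pf : mpres mu nu f.
Local Open Scope ereal_scope.

Lemma mpres_ge0_integral (F : T2 -> \bar R) :
  measurable_fun [set: T2] F -> (forall x, 0 <= F x) ->
  \int[mu]_x F (f x) = \int[nu]_x F x.
Proof.
move=> mF F0; have [mf fE] := pf.
transitivity (\int[pushforward mu f]_x F x).
  by rewrite ge0_integral_pushforward.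
by apply: (@eq_measure_integral _ _ _ setT nu (pfm mu mf)) => A mA _; exact: fE.
Qed.

End MeasurePreserving.

(** * Translation and negation on the line; the Gaussian density *)

Section LebesgueTranslation.
Context {R : realType}.
Local Notation leb := (@lebesgue_measure R).
Local Open Scope ereal_scope.

Lemma measurable_shift (a : R) :
  measurable_fun [set: measurableTypeR R] (fun x : measurableTypeR R => (x + a)%R : measurableTypeR R).
Proof. by apply: measurable_funD. Qed.

(** The translated measure has the same values on half-open intervals, and these determine Lebesgue
    measure. *)
Lemma lebesgue_shift (a : R) (A : set (measurableTypeR R)) : measurable A ->
  leb A = pushforward leb (fun x : measurableTypeR R => (x + a)%R : measurableTypeR R) A.
Proof.
move=> mA.
pose f := (fun x : measurableTypeR R => (x + a)%R : measurableTypeR R).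
have mf : measurable_fun setT f := measurable_shift a.
pose Pf : {measure set (measurableTypeR R) -> \bar R} := pfm leb mf.
suff H : forall X, ocitv X -> leb X = Pf X by exact: (lebesgue_measure_unique H mA).
move=> X [[b c] /= _ <-].
rewrite /Pf /= /pushforward.
rewrite (_ : _ @^-1` _ = `](b - a)%R, (c - a)%R]%classic); last first.
  apply/seteqP; split => x /=; rewrite !in_itv /= /f; lra.
rewrite !lebesgue_measure_itv /= !lte_fin.
by rewrite ltrD2r; case: ifPn => // _; rewrite -!EFinD; congr EFin; ring.
Qed.

Lemma lebesgue_integral_shift (a : R) (F : R -> \bar R) :
  measurable_fun [set: R] F -> (forall x, 0 <= F x) ->
  \int[leb]_x F (x + a)%R = \int[leb]_x F x.
Proof.
apply: (@mpres_ge0_integral _ _ _ _ _ leb leb (fun x : measurableTypeR R => (x + a)%R : measurableTypeR R)).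
by split; [exact: measurable_shift|move=> A mA; exact/esym/lebesgue_shift].
Qed.

Lemma lebesgue_opp (A : set (measurableTypeR R)) : measurable A ->
  leb A = pushforward leb (fun x : measurableTypeR R => (- x)%R : measurableTypeR R) A.
Proof.
move=> mA.
pose f := (fun x : measurableTypeR R => (- x)%R : measurableTypeR R).
have mf : measurable_fun setT f by exact: oppr_measurable.
pose Pf : {measure set (measurableTypeR R) -> \bar R} := pfm leb mf.
suff H : forall X, ocitv X -> leb X = Pf X by exact: (lebesgue_measure_unique H mA).
move=> X [[b c] /= _ <-].
rewrite /Pf /= /pushforward.
rewrite (_ : _ @^-1` _ = `[(- c)%R, (- b)%R[%classic); last first.
  apply/seteqP; split => x /=; rewrite !in_itv /= /f; lra.
rewrite !lebesgue_measure_itv /= !lte_fin.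
by rewrite ltrN2; case: ifPn => // _; rewrite -!EFinD; congr EFin; ring.
Qed.

Lemma lebesgue_integral_opp (F : R -> \bar R) :
  measurable_fun [set: R] F -> (forall x, 0 <= F x) ->
  \int[leb]_x F (- x)%R = \int[leb]_x F x.
Proof.
apply: (@mpres_ge0_integral _ _ _ _ _ leb leb (fun x : measurableTypeR R => (- x)%R : measurableTypeR R)).
by split; [exact: oppr_measurable|move=> A mA; exact/esym/lebesgue_opp].
Qed.

Definition gam : probability (measurableTypeR R) R := normal_prob 0%R 1%R.
Definition phi (x : R) : R := normal_pdf 0%R 1%R x.

Lemma gamE (A : set R) : gam A = normal_prob 0%R 1%R A.
Proof. by []. Qed.

Lemma phiE x : phi x = (normal_peak 1 * expR (- x ^+ 2 / 2))%R.
Proof.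
rewrite /phi normal_pdfE ?oner_neq0// /normal_fun subr0.
by rewrite expr1n.
Qed.

Lemma phi_ge0 x : (0 <= phi x)%R.
Proof. exact: normal_pdf_ge0. Qed.

Lemma phi_gt0 x : (0 < phi x)%R.
Proof. by rewrite phiE mulr_gt0 ?expR_gt0// normal_peak_gt0 ?oner_neq0. Qed.

Lemma measurable_phi : measurable_fun [set: R] phi.
Proof. exact: measurable_normal_pdf. Qed.

(** The Radon-Nikodym derivative of the normal law and [phi] have equal integrals over every
    measurable set, hence agree almost everywhere. *)
Lemma integral_gam (F : R -> \bar R) :
  measurable_fun [set: R] F -> (forall x, 0 <= F x) ->
  \int[gam]_x F x = \int[leb]_x (F x * (phi x)%:E).
Proof.
move=> mF F0.
have dom : normal_prob (0:R)%R 1%R `<< leb := normal_prob_dominates 0%R 1%R.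
rewrite -(Radon_Nikodym_SigmaFinite.change_of_variables dom F0 measurableT)//.
apply: ae_eq_integral => //.
- apply: emeasurable_funM => //.
  exact: measurable_int (Radon_Nikodym_SigmaFinite.f_integrable dom).
- apply: emeasurable_funM => //.
  by apply/measurable_EFinP; exact: measurable_phi.
apply: ae_eqe_mul2l.
apply: integral_ae_eq => //=.
- exact: Radon_Nikodym_SigmaFinite.f_integrable dom.
- by apply/measurable_EFinP; exact: measurable_phi.
- by move=> E _ mE; rewrite -(Radon_Nikodym_SigmaFinite.f_integral dom).
Qed.

End LebesgueTranslation.

#[global] Opaque gam phi.

(** * Cameron-Martin formula and invariance of the planar Gaussian *)

Section Gauss2D.
Context {R : realType}.
Local Notation leb := (@lebesgue_measure R).
Local Notation Rm := (measurableTypeR R).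
Local Open Scope ereal_scope.

(* Density of N(a, 1) with respect to N(0, 1). *)
Definition cmw (a x : R) : R := expR (a * x - a ^+ 2 / 2).

Lemma cmw_gt0 a x : (0 < cmw a x)%R. Proof. exact: expR_gt0. Qed.

Lemma measurable_cmw a : measurable_fun [set: R] (cmw a).
Proof.
apply: measurableT_comp => //.
by apply: measurable_funB => //; exact: measurable_funM.
Qed.

(** Translation moves the shift onto the density, and [phi (x - a) = phi x * cmw a x]. *)
Lemma cameron_martin_ge0 (a : R) (F : R -> \bar R) :
  measurable_fun [set: R] F -> (forall x, 0 <= F x) ->
  \int[@gam R]_x F (x + a)%R = \int[@gam R]_x (F x * (cmw a x)%:E).
Proof.
move=> mF F0.
have mFa : measurable_fun [set: R] (fun x : R => F (x + a)%R).
  exact: (measurableT_comp mF (measurable_shift a)).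
rewrite integral_gam//.
have mE : measurable_fun [set: R] (EFin \o cmw a).
  by apply/measurable_EFinP; exact: measurable_cmw.
rewrite integral_gam//; last 2 first.
- exact: emeasurable_funM.
- by move=> x; rewrite mule_ge0// lee_fin ltW ?cmw_gt0.
pose G (x : R) := F x * (phi (x - a))%:E.
transitivity (\int[leb]_x G (x + a)%R).
  by apply: eq_integral => x _; rewrite /G addrK.
rewrite lebesgue_integral_shift; last 2 first.
- apply: emeasurable_funM => //; apply/measurable_EFinP.
  by apply: measurableT_comp; [exact: measurable_phi|exact: measurable_funB].
- by move=> x; rewrite mule_ge0// lee_fin phi_ge0.
apply: eq_integral => x _; rewrite /G -muleA -EFinM; congr (_ * EFin _).
rewrite !phiE /cmw [RHS]mulrC -mulrA -expRD; congr (_ * expR _)%R.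
by field.
Qed.

(** Invariance is expressed through integrals of nonnegative functions: composition is then
    immediate, and Tonelli reduces a shear to translations of the line. *)
Definition lebinv (h : Rm * Rm -> Rm * Rm) :=
  measurable_fun setT h /\ forall G : Rm * Rm -> \bar R,
    measurable_fun setT G -> (forall x, 0 <= G x) ->
    \int[leb \x leb]_x G (h x) = \int[leb \x leb]_x G x.

Lemma lebinv_comp h1 h2 : lebinv h1 -> lebinv h2 -> lebinv (h1 \o h2).
Proof.
move=> [m1 i1] [m2 i2]; split; first exact: measurableT_comp.
move=> G mG G0; rewrite -[RHS]i1//.
by apply: (i2 (G \o h1)) => [|x]; [exact: measurableT_comp|exact: G0].
Qed.

Lemma lebinv_shear1 (p : R) : lebinv (fun x => ((x.1 + p * x.2)%R, x.2)).
Proof.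
have mh : measurable_fun setT (fun x : Rm * Rm => ((x.1 + p * x.2)%R, x.2) : Rm * Rm).
  apply: measurable_fun_pair => //; apply: measurable_funD => //.
  exact: measurable_funM.
split => // G mG G0.
rewrite fubini_tonelli2; [|exact: measurableT_comp|by move=> x; exact: G0].
rewrite [RHS]fubini_tonelli2; [|exact: mG|exact: G0]; apply: eq_integral => y _.
rewrite /fubini_G /=.
apply: (@lebesgue_integral_shift R (p * y)%R (fun x => G (x, y))) => //.
by apply: measurableT_comp => //; exact: measurable_pair2.
Qed.

Lemma lebinv_shear2 (p : R) : lebinv (fun x => (x.1, (x.2 + p * x.1)%R)).
Proof.
have mh : measurable_fun setT (fun x : Rm * Rm => (x.1, (x.2 + p * x.1)%R) : Rm * Rm).
  apply: measurable_fun_pair => //; apply: measurable_funD => //.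
  exact: measurable_funM.
split => // G mG G0.
rewrite fubini_tonelli1; [|exact: measurableT_comp|by move=> x; exact: G0].
rewrite [RHS]fubini_tonelli1; [|exact: mG|exact: G0]; apply: eq_integral => x _.
rewrite /fubini_F /=.
apply: (@lebesgue_integral_shift R (p * x)%R (fun y => G (x, y))) => //.
by apply: measurableT_comp => //; exact: measurable_pair1.
Qed.

Lemma lebinv_opp1 : lebinv (fun x => ((- x.1)%R, x.2)).
Proof.
have mh : measurable_fun setT (fun x : Rm * Rm => ((- x.1)%R, x.2) : Rm * Rm).
  by apply: measurable_fun_pair => //; apply: measurableT_comp.
split => // G mG G0.
rewrite fubini_tonelli2; [|exact: measurableT_comp|by move=> x; exact: G0].
rewrite [RHS]fubini_tonelli2; [|exact: mG|exact: G0]; apply: eq_integral => y _.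
rewrite /fubini_G /=.
apply: (@lebesgue_integral_opp R (fun x => G (x, y))) => //.
by apply: measurableT_comp => //; exact: measurable_pair2.
Qed.

Lemma lebinv_opp2 : lebinv (fun x => (x.1, (- x.2)%R)).
Proof.
have mh : measurable_fun setT (fun x : Rm * Rm => (x.1, (- x.2)%R) : Rm * Rm).
  by apply: measurable_fun_pair => //; apply: measurableT_comp.
split => // G mG G0.
rewrite fubini_tonelli1; [|exact: measurableT_comp|by move=> x; exact: G0].
rewrite [RHS]fubini_tonelli1; [|exact: mG|exact: G0]; apply: eq_integral => x _.
rewrite /fubini_F /=.
apply: (@lebesgue_integral_opp R (fun y => G (x, y))) => //.
by apply: measurableT_comp => //; exact: measurable_pair1.
Qed.

(** The matrix with rows [(C, S)] and [(S, -C)]. When [C^2 + S^2 = 1] it is a reflection, preferred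
    to a rotation because it is its own inverse. *)
Definition refl2 (C S : R) (x : Rm * Rm) : Rm * Rm :=
  ((C * x.1 + S * x.2)%R, (S * x.1 - C * x.2)%R).

Lemma measurable_refl2 C S : measurable_fun setT (refl2 C S).
Proof.
apply: measurable_fun_pair; [apply: measurable_funD|apply: measurable_funB];
  exact: measurable_funM.
Qed.

Lemma lebinv_refl2 C S : (C ^+ 2 + S ^+ 2 = 1)%R -> lebinv (refl2 C S).
Proof.
move=> CS1.
(* The shear coefficient below divides by S; for [S = 0] only sign changes remain. *)
have [S0|S0] := eqVneq S 0%R.
  have : (C == 1)%R || (C == -1)%R.
    by rewrite -eqf_sqr; apply/eqP; move: CS1; rewrite S0; nra.
  move=> /orP[] /eqP ->.
    rewrite (_ : refl2 _ _ = (fun x => (x.1, (- x.2)%R))); first exact: lebinv_opp2.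
    by apply/funext => -[x y]; rewrite /refl2 S0 /=; congr pair; ring.
  rewrite (_ : refl2 _ _ = (fun x => ((- x.1)%R, x.2))); first exact: lebinv_opp1.
  by apply/funext => -[x y]; rewrite /refl2 S0 /=; congr pair; ring.
(* The reflection is a sign change followed by three shears. *)
pose p : R := ((C - 1) / S)%R.
have sh := lebinv_comp (lebinv_shear1 p) (lebinv_comp (lebinv_shear2 S)
  (lebinv_comp (lebinv_shear1 p) lebinv_opp2)).
move: sh; set h := (X in lebinv X) => sh; suff -> : refl2 C S = h by [].
apply/funext => -[x y]; rewrite /refl2 /h /= /p.
have C2 : (C ^+ 2 = 1 - S ^+ 2)%R by rewrite -CS1; ring.
congr pair.
  transitivity ((C * S * x - (C^+2 - 1) * y) / S)%R; last by field.
  by rewrite C2; field.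
by field.
Qed.

Lemma integral_gam2 (F : Rm * Rm -> \bar R) :
  measurable_fun setT F -> (forall x, 0 <= F x) ->
  \int[@gam R \x @gam R]_x F x =
  \int[leb \x leb]_x (F x * (phi x.1 * phi x.2)%:E).
Proof.
move=> mF F0.
have mp : measurable_fun [set: Rm] (@phi R) := @measurable_phi R.
have mp1 : measurable_fun setT (fun x : Rm * Rm => (phi x.1)%R).
  exact: measurableT_comp.
have mp2 : measurable_fun setT (fun x : Rm * Rm => (phi x.2)%R).
  exact: measurableT_comp.
rewrite fubini_tonelli1// [RHS]fubini_tonelli1//; first last.
- by move=> x; rewrite mule_ge0// lee_fin mulr_ge0 ?phi_ge0.
- apply: emeasurable_funM => //; apply/measurable_EFinP.
  exact: measurable_funM.
rewrite integral_gam; last 2 first.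
- exact: measurable_fun_fubini_tonelli_F.
- by move=> x; apply: integral_ge0 => y _.
apply: eq_integral => x _; rewrite /fubini_F /=.
have mFx : measurable_fun [set: R] (fun y : R => F (x, y)).
  by apply: measurableT_comp => //; exact: measurable_pair1.
rewrite integral_gam// muleC -ge0_integralZl//; first last.
- by rewrite lee_fin phi_ge0.
- by move=> y _; rewrite mule_ge0// lee_fin phi_ge0.
- by apply: emeasurable_funM => //; apply/measurable_EFinP.
by apply: eq_integral => y _; rewrite muleCA -EFinM.
Qed.

(** The density of the pair depends on [x^2 + y^2] alone, and planar Lebesgue measure is invariant
    under the reflection. *)
Lemma gam2_refl C S : (C ^+ 2 + S ^+ 2 = 1)%R ->
  mpres (@gam R \x @gam R) (@gam R \x @gam R) (refl2 C S).
Proof.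
move=> CS1; have mr := measurable_refl2 C S; split; [exact: mr|move=> A mA].
have mrA : measurable (refl2 C S @^-1` A) by rewrite -[X in measurable X]setTI; exact: mr.
rewrite -(setIT (_ @^-1` _)) -[X in _ = _ X]setIT.
rewrite -[LHS](@integral_indic _ _ _ (@gam R \x @gam R) setT measurableT); last exact: mrA.
rewrite -[RHS](@integral_indic _ _ _ (@gam R \x @gam R) setT measurableT); last exact: mA.
have mi B : measurable B -> measurable_fun setT (fun x : Rm * Rm => (\1_B x : R)%:E).
  by move=> mB; apply/measurable_EFinP; exact: measurable_indic.
have i0 B : forall x : Rm * Rm, 0 <= (\1_B x : R)%:E by move=> x; rewrite lee_fin.
rewrite integral_gam2; [|exact: mi|exact: i0].
rewrite integral_gam2; [|exact: mi|exact: i0].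
have [_ inv] := lebinv_refl2 CS1.
rewrite -[RHS]inv; last 2 first.
- apply: emeasurable_funM => //; first exact: mi.
  apply/measurable_EFinP; apply: measurable_funM; apply: measurableT_comp => //; exact: measurable_phi.
- by move=> x; rewrite mule_ge0// lee_fin mulr_ge0 ?phi_ge0.
apply: eq_integral => -[x y] _; congr (_ * _%:E).
rewrite !phiE /= -!mulrA; congr (_ * _)%R.
rewrite mulrCA [RHS]mulrCA; congr (_ * _)%R; rewrite -!expRD; congr expR.
transitivity (- ((C^+2 + S^+2) * (x^+2 + y^+2)) / 2)%R; last by field.
by rewrite CS1; field.
Qed.

End Gauss2D.

(** * Expectations of bounded functions *)

Section Ex.
Context d (T : measurableType d) (R : realType).
Variable P : probability T R.
Implicit Types F G : T -> R.

Definition itg F := P.-integrable setT (EFin \o F).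
(** [fine] sends an infinite integral to 0, so [Ex] is total and [Ex_ge0] needs no integrability. *)
Definition Ex F : R := fine (\int[P]_x (F x)%:E)%E.
(** The bound holds everywhere, not just almost everywhere, so each section of such a function is
    again one and Fubini needs no exceptional sets. *)
Definition bm F := measurable_fun setT F /\ exists C, forall x, `|F x| <= C.

Lemma ExE F : itg F -> (\int[P]_x (F x)%:E)%E = (Ex F)%:E.
Proof. by move=> iF; rewrite /Ex fineK//; exact: integrable_fin_num. Qed.

Lemma itg_measurable F : itg F -> measurable_fun setT F.
Proof. by move=> /measurable_int /measurable_EFinP. Qed.

Lemma itg_le F G : measurable_fun setT F -> (forall x, `|F x| <= G x) ->
  itg G -> itg F.
Proof.
move=> mF FG; apply: le_integrable => //; first exact/measurable_EFinP.
by move=> x _ /=; rewrite lee_fin (le_trans (FG x))// ler_norm.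
Qed.

Lemma itg_cst (c : R) : itg (fun=> c).
Proof.
apply: measurable_bounded_integrable => //.
  by apply: (le_lt_trans (@probability_le1 _ _ _ P setT measurableT)); exact: ltry.
exact: bounded_cst.
Qed.

Lemma bm_itg F : bm F -> itg F.
Proof. by move=> [mF [C FC]]; apply: (itg_le mF FC); exact: itg_cst. Qed.

Lemma itgD F G : itg F -> itg G -> itg (fun x => F x + G x).
Proof. by move=> iF iG; exact: (integrableD measurableT iF iG). Qed.

Lemma itgN F : itg F -> itg (fun x => - F x).
Proof. by move=> iF; exact: (integrableN iF). Qed.

Lemma itgB F G : itg F -> itg G -> itg (fun x => F x - G x).
Proof. by move=> iF iG; apply: itgD => //; exact: itgN. Qed.

Lemma itgZ F (c : R) : itg F -> itg (fun x => c * F x).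
Proof. by move=> iF; exact: (integrableZl measurableT c iF). Qed.

Lemma eq_itg F G : F =1 G -> itg F -> itg G.
Proof. by move=> /funext ->. Qed.

Lemma itg_sum (I : finType) (F : I -> T -> R) : (forall i, itg (F i)) ->
  itg (fun x => \sum_i F i x).
Proof.
move=> iF.
rewrite (_ : itg _ = P.-integrable setT (fun x => \sum_i (F i x)%:E)%E).
  by apply: (integrable_sum measurableT) => i _; exact: iF.
by congr (P.-integrable setT _); apply/funext => x /=; rewrite sumEFin.
Qed.

Lemma eq_Ex F G : F =1 G -> Ex F = Ex G.
Proof. by move=> /funext ->. Qed.

Lemma ExD F G : itg F -> itg G -> Ex (fun x => F x + G x) = Ex F + Ex G.
Proof. by move=> iF iG; exact: (RintegralD measurableT iF iG). Qed.

Lemma ExZ F (c : R) : itg F -> Ex (fun x => c * F x) = c * Ex F.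
Proof. by move=> iF; exact: (RintegralZl c measurableT iF). Qed.

Lemma ExN F : itg F -> Ex (fun x => - F x) = - Ex F.
Proof.
move=> iF; rewrite -mulN1r -ExZ//; apply: eq_Ex => x; exact/esym/mulN1r.
Qed.

Lemma ExB F G : itg F -> itg G -> Ex (fun x => F x - G x) = Ex F - Ex G.
Proof. by move=> iF iG; rewrite ExD ?ExN//; exact: itgN. Qed.

Lemma Ex_sum (I : finType) (F : I -> T -> R) : (forall i, itg (F i)) ->
  Ex (fun x => \sum_i F i x) = \sum_i Ex (F i).
Proof.
move=> iF; rewrite /Ex.
transitivity (fine (\int[P]_x (\sum_(i <- index_enum I) (F i x)%:E))%E).
  by congr fine; apply: eq_integral => x _; rewrite sumEFin.
rewrite (integral_sum measurableT); last by move=> i; exact: iF.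
under eq_bigr do rewrite ExE//.
by rewrite sumEFin.
Qed.

Lemma Ex_cst (c : R) : Ex (fun=> c) = c.
Proof.
have := @integral_cst _ _ _ P setT measurableT c%:E.
by rewrite /Ex => ->; rewrite [X in (_ * X)%E]probability_setT mule1.
Qed.

Lemma Ex_le F G : itg F -> itg G -> (forall x, F x <= G x) -> Ex F <= Ex G.
Proof. by move=> iF iG FG; apply: (le_Rintegral measurableT iF iG) => x _. Qed.

Lemma Ex_ge0 F : (forall x, 0 <= F x) -> 0 <= Ex F.
Proof. by move=> F0; apply: fine_ge0; apply: integral_ge0 => x _; rewrite lee_fin. Qed.

Lemma Ex_norm F : itg F -> `|Ex F| <= Ex (fun x => `|F x|).
Proof. by move=> iF; exact: (le_normr_Rintegral measurableT iF). Qed.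

Lemma itg_norm F : itg F -> itg (fun x => `|F x|).
Proof.
move=> iF; apply: (@eq_itg (fun x => `|F x|)) => //.
exact: (integrable_abse iF).
Qed.

Lemma Ex_bound F C : measurable_fun setT F -> (forall x, `|F x| <= C) -> `|Ex F| <= C.
Proof.
move=> mF FC; have iF : itg F by apply: bm_itg; split => //; exists C.
apply: (le_trans (Ex_norm iF)); rewrite -[leRHS](Ex_cst C).
by apply: Ex_le => //; [exact: itg_norm|exact: itg_cst].
Qed.

Lemma Ex_ae F G : measurable_fun setT F -> measurable_fun setT G ->
  {ae P, forall x, F x = G x} -> Ex F = Ex G.
Proof.
move=> mF mG FG; rewrite /Ex; congr fine.
apply: ae_eq_integral => //; [exact/measurable_EFinP|exact/measurable_EFinP|].
by apply: filterS FG => x /= -> _.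
Qed.

Lemma Ex_eq0_ae F : itg F -> (forall x, 0 <= F x) -> Ex F = 0 ->
  {ae P, forall x, F x = 0}.
Proof.
move=> iF F0 F00.
have /(ae_eq_integral_abs P measurableT (measurable_int _ iF)) : (\int[P]_x `|(EFin \o F) x|)%E = 0%E.
  transitivity (\int[P]_x (F x)%:E)%E; last by rewrite ExE// F00.
  by apply: eq_integral => x _; rewrite gee0_abs// lee_fin.
by apply: filterS => x /(_ I) /= [].
Qed.

Lemma Ex_dct (F_ : nat -> T -> R) F C : (forall n, measurable_fun setT (F_ n)) ->
  measurable_fun setT F -> (forall n x, `|F_ n x| <= C) ->
  {ae P, forall x, F_ n x @[n --> \oo] --> F x} ->
  Ex (F_ n) @[n --> \oo] --> Ex F.
Proof.
move=> mF_ mF FC cv.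
have [|||||iF _ cvI] := @dominated_convergence _ _ _ P setT measurableT
   (fun n => EFin \o F_ n) (EFin \o F) (EFin \o fun=> C).
- by move=> n; exact/measurable_EFinP.
- exact/measurable_EFinP.
- by apply: filterS cv => x cvx _; apply: cvg_EFin => //; exact: nearW.
- exact: itg_cst.
- by apply: aeW => x n _ /=; rewrite lee_fin.
apply: fine_cvg.
by have := cvI; rewrite (ExE iF).
Qed.

Lemma bm_cst (c : R) : bm (fun=> c).
Proof. by split; [exact: measurable_cst|exists `|c|]. Qed.

Lemma bmD F G : bm F -> bm G -> bm (fun x => F x + G x).
Proof.
move=> [mF [C FC]] [mG [D GD]]; split; first exact: measurable_funD.
by exists (C + D) => x; rewrite (le_trans (ler_normD _ _))// lerD.
Qed.

Lemma bmM F G : bm F -> bm G -> bm (fun x => F x * G x).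
Proof.
move=> [mF [C FC]] [mG [D GD]]; split; first exact: measurable_funM.
by exists (C * D) => x; rewrite normrM ler_pM.
Qed.

Lemma bmN F : bm F -> bm (fun x => - F x).
Proof.
move=> [mF [C FC]]; split; first exact: measurable_funN.
by exists C => x; rewrite normrN.
Qed.

Lemma bmB F G : bm F -> bm G -> bm (fun x => F x - G x).
Proof. by move=> bF bG; apply: bmD => //; exact: bmN. Qed.

Lemma bmZ F (c : R) : bm F -> bm (fun x => c * F x).
Proof. by move=> bF; apply: bmM => //; exact: bm_cst. Qed.

Lemma eq_bm F G : F =1 G -> bm F -> bm G.
Proof. by move=> /funext ->. Qed.

Lemma bm_sum (I : finType) (F : I -> T -> R) : (forall i, bm (F i)) ->
  bm (fun x => \sum_i F i x).
Proof.
move=> bF.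
suff H (s : seq I) : bm (fun x => \sum_(i <- s) F i x) by exact: H.
elim: s => [|i s IH]; first by apply: eq_bm (bm_cst 0) => x; rewrite big_nil.
by apply: eq_bm (bmD (bF i) IH) => x; rewrite big_cons.
Qed.

Lemma itg_bmM B F : bm B -> itg F -> itg (fun x => B x * F x).
Proof.
move=> [mB [C BC]] iF; apply: (@itg_le _ (fun x => C * `|F x|)).
- by apply: measurable_funM => //; exact: itg_measurable iF.
- by move=> x; rewrite normrM; exact: ler_wpM2r.
- by apply/itgZ/itg_norm.
Qed.

Lemma bm_indic (A : set T) : measurable A -> bm (\1_A : T -> R).
Proof.
move=> mA; split; first exact: measurable_indic.
by exists 1 => x; rewrite indicE; case: (_ \in _); rewrite ?normr1 ?normr0.
Qed.

Lemma Ex_indic (A : set T) : measurable A -> P A = (Ex (\1_A))%:E.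
Proof.
move=> mA; rewrite -ExE; last by apply: bm_itg; exact: bm_indic.
by rewrite integral_indic ?setIT.
Qed.

End Ex.

Lemma bm_comp d d' (T1 : measurableType d) (T2 : measurableType d') (R : realType)
  (F : T2 -> R) (h : T1 -> T2) :
  bm F -> measurable_fun setT h -> bm (fun x => F (h x)).
Proof.
move=> [mF [C FC]] mh; split; first exact: (measurableT_comp mF mh).
by exists C.
Qed.

Section ExPres.
Context d d' (T1 : measurableType d) (T2 : measurableType d') (R : realType).
Variables (P : probability T1 R) (Q : probability T2 R) (h : T1 -> T2).

Lemma mpres_itg F : mpres P Q h -> itg Q F -> itg P (fun x => F (h x)).
Proof.
move=> pf iF; have mF := itg_measurable iF; have [mh _] := pf.
apply/integrableP; split.
  by apply/measurable_EFinP; exact: (measurableT_comp mF mh).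
move/integrableP: iF => [_]; apply: le_lt_trans.
rewrite (mpres_ge0_integral pf (F := fun x => `|(F x)%:E|%E)) //.
apply: measurableT_comp => //; exact/measurable_EFinP.
Qed.

Lemma mpres_Ex F : mpres P Q h -> itg Q F -> Ex P (fun x => F (h x)) = Ex Q F.
Proof.
move=> pf iF; have mF := itg_measurable iF; have [mh fE] := pf.
rewrite /Ex; congr fine.
transitivity (\int[pushforward P h]_x (F x)%:E)%E.
  rewrite (integral_pushforward mh)//; first exact/measurable_EFinP.
  exact: (mpres_itg pf iF).
by apply: (@eq_measure_integral _ _ _ setT Q (pfm P mh)) => A mA _; exact: fE.
Qed.

(** Indicators are bounded, so expectations decide. This lets invariance be proved by Fubini
    calculations with functions. *)
Lemma Ex_mpres : measurable_fun setT h ->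
  (forall F, bm F -> Ex P (fun x => F (h x)) = Ex Q F) -> mpres P Q h.
Proof.
move=> mh H; split => // A mA.
have mhA : measurable (h @^-1` A) by rewrite -[X in measurable X]setTI; exact: mh.
apply: etrans (Ex_indic P mhA) _; apply: etrans _ (esym (Ex_indic Q mA)).
by rewrite -H//; exact: bm_indic.
Qed.

Lemma mpres_ae (A : T2 -> Prop) : mpres P Q h ->
  {ae Q, forall x, A x} -> {ae P, forall x, A (h x)}.
Proof.
move=> [mh fE] [B [mB B0 AB]]; exists (h @^-1` B); split.
- by rewrite -[X in measurable X]setTI; exact: mh.
- exact: etrans (fE B mB) B0.
- by move=> x /= nA; apply: AB.
Qed.

End ExPres.

Lemma mpres_id d (T : measurableType d) (R : realType) (P : {measure set T -> \bar R}) : mpres P P id.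
Proof. by split. Qed.

Lemma mpres_comp d1 d2 d3 (T1 : measurableType d1) (T2 : measurableType d2)
  (T3 : measurableType d3) (R : realType) (P1 : {measure set T1 -> \bar R})
  (P2 : {measure set T2 -> \bar R}) (P3 : {measure set T3 -> \bar R})
  (f : T2 -> T3) (g : T1 -> T2) :
  mpres P2 P3 f -> mpres P1 P2 g -> mpres P1 P3 (fun x => f (g x)).
Proof.
move=> [mf fE] [mg gE]; split; first exact: (measurableT_comp mf mg).
move=> A mA; rewrite -fE// -gE//.
by rewrite -[X in measurable X]setTI; exact: mf.
Qed.

(** * Fubini for bounded functions and for null sets *)

Section ExFubini.
Context d d' (T1 : measurableType d) (T2 : measurableType d') (R : realType).
Variables (P : probability T1 R) (Q : probability T2 R).
Implicit Types F : T1 * T2 -> R.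

Lemma itg_fub F : itg (P \x Q)%E F -> (forall x, itg Q (fun y => F (x, y))) ->
  itg P (fun x => Ex Q (fun y => F (x, y))).
Proof.
move=> iF iFx; have := integrable_fubini_F iF.
by congr (P.-integrable setT _); apply/funext => x; rewrite /fubini_F /= (ExE (iFx x)).
Qed.

Lemma Ex_fub_itg F : itg (P \x Q)%E F -> (forall x, itg Q (fun y => F (x, y))) ->
  Ex (P \x Q)%E F = Ex P (fun x => Ex Q (fun y => F (x, y))).
Proof.
move=> iF iFx; rewrite /Ex -(integral12_prod_meas1 iF); congr fine.
by apply: eq_integral => x _; rewrite /fubini_F /= (ExE (iFx x)).
Qed.

Lemma bm_section1 F x : bm F -> bm (fun y => F (x, y)).
Proof. by move=> bF; apply: (bm_comp bF); exact: measurable_pair1. Qed.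

Lemma bm_section2 F y : bm F -> bm (fun x => F (x, y)).
Proof. by move=> bF; apply: (bm_comp bF); exact: measurable_pair2. Qed.

Lemma Ex_fub F : bm F ->
  Ex (P \x Q)%E F = Ex P (fun x => Ex Q (fun y => F (x, y))).
Proof.
move=> bF; apply: Ex_fub_itg; first exact: bm_itg.
by move=> x; apply: bm_itg; exact: bm_section1.
Qed.

Lemma Ex_fub2 F : bm F ->
  Ex (P \x Q)%E F = Ex Q (fun y => Ex P (fun x => F (x, y))).
Proof.
move=> bF; have iF : itg (P \x Q)%E F by exact: bm_itg.
rewrite /Ex -(integral21_prod_meas1 iF); congr fine.
apply: eq_integral => y _; rewrite /fubini_G /= -ExE//.
by apply: bm_itg; exact: bm_section2.
Qed.

Lemma Ex_swap F : bm F ->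
  Ex P (fun x => Ex Q (fun y => F (x, y))) = Ex Q (fun y => Ex P (fun x => F (x, y))).
Proof. by move=> bF; rewrite -Ex_fub// Ex_fub2. Qed.

Lemma bm_fub1 F : bm F -> bm (fun x => Ex Q (fun y => F (x, y))).
Proof.
move=> bF; have [mF [C FC]] := bF; split.
  apply: itg_measurable; apply: (itg_fub (F := F)); first exact: bm_itg.
  by move=> x; apply: bm_itg; exact: bm_section1.
exists C => x; apply: Ex_bound => //.
by have [] := bm_section1 x bF.
Qed.

(** The indicator of the exceptional set has mean zero, so almost all of its sections are null. *)
Lemma ae_fub (A : T1 * T2 -> Prop) : {ae (P \x Q)%E, forall z, A z} ->
  {ae P, forall x, {ae Q, forall y, A (x, y)}}.
Proof.
move=> [B [mB B0 AB]].
have bB : bm (\1_B : _ -> R) by exact: bm_indic.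
have iB : itg P (fun x => Ex Q (fun y => \1_B (x, y))) by apply: bm_itg; exact: bm_fub1.
have /(Ex_eq0_ae iB) : Ex P (fun x => Ex Q (fun y => \1_B (x, y))) = 0.
  rewrite -Ex_fub//; apply: EFin_inj; exact: etrans (esym (Ex_indic (P \x Q)%E mB)) B0.
move=> H; have : {ae P, forall x, Ex Q (fun y => \1_B (x, y)) = 0}.
  by apply: H => x; apply: Ex_ge0 => y; rewrite indicE.
apply: filterS => x H0; exists (xsection B x); split.
- exact: measurable_xsection.
- apply: etrans (Ex_indic Q (measurable_xsection _ mB)) _; congr EFin; rewrite -H0.
  by apply: eq_Ex => y; rewrite !indicE mem_xsection.
- by move=> y /= nA; rewrite /xsection /= inE; apply: AB.
Qed.

Lemma mpres_fst : mpres (P \x Q)%E P fst.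
Proof.
apply: Ex_mpres; first exact: measurable_fst.
move=> F bF; rewrite Ex_fub; last by apply: (bm_comp bF); exact: measurable_fst.
by apply: eq_Ex => x /=; exact: Ex_cst.
Qed.

Lemma mpres_snd : mpres (P \x Q)%E Q snd.
Proof.
apply: Ex_mpres; first exact: measurable_snd.
move=> F bF; rewrite Ex_fub2; last by apply: (bm_comp bF); exact: measurable_snd.
by apply: eq_Ex => x /=; exact: Ex_cst.
Qed.

End ExFubini.

#[global] Opaque Ex.

(** * Gaussian vectors and correlated pairs *)

Lemma measurable_mktuple d (T : measurableType d) (R : realType) n
    (g : 'I_n -> T -> R) : (forall i, measurable_fun setT (g i)) ->
  measurable_fun setT (fun x => [tuple g i x | i < n] : n.-tuple R).
Proof.
move=> mg; apply/measurable_fun_tnthP => i.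
rewrite (_ : _ \o _ = g i)//.
by apply/funext => x /=; rewrite tnth_mktuple.
Qed.

Lemma measurable_tnth_comp d (T : measurableType d) (R : realType) n
    (g : T -> n.-tuple R) (i : 'I_n) : measurable_fun setT g ->
  measurable_fun setT (fun x => tnth (g x) i).
Proof. by move=> mg; apply: (measurableT_comp (measurable_tnth i) mg). Qed.

(** * The standard Gaussian on boxes; resampling one coordinate *)

Section Boxes.
Context {R : realType} {n : nat}.
Local Notation gam := (@gam R).

Definition box (A : 'I_n -> set R) : set (n.-tuple R) :=
  [set x | forall i, A i (tnth x i)].

Lemma measurable_box A : (forall i, measurable (A i)) -> measurable (box A).
Proof.
move=> mA; rewrite (_ : box A = \bigcap_(i in [set: 'I_n]) ((fun x : n.-tuple R => tnth x i) @^-1` A i)).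
  apply: fin_bigcap_measurable => // i _; rewrite -[X in measurable X]setTI.
  exact: (measurable_tnth i).
by apply/seteqP; split => [x H i _|x H i]; [exact: H|exact: H].
Qed.

Lemma box_generates :
  (measurable : set (set (n.-tuple R))) =
  <<s [set B | exists2 A, (forall i, measurable (A i)) & B = box A] >>.
Proof.
apply/seteqP; split; last first.
  apply: smallest_sub; first exact: sigma_algebra_measurable.
  by move=> _ [A mA ->]; exact: measurable_box.
apply: smallest_sub; first exact: smallest_sigma_algebra.
move=> B; rewrite -bigcup_seq/= => -[i _ [A mA <-]].
apply: sub_sigma_algebra; exists (fun j => if j == i then A else setT).
  by move=> j; case: ifP.
rewrite setTI; apply/seteqP; split => [x /= Ax j|x /(_ i)]; last by rewrite eqxx.
by case: eqP => [->|].
Qed.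

Lemma std_gaussian_gam (P : probability (n.-tuple R) R) : std_gaussian P ->
  forall A, (forall i, measurable (A i)) -> P (box A) = (\prod_(i < n) gam (A i))%E.
Proof. by move=> gP A mA; rewrite gP//; apply: eq_bigr => i _; rewrite gamE. Qed.

(** Boxes are stable under intersection and generate the sigma-algebra. Hence [std_gaussian], which
    speaks of boxes only, determines the measure. *)
Lemma box_unique (P Q : {measure set (n.-tuple R) -> \bar R}) :
  (P setT < +oo)%E ->
  (forall A, (forall i, measurable (A i)) -> P (box A) = Q (box A)) ->
  forall B, measurable B -> P B = Q B.
Proof.
move=> P1 PQ B mB.
apply: (measure_unique [set B | exists2 A, (forall i, measurable (A i)) & B = box A] (fun=> setT)) => //.
- exact: box_generates.
- move=> _ _ [A mA ->] [A' mA' ->]; exists (fun i => A i `&` A' i).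
    by move=> i; exact: measurableI.
  by apply/seteqP; split => [x [H H'] i|x H]; [split|split => i; have [] := H i].
- by move=> _; exists (fun=> setT) => //; apply/seteqP; split => // x _ i.
- by apply/seteqP; split => // x _; exists 0%N.
- by move=> _ [A mA ->]; exact: PQ.
Qed.

Definition upd (x : n.-tuple R) (i : 'I_n) (a : R) : n.-tuple R :=
  [tuple if l == i then a else tnth x l | l < n].

Lemma tnth_upd x i a l : tnth (upd x i a) l = if l == i then a else tnth x l.
Proof. by rewrite tnth_mktuple. Qed.

Lemma upd_upd x i a b : upd (upd x i a) i b = upd x i b.
Proof. by apply: eq_from_tnth => l; rewrite !tnth_upd; case: (l == i). Qed.

Lemma measurable_upd d (T : measurableType d) (f : T -> n.-tuple R) (g : T -> R) i :
  measurable_fun setT f -> measurable_fun setT g ->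
  measurable_fun setT (fun x => upd (f x) i (g x)).
Proof.
move=> mf mg; apply: measurable_mktuple => l.
by case: (l == i) => //; exact: measurable_tnth_comp.
Qed.

(** Both laws give a box the same product of one-dimensional masses. Independence of the coordinates
    enters the proof here, so R^n never has to be split as a product. *)
Lemma resample (P : probability (n.-tuple R) R) (i : 'I_n) : std_gaussian P ->
  mpres (P \x gam)%E P (fun p => upd p.1 i p.2).
Proof.
move=> gP.
have mu : measurable_fun setT (fun p : n.-tuple R * measurableTypeR R => upd p.1 i p.2).
  exact: (measurable_upd i measurable_fst measurable_snd).
split; first exact: mu.
move=> B mB.
have := @box_unique (pfm (P \x gam)%E mu) P; apply => //.
  rewrite /pfm /= /pushforward preimage_setT.
  by rewrite [X in (X < _)%E]probability_setT; exact: ltry.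
move=> A mA.
(* [A'] drops the constraint on coordinate [i], whose old value gets overwritten. *)
pose A' j := if j == i then setT else A j.
have mA' j : measurable (A' j) by rewrite /A'; case: ifP.
rewrite [RHS]std_gaussian_gam//.
transitivity ((P \x gam)%E (box A' `*` A i)).
  congr ((P \x gam)%E _).
  apply/seteqP; split => [[x a] /= H|[x a] /= [H Aa]].
    split => [j|]; rewrite /A'; last by have := H i; rewrite tnth_upd eqxx.
    by have := H j; rewrite tnth_upd; case: ifP.
  by move=> j; have := H j; rewrite /A' tnth_upd; case: eqP => [->|].
transitivity (P (box A') * gam (A i))%E.
  exact: (product_measure1E P gam (measurable_box mA') (mA i)).
rewrite std_gaussian_gam// [RHS](bigD1 i)//= (bigD1 i)//= {1}/A' eqxx.
rewrite [X in (X * _ * _)%E](_ : _ = 1%E); last exact: probability_setT.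
rewrite mul1e muleC; congr (_ * _)%E; apply: eq_bigr => j /negbTE ji.
by rewrite /A' ji.
Qed.

Lemma Ex_resample (P : probability (n.-tuple R) R) (i : 'I_n) (F : n.-tuple R -> R) :
  std_gaussian P -> bm F ->
  Ex P (fun x => Ex gam (fun a => F (upd x i a))) = Ex P F.
Proof.
move=> gP bF; have rP := resample i gP.
rewrite -[RHS](mpres_Ex rP (bm_itg P bF)) Ex_fub//.
by apply: (bm_comp bF); have [] := rP.
Qed.

End Boxes.

Section Curried.
Context d d' (T1 : measurableType d) (T2 : measurableType d') (R : realType).
Variables (P : probability T1 R) (Q : probability T2 R).
Implicit Types G : T1 -> T2 -> R.

(* The statement involves no measure on T1; Fubini is applied with a Dirac mass. *)
Lemma bm_Ex G : bm (fun p : T1 * T2 => G p.1 p.2) -> bm (fun x => Ex Q (G x)).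
Proof. exact: (@bm_fub1 _ _ _ _ _ [the probability _ _ of dirac point] Q). Qed.

Lemma Ex_prod G : bm (fun p : T1 * T2 => G p.1 p.2) ->
  Ex (P \x Q)%E (fun p => G p.1 p.2) = Ex P (fun x => Ex Q (G x)).
Proof. by move=> bG; rewrite Ex_fub. Qed.

Lemma Ex_exch G : bm (fun p : T1 * T2 => G p.1 p.2) ->
  Ex P (fun x => Ex Q (G x)) = Ex Q (fun y => Ex P (G^~ y)).
Proof. by move=> bG; rewrite (Ex_swap P Q bG). Qed.

End Curried.

Lemma measurable_fst_comp d d1 d2 (T : measurableType d) (T1 : measurableType d1)
    (T2 : measurableType d2) (g : T -> T1 * T2) :
  measurable_fun setT g -> measurable_fun setT (fun x => (g x).1).
Proof. by move=> mg; exact: (measurableT_comp measurable_fst mg). Qed.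

Lemma measurable_snd_comp d d1 d2 (T : measurableType d) (T1 : measurableType d1)
    (T2 : measurableType d2) (g : T -> T1 * T2) :
  measurable_fun setT g -> measurable_fun setT (fun x => (g x).2).
Proof. by move=> mg; exact: (measurableT_comp measurable_snd mg). Qed.

Lemma bm_comp2 d d1 d2 (T : measurableType d) (T1 : measurableType d1)
    (T2 : measurableType d2) (R : realType) (G : T1 -> T2 -> R)
    (h1 : T -> T1) (h2 : T -> T2) :
  bm (fun p : T1 * T2 => G p.1 p.2) -> measurable_fun setT h1 ->
  measurable_fun setT h2 -> bm (fun x => G (h1 x) (h2 x)).
Proof.
move=> bG m1 m2; apply: (@bm_comp _ _ _ _ _ _ (fun x => (h1 x, h2 x)) bG).
exact: measurable_fun_pair.
Qed.

Section Mix.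
Context {R : realType} {n : nat}.
Implicit Types (a b c : 'I_n -> R) (x z w : n.-tuple R).

(** The weights depend on the coordinate, so that one coordinate can be given a correlation of its
    own. *)
Definition mix a b x z : n.-tuple R :=
  [tuple a i * tnth x i + b i * tnth z i | i < n].
Definition scl a x : n.-tuple R := [tuple a i * tnth x i | i < n].

Lemma tnth_mix a b x z i : tnth (mix a b x z) i = a i * tnth x i + b i * tnth z i.
Proof. by rewrite tnth_mktuple. Qed.

Lemma tnth_scl a x i : tnth (scl a x) i = a i * tnth x i.
Proof. by rewrite tnth_mktuple. Qed.

Lemma measurable_mix d (T : measurableType d) a b (f g : T -> n.-tuple R) :
  measurable_fun setT f -> measurable_fun setT g ->
  measurable_fun setT (fun t => mix a b (f t) (g t)).
Proof.
move=> mf mg; apply: measurable_mktuple => i.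
by apply: measurable_funD; apply: measurable_funM; [exact: measurable_cst|exact: measurable_tnth_comp| exact: measurable_cst|exact: measurable_tnth_comp].
Qed.

Lemma measurable_scl d (T : measurableType d) a (f : T -> n.-tuple R) :
  measurable_fun setT f -> measurable_fun setT (fun t => scl a (f t)).
Proof.
move=> mf; apply: measurable_mktuple => i.
by apply: measurable_funM; [exact: measurable_cst|exact: measurable_tnth_comp].
Qed.

End Mix.

Ltac measur := repeat (lazymatch goal with
  | |- measurable_fun _ (fun x => x) => exact: measurable_id
  | |- measurable_fun _ (fun x => (@?a x, @?b x)) => apply: measurable_fun_pair
  | |- measurable_fun _ (fun x => upd (@?a x) _ (@?b x)) => apply: measurable_upd
  | |- measurable_fun _ (fun x => mix _ _ (@?a x) (@?b x)) => apply: measurable_mix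
  | |- measurable_fun _ (fun x => scl _ (@?a x)) => apply: measurable_scl
  | |- measurable_fun _ (fun x => tnth (@?a x) _) => apply: measurable_tnth_comp
  | |- measurable_fun _ (fun x => fst x) => exact: measurable_fst
  | |- measurable_fun _ (fun x => snd x) => exact: measurable_snd
  | |- measurable_fun _ (fun x => fst (@?a x)) => apply: measurable_fst_comp
  | |- measurable_fun _ (fun x => snd (@?a x)) => apply: measurable_snd_comp
  | |- measurable_fun _ (fun x => @?a x + - @?b x) => apply: measurable_funB
  | |- measurable_fun _ (fun x => @?a x + @?b x) => apply: measurable_funD
  | |- measurable_fun _ (fun x => @?a x * @?b x) => apply: measurable_funM
  | |- measurable_fun _ (fun x => - @?a x) => apply: measurable_funN
  | |- measurable_fun _ fst => exact: measurable_fst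
  | |- measurable_fun _ snd => exact: measurable_snd
  | |- measurable_fun _ (scl ?a) => exact: (measurable_scl a (@measurable_id _ _ _))
  | |- measurable_fun _ (mix ?a ?b ?x) =>
      exact: (measurable_mix a b (measurable_cst x) (@measurable_id _ _ _))
  | |- measurable_fun _ (upd ?x ?i) =>
      exact: (measurable_upd i (measurable_cst x) (@measurable_id _ _ _))
  | |- _ => first [assumption | exact: measurable_cst]
  end).

(** * Orthogonal mixing of two independent Gaussian vectors *)

Section Reflections.
Context {R : realType} {n : nat}.
Variable P : probability (n.-tuple R) R.
Hypothesis gP : std_gaussian P.
Local Notation gam := (@gam R).
Local Notation Rm := (measurableTypeR R).
Local Notation X := (n.-tuple R).

Lemma Ex_refl2 (C S : R) (G : R -> R -> R) : C ^+ 2 + S ^+ 2 = 1 ->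
  bm (fun p : Rm * Rm => G p.1 p.2) ->
  Ex gam (fun a => Ex gam (fun b => G (C * a + S * b) (S * a - C * b))) =
  Ex gam (fun a => Ex gam (G a)).
Proof.
move=> CS bG; have pr := gam2_refl CS.
have bG' : bm (fun p : Rm * Rm => G (C * p.1 + S * p.2) (S * p.1 - C * p.2)).
  by apply: (bm_comp2 bG); measur.
rewrite -[RHS](Ex_prod gam gam bG).
rewrite -[LHS](@Ex_prod _ _ _ _ _ gam gam (fun a b => G (C * a + S * b) (S * a - C * b)) bG').
by rewrite -[RHS](mpres_Ex pr (bm_itg _ bG)).
Qed.

Lemma Ex_resample2 (i : 'I_n) (F : X * X -> R) : bm F ->
  Ex (P \x P)%E (fun p => Ex gam (fun a => Ex gam (fun b => F (upd p.1 i a, upd p.2 i b)))) =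
  Ex (P \x P)%E F.
Proof.
move=> bF.
have b4 : bm (fun q : ((X * X) * Rm) * Rm => F (upd q.1.1.1 i q.1.2, upd q.1.1.2 i q.2)).
  by apply: (bm_comp bF); measur.
have b3 : bm (fun q : (X * X) * Rm => Ex gam (fun b => F (upd q.1.1 i q.2, upd q.1.2 i b))).
  exact: (bm_Ex gam b4).
have b2 : bm (fun p : X * X => Ex gam (fun a => Ex gam (fun b => F (upd p.1 i a, upd p.2 i b)))).
  exact: (bm_Ex gam b3).
rewrite (Ex_prod P P (G := fun x z => Ex gam (fun a => Ex gam (fun b => F (upd x i a, upd z i b)))) b2).
have bF1 : bm (fun x => Ex P (fun z => F (x, z))) by exact: bm_fub1.
rewrite [RHS](Ex_fub P P bF) -(Ex_resample i gP bF1); apply: eq_Ex => x.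
rewrite (@Ex_exch _ _ _ _ _ P gam (fun z a => Ex gam (fun b => F (upd x i a, upd z i b)))).
  apply: eq_Ex => a; apply: (Ex_resample i gP (F := fun z => F (upd x i a, z))).
  exact: bm_section1.
apply: (@bm_comp _ _ _ _ _ _ (fun q : X * Rm => ((x, q.1), q.2)) b3).
by measur.
Qed.

Definition refl1 (i : 'I_n) (C S : R) (p : X * X) : X * X :=
  (upd p.1 i (C * tnth p.1 i + S * tnth p.2 i), upd p.2 i (S * tnth p.1 i - C * tnth p.2 i)).

Lemma mpres_refl1 i C S : C ^+ 2 + S ^+ 2 = 1 ->
  mpres (P \x P)%E (P \x P)%E (refl1 i C S).
Proof.
move=> CS.
have mr : measurable_fun setT (refl1 i C S) by rewrite /refl1; measur.
apply: (Ex_mpres mr) => F bF.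
have bFr : bm (fun p => F (refl1 i C S p)) by exact: (bm_comp bF).
rewrite -(Ex_resample2 i bFr) -[RHS](Ex_resample2 i bF).
apply: eq_Ex => -[x z] /=.
rewrite -[RHS](@Ex_refl2 C S (fun a b => F (upd x i a, upd z i b)) CS).
  apply: eq_Ex => a; apply: eq_Ex => b; rewrite /refl1 /= !upd_upd !tnth_upd eqxx.
  by [].
by apply: (bm_comp bF); measur.
Qed.

(** Reflecting only the coordinates below [m] interpolates between the identity and the full
    reflection, for an induction on [m]. *)
Definition reflm (C S : 'I_n -> R) (m : nat) (p : X * X) : X * X :=
  ([tuple if (l < m)%N then C l * tnth p.1 l + S l * tnth p.2 l else tnth p.1 l | l < n],
   [tuple if (l < m)%N then S l * tnth p.1 l - C l * tnth p.2 l else tnth p.2 l | l < n]).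

Lemma mpres_reflm C S m : (forall i, C i ^+ 2 + S i ^+ 2 = 1) -> (m <= n)%N ->
  mpres (P \x P)%E (P \x P)%E (reflm C S m).
Proof.
move=> CS; elim: m => [_|m IH mn].
  rewrite (_ : reflm _ _ _ = id); first exact: mpres_id.
  by apply/funext => -[x z]; rewrite /reflm; congr pair; apply: eq_from_tnth => l; rewrite tnth_mktuple.
pose i := Ordinal mn.
have E (l : 'I_n) : (l < m.+1)%N = (l == i) || (l < m)%N.
  by rewrite ltnS leq_eqVlt -val_eqE.
have := mpres_comp (mpres_refl1 i (CS i)) (IH (ltnW mn)).
congr (mpres _ _ _); apply/funext => -[x z]; rewrite /refl1 /reflm /=; congr pair;
  apply: eq_from_tnth => l; rewrite tnth_upd !tnth_mktuple E;
  by case: eqP => [->|] //=; rewrite ltnn.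
Qed.

Lemma mpres_refl C S : (forall i, C i ^+ 2 + S i ^+ 2 = 1) ->
  mpres (P \x P)%E (P \x P)%E (fun p => (mix C S p.1 p.2, mix S (fun i => - C i) p.1 p.2)).
Proof.
move=> CS; have := mpres_reflm CS (leqnn n).
congr (mpres _ _ _); apply/funext => -[x z]; rewrite /reflm /=; congr pair;
  by apply: eq_from_tnth => l; rewrite tnth_mix !tnth_mktuple ltn_ord ?mulNr.
Qed.

Lemma mpres_mix C S : (forall i, C i ^+ 2 + S i ^+ 2 = 1) ->
  mpres (P \x P)%E P (fun p => mix C S p.1 p.2).
Proof. by move=> CS; exact: (mpres_comp (mpres_fst P P) (mpres_refl CS)). Qed.

(** In each coordinate [a z + b w] is a centred Gaussian of variance [k^2], which is also the law of
    [k z]. *)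
Lemma Ex_mix_scl (a b k : 'I_n -> R) (F : X -> R) :
  (forall i, a i ^+ 2 + b i ^+ 2 = k i ^+ 2) -> bm F ->
  Ex P (fun z => Ex P (fun w => F (mix a b z w))) = Ex P (fun z => F (scl k z)).
Proof.
move=> abk bF.
(* When [k i = 0] both [a i] and [b i] vanish, and any unit vector would do. *)
pose C i := if k i == 0 then 1 else a i / k i.
pose S i := if k i == 0 then 0 else b i / k i.
have CS i : C i ^+ 2 + S i ^+ 2 = 1.
  rewrite /C /S; case: eqVneq => [_|k0]; first by rewrite expr1n expr0n addr0.
  by rewrite !exprMn -mulrDl abk exprVn divff// sqrf_eq0.
have pr := mpres_mix CS.
have bFs : bm (fun z => F (scl k z)) by apply: (bm_comp bF); measur.
rewrite -(mpres_Ex pr (bm_itg _ bFs)).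
have bFm : bm (fun p : X * X => F (mix a b p.1 p.2)) by apply: (bm_comp bF); measur.
rewrite -(@Ex_prod _ _ _ _ _ P P (fun z w => F (mix a b z w)) bFm).
apply: eq_Ex => -[z w] /=; congr (F _); apply: eq_from_tnth => i.
rewrite tnth_mix tnth_scl tnth_mix /C /S; case: eqVneq => [k0|k0]; last by field.
have := abk i; rewrite k0 expr0n /= => /eqP; rewrite paddr_eq0 ?sqr_ge0// !sqrf_eq0.
by move=> /andP[/eqP -> /eqP ->]; ring.
Qed.

Definition co (c : 'I_n -> R) i := Num.sqrt (1 - c i ^+ 2).

Lemma co2 c i : 0 <= c i <= 1 -> c i ^+ 2 + co c i ^+ 2 = 1.
Proof.
move=> /andP[c0 c1]; rewrite /co sqr_sqrtr; first by ring.
by rewrite subr_ge0 expr_le1.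
Qed.

(* E[K(x, y)] for standard Gaussian x, y whose i-th coordinates have correlation c i. *)
Definition corr_mean (c : 'I_n -> R) (K : X -> X -> R) : R :=
  Ex (P \x P)%E (fun p => K p.1 (mix c (co c) p.1 p.2)).

(** The reflection with weights [c] and [co c] exchanges the two members of the pair. *)
Lemma corr_mean_sym c K : (forall i, 0 <= c i <= 1) -> bm (fun p : X * X => K p.1 p.2) ->
  corr_mean c K = corr_mean c (fun x y => K y x).
Proof.
move=> c01 bK; have CS i := co2 (c01 i).
have bH : bm (fun p : X * X => K p.1 (mix c (co c) p.1 p.2)).
  by apply: (bm_comp2 bK); measur.
rewrite /corr_mean -(mpres_Ex (mpres_refl CS) (bm_itg _ bH)).
apply: eq_Ex => -[x z] /=; congr (K _ _); apply: eq_from_tnth => i.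
rewrite !tnth_mix mulNr.
transitivity ((c i ^+ 2 + co c i ^+ 2) * tnth x i); last by rewrite CS mul1r.
by ring.
Qed.

(** The two noisy copies of x are independent given x. After reflecting the pair (x, z) the first
    copy becomes the base point, and the second is [c d'] times it plus independent noise. *)
Lemma corr_mean_mul c d' K : (forall i, 0 <= c i <= 1) -> (forall i, 0 <= d' i <= 1) ->
  bm (fun p : X * X => K p.1 p.2) ->
  Ex P (fun x => Ex P (fun z => Ex P (fun w => K (mix c (co c) x z) (mix d' (co d') x w)))) =
  corr_mean (fun i => c i * d' i) K.
Proof.
move=> c01 d01 bK; have CS i := co2 (c01 i).
pose H x z := Ex P (fun w => K (mix c (co c) x z) (mix d' (co d') x w)).
have bH : bm (fun p : X * X => H p.1 p.2).
  apply: (@bm_Ex _ _ _ _ _ P (fun (p : X * X) w => K (mix c (co c) p.1 p.2) (mix d' (co d') p.1 w))).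
  by apply: (bm_comp2 bK); measur.
rewrite -(Ex_prod P P bH) -(mpres_Ex (mpres_refl CS) (bm_itg _ bH)).
pose cd i := c i * d' i.
have bL : bm (fun p : X * X => Ex P (fun w => K p.1 (mix d' (co d') (mix c (co c) p.1 p.2) w))).
  apply: (@bm_Ex _ _ _ _ _ P (fun (p : X * X) w => K p.1 (mix d' (co d') (mix c (co c) p.1 p.2) w))).
  by apply: (bm_comp2 bK); measur.
transitivity (Ex (P \x P)%E (fun p : X * X => Ex P (fun w => K p.1 (mix d' (co d') (mix c (co c) p.1 p.2) w)))).
  apply: eq_Ex => -[x z] /=; rewrite /H; apply: eq_Ex => w; congr (K _ _).
  apply: eq_from_tnth => i; rewrite !tnth_mix mulNr.
  transitivity ((c i ^+ 2 + co c i ^+ 2) * tnth x i); last by rewrite CS mul1r.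
  by ring.
rewrite (@Ex_prod _ _ _ _ _ P P (fun x z => Ex P (fun w => K x (mix d' (co d') (mix c (co c) x z) w)))) //.
have bR : bm (fun p : X * X => K p.1 (mix cd (co cd) p.1 p.2)).
  by apply: (bm_comp2 bK); measur.
rewrite /corr_mean (@Ex_prod _ _ _ _ _ P P (fun x z => K x (mix cd (co cd) x z))) //.
apply: eq_Ex => x.
(* The two noise terms together have variance [1 - (c i * d' i)^2]. *)
have kk i : (d' i * co c i) ^+ 2 + co d' i ^+ 2 = co cd i ^+ 2.
  have cd01 : 0 <= cd i <= 1.
    have /andP[? ?] := c01 i; have /andP[? ?] := d01 i.
    by rewrite mulr_ge0//= mulr_ile1.
  have := co2 cd01; have := CS i; have := co2 (d01 i); rewrite /cd !exprMn.
  move=> /(canRL (addKr _)) -> /(canRL (addKr _)) -> /(canRL (addKr _)) ->.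
  by ring.
have bG : bm (fun y => K x (mix cd (fun=> 1) x y)).
  by apply: (bm_comp2 bK); measur.
transitivity (Ex P (fun z => Ex P (fun w => K x (mix cd (fun=> 1) x (mix (fun i => d' i * co c i) (co d') z w))))).
  apply: eq_Ex => z; apply: eq_Ex => w; congr (K _ _); apply: eq_from_tnth => i.
  by rewrite !tnth_mix /cd; ring.
rewrite (Ex_mix_scl kk bG); apply: eq_Ex => z; congr (K _ _).
by apply: eq_from_tnth => i; rewrite !tnth_mix tnth_scl mul1r.
Qed.

(** The points [a x + b z] and [a x - b z] have unit variances and covariance [a^2 - b^2]. In this
    form a common shift of both points is a shift of x alone, which is how the second variation is
    computed. *)
Lemma corr_mean_symform (a b c : 'I_n -> R) K : (forall i, 0 <= a i) -> (forall i, 0 <= b i) ->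
  (forall i, a i ^+ 2 + b i ^+ 2 = 1) -> (forall i, c i = a i ^+ 2 - b i ^+ 2) ->
  bm (fun p : X * X => K p.1 p.2) ->
  Ex (P \x P)%E (fun p => K (mix a b p.1 p.2) (mix a (fun i => - b i) p.1 p.2)) = corr_mean c K.
Proof.
move=> a0 b0 ab cE bK.
have coE i : co c i = 2 * a i * b i.
  rewrite /co cE.
  transitivity (Num.sqrt ((2 * a i * b i) ^+ 2)).
    congr Num.sqrt; rewrite [X in X - _](_ : 1 = (a i ^+ 2 + b i ^+ 2) ^+ 2).
      by ring.
    by rewrite ab expr1n.
  by rewrite sqrtr_sqr ger0_norm// !mulr_ge0.
have bL : bm (fun p : X * X => K (mix a b p.1 p.2) (mix a (fun i => - b i) p.1 p.2)).
  by apply: (bm_comp2 bK); measur.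
rewrite -(mpres_Ex (mpres_refl ab) (bm_itg _ bL)) /corr_mean.
apply: eq_Ex => -[x z] /=; congr (K _ _); apply: eq_from_tnth => i; rewrite !tnth_mix.
  transitivity ((a i ^+ 2 + b i ^+ 2) * tnth x i); last by rewrite ab mul1r.
  by ring.
by rewrite coE cE; ring.
Qed.

End Reflections.

(** * Taylor expansion of Gaussian averages *)

Section ExpBounds.
Context {R : realType}.
Implicit Types y : R.

Lemma expR_abs1 y : `|expR y - 1| <= `|y| * expR `|y|.
Proof.
have e1 := expR_ge1Dx y; have e2 := expR_ge1Dx (- y).
have e0 := expR_gt0 y.
have eN : expR (- y) * expR y = 1 by rewrite mulrC expRxMexpNx_1.
have [y0|y0] := leP 0 y.
  rewrite (ger0_norm y0) ger0_norm; last by lra.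
  nra.
rewrite (ltr0_norm y0) ler0_norm; last first.
  by rewrite subr_le0 expR_le1 ltW.
have : 1 <= expR (- y) by rewrite -expR0 ler_expR; lra.
nra.
Qed.

Lemma expR_abs2 y : 0 <= expR y - 1 - y <= y ^+ 2 * expR `|y|.
Proof.
have e1 := expR_ge1Dx y; have e2 := expR_ge1Dx (- y).
have e0 := expR_gt0 y.
have eN : expR (- y) * expR y = 1 by rewrite mulrC expRxMexpNx_1.
apply/andP; split; first by lra.
have h := expR_abs1 y.
have h1 : expR y - 1 - y <= y * (expR y - 1) by nra.
apply: (le_trans h1); apply: (le_trans (ler_norm _)).
have -> : y ^+ 2 = `|y| * `|y| by rewrite -normrM -expr2 ger0_norm ?sqr_ge0.
rewrite normrM -mulrA.
by apply: ler_wpM2l.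
Qed.

(** By the mean value theorem: the derivative of the remainder is the remainder of one order less,
    bounded in [expR_abs2]. *)
Lemma expR_abs3 y :
  `|expR y - 1 - y - y ^+ 2 / 2| <= `|y| ^+ 3 * expR `|y|.
Proof.
pose r (x : R) := expR x - 1 - x - x ^+ 2 / 2.
pose dr (x : R) := expR x - 1 - x.
have dr_ (x : R) : is_derive x 1 r (dr x).
  rewrite /r /dr; apply: trigger_derive.
  by rewrite /GRing.scale /= !(mulr1, mulr0, addr0, add0r, expr1, subr0); field.
have rc : continuous r.
  by move=> x; apply/differentiable_continuous/derivable1_diffP; case: (dr_ x).
have r0 : r 0 = 0 by rewrite /r expR0; ring.
suff [c cy rE] : exists2 c, `|c| <= `|y| & r y = dr c * y.
  rewrite -/(r y) rE normrM.
  have /andP[d0 d1] := expR_abs2 c.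
  rewrite (ger0_norm d0) exprS -mulrA mulrC.
  apply: ler_wpM2l => //; apply: (le_trans d1).
  apply: ler_pM; [exact: sqr_ge0|exact: expR_ge0| |by rewrite ler_expR].
  by rewrite -[c ^+ 2]ger0_norm ?sqr_ge0// normrX lerXn2r// nnegrE.
have [y0|y0] := leP 0 y.
  have [c] := MVT_segment y0 (fun x _ => dr_ x) (continuous_subspaceT rc).
  rewrite in_itv /= r0 !subr0 => /andP[c0 cy] ->; exists c => //.
  by rewrite !ger0_norm.
have [c] := MVT_segment (ltW y0) (fun x _ => dr_ x) (continuous_subspaceT rc).
rewrite in_itv /= r0 !sub0r => /andP[c0 cy]; rewrite mulrN => /oppr_inj ->.
by exists c => //; rewrite !ler0_norm// ?lerN2// ltW.
Qed.

Lemma abs_le_expR (x : R) : 1 + `|x| <= expR `|x|.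
Proof. exact: expR_ge1Dx. Qed.

(** The polynomial is the second-order expansion of the density in t, with Hermite polynomials as
    coefficients. Powers of |x| in the error are absorbed by four factors [expR |x|], whose product
    is Gaussian integrable. *)
Lemma cmw_taylor (t x : R) : `|t| <= 1 ->
  `|cmw t x - (1 + t * x + t ^+ 2 * ((x ^+ 2 - 1) / 2))| <=
  (expR 1 + 1) * `|t| ^+ 3 * expR (4 * `|x|).
Proof.
move=> t1; rewrite /cmw; set y := t * x - t ^+ 2 / 2.
have tt : t ^+ 2 = `|t| ^+ 2 by rewrite -normrX ger0_norm ?sqr_ge0.
have t0 : 0 <= `|t| by [].
have x0 : 0 <= `|x| by [].
have yb : `|y| <= `|t| * (1 + `|x|).
  apply: (le_trans (ler_normB _ _)); rewrite normrM (ger0_norm (_ : 0 <= t ^+ 2 / 2)); last by rewrite divr_ge0 ?sqr_ge0.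
  by rewrite tt; nra.
have yb1 : `|y| <= 1 + `|x| by nra.
have h := expR_abs3 y.
have ex := abs_le_expR x.
have e4 : expR (4 * `|x|) = expR `|x| ^+ 4 by rewrite -expRM_natl.
have b1 : `|expR y - 1 - y - y ^+ 2 / 2| <= expR 1 * `|t| ^+ 3 * expR (4 * `|x|).
  apply: (le_trans h).
  have -> : expR 1 * `|t| ^+ 3 * expR (4 * `|x|) =
     (`|t| * expR `|x|) ^+ 3 * (expR 1 * expR `|x|) by rewrite e4; ring.
  apply: ler_pM; [exact: exprn_ge0|exact: expR_ge0| |by rewrite -expRD ler_expR].
  apply: lerXn2r; rewrite ?nnegrE// ?mulr_ge0 ?expR_ge0//.
  by apply: (le_trans yb); exact: ler_wpM2l.
(* What is left consists of the terms of [y + y^2 / 2] of order three and four in t. *)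
have -> : expR y - (1 + t * x + t ^+ 2 * ((x ^+ 2 - 1) / 2)) =
  (expR y - 1 - y - y ^+ 2 / 2) + (t ^+ 4 / 8 - t ^+ 3 * x / 2).
  by rewrite /y; field.
apply: (le_trans (ler_normD _ _)); rewrite mulrDl mulrDl mul1r; apply: lerD => //.
have e41 : 1 + `|x| <= expR (4 * `|x|).
  by apply: (le_trans ex); rewrite ler_expR; lra.
apply: (@le_trans _ _ (`|t| ^+ 3 * (1 + `|x|))); last first.
  by apply: ler_wpM2l => //; exact: exprn_ge0.
apply: (le_trans (ler_normB _ _)).
have -> : `|t ^+ 4 / 8| = `|t| ^+ 4 / 8 by rewrite normrM normrX [X in _ * X]ger0_norm.
have -> : `|t ^+ 3 * x / 2| = `|t| ^+ 3 * `|x| / 2.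
  by rewrite normrM [`|_ * x|]normrM normrX [X in _ * X]ger0_norm.
have t3 : 0 <= `|t| ^+ 3 by exact: exprn_ge0.
rewrite (exprS `|t| 3).
have : `|t| * `|t| ^+ 3 <= `|t| ^+ 3 by nra.
have : 0 <= `|t| ^+ 3 * `|x| by exact: mulr_ge0.
lra.
Qed.

Lemma cmw_lip (t x : R) : `|t| <= 1 ->
  `|cmw t x - 1| <= expR 1 * `|t| * expR (4 * `|x|).
Proof.
move=> t1; rewrite /cmw; set y := t * x - t ^+ 2 / 2.
have tt : t ^+ 2 = `|t| ^+ 2 by rewrite -normrX ger0_norm ?sqr_ge0.
have t0 : 0 <= `|t| by [].
have x0 : 0 <= `|x| by [].
have yb : `|y| <= `|t| * (1 + `|x|).
  apply: (le_trans (ler_normB _ _)); rewrite normrM (ger0_norm (_ : 0 <= t ^+ 2 / 2)); last by rewrite divr_ge0 ?sqr_ge0.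
  by rewrite tt; nra.
have yb1 : `|y| <= 1 + `|x| by nra.
have ex := abs_le_expR x.
apply: (le_trans (expR_abs1 y)).
apply: (@le_trans _ _ ((`|t| * expR `|x|) * expR (1 + `|x|))).
  apply: ler_pM; [exact: normr_ge0|exact: expR_ge0| |by rewrite ler_expR].
  by apply: (le_trans yb); exact: ler_wpM2l.
have -> : `|t| * expR `|x| * expR (1 + `|x|) = expR 1 * `|t| * expR (2 * `|x|).
  by rewrite expRD expRM_natl; ring.
by apply: ler_wpM2l; [rewrite mulr_ge0 ?expR_ge0|rewrite ler_expR; lra].
Qed.

End ExpBounds.

(** * Gaussian averages of shifted bounded functions *)

Section Gauss1D.
Context {R : realType}.
Local Notation gam := (@gam R).
Local Notation Rm := (measurableTypeR R).
Implicit Types (B : R -> R).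

(** Cameron-Martin for the constant 1 identifies the integral with the total mass. *)
Lemma itg_cmw (a : R) : itg gam (cmw a).
Proof.
apply/integrableP; split; first by apply/measurable_EFinP; exact: measurable_cmw.
have := @cameron_martin_ge0 R a (cst 1%E) (measurable_cst _) (fun=> lee01).
rewrite integral_cst; last exact: measurableT.
rewrite mul1e [X in X = _](_ : _ = 1%E); last exact: probability_setT.
move=> E; apply: (@le_lt_trans _ _ 1%E); last exact: ltry.
rewrite E; apply: ge0_le_integral.
- exact: measurableT.
- by move=> x _; exact: abse_ge0.
- by apply: measurableT_comp => //; apply/measurable_EFinP; exact: measurable_cmw.
- by under eq_fun do rewrite mul1e; apply/measurable_EFinP; exact: measurable_cmw.
- by move=> x _; rewrite mul1e gee0_abs// lee_fin ltW// cmw_gt0.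
Qed.

Lemma Ex_cmw (a : R) : Ex gam (cmw a) = 1.
Proof.
have := @cameron_martin_ge0 R a (cst 1%E) (measurable_cst _) (fun=> lee01).
rewrite integral_cst; last exact: measurableT.
rewrite mul1e [X in X = _](_ : _ = 1%E); last exact: probability_setT.
under eq_integral do rewrite mul1e.
by rewrite (ExE (itg_cmw a)) => -[].
Qed.

Lemma itg_bm_cmw B (a : R) : bm B -> itg gam (fun x => B x * cmw a x).
Proof.
move=> [mB [C BC]].
apply: (@itg_le _ _ _ gam _ (fun x => C * cmw a x)).
- by apply: measurable_funM => //; exact: measurable_cmw.
- by move=> x; rewrite normrM (gtr0_norm (cmw_gt0 a x)) ler_wpM2r// ltW// cmw_gt0.
- exact/itgZ/itg_cmw.
Qed.

(** [B + C] is nonnegative, so the earlier form applies to it; the constant contributes C on both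
    sides because [cmw] has mean 1. *)
Lemma cameron_martin B (a : R) : bm B ->
  Ex gam (fun x => B (x + a)) = Ex gam (fun x => B x * cmw a x).
Proof.
move=> bB; have [mB [C BC]] := bB.
have mBa : measurable_fun [set: R] (fun x : R => B (x + a)).
  exact: (measurableT_comp mB (measurable_shift a)).
have bBa : bm (fun x : R => B (x + a)) by split => //; exists C => x; exact: BC.
have B0 x : 0 <= B x + C by have := BC x; rewrite ler_norml => /andP[]; lra.
have mBC : measurable_fun [set: R] (fun x : R => (B x + C)%:E).
  by apply/measurable_EFinP; apply: measurable_funD.
have := @cameron_martin_ge0 R a (fun x => (B x + C)%:E) mBC B0.
have i1 : itg gam (fun x : R => B (x + a) + C).
  by apply: itgD; [exact: bm_itg|exact: itg_cst].
have i2 : itg gam (fun x : R => (B x + C) * cmw a x).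
  by apply: itg_bm_cmw; apply: bmD => //; exact: bm_cst.
rewrite (ExE i1) => E.
have : Ex gam (fun x : R => B (x + a) + C) = Ex gam (fun x : R => (B x + C) * cmw a x).
  by apply: EFin_inj; rewrite E -(ExE i2).
rewrite ExD; [|exact: bm_itg|exact: itg_cst].
rewrite Ex_cst.
have -> : Ex gam (fun x : R => (B x + C) * cmw a x) = Ex gam (fun x => B x * cmw a x + C * cmw a x).
  by apply: eq_Ex => x; rewrite mulrDl.
rewrite ExD; [|exact: itg_bm_cmw|exact/itgZ/itg_cmw].
by rewrite ExZ ?Ex_cmw ?mulr1; [move=> /addIr|exact: itg_cmw].
Qed.

Lemma itg_exp4 : itg gam (fun x : R => expR (4 * `|x|)).
Proof.
(* [expR (4 |x|)] is at most [expR (4 x) + expR (- 4 x)], and [expR 8] undoes the normalisation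
   [4^2 / 2] inside [cmw]. *)
apply: (@itg_le _ _ _ gam _ (fun x => expR 8 * (cmw 4 x + cmw (-4) x))).
- by apply: measurableT_comp => //; apply: measurable_funM => //; exact: normr_measurable.
- move=> x; rewrite ger0_norm ?expR_ge0// /cmw.
  have -> : expR 8 * (expR (4 * x - 4 ^+ 2 / 2) + expR (- (4) * x - (- (4)) ^+ 2 / 2)) =
    expR (4 * x) + expR (- (4 * x)) :> R.
    by rewrite mulrDr -!expRD; congr (expR _ + expR _); field.
  have [x0|x0] := leP 0 x.
    by rewrite ger0_norm// lerDl expR_ge0.
  by rewrite ltr0_norm// mulrN lerDr expR_ge0.
- by apply: itgZ; apply: itgD; exact: itg_cmw.
Qed.

Lemma itg_powabs (m : nat) : (m <= 4)%N -> itg gam (fun x : R => `|x| ^+ m).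
Proof.
move=> m4; apply: (itg_le _ _ itg_exp4).
  by apply: measurable_funX; exact: normr_measurable.
move=> x; rewrite ger0_norm; last exact: exprn_ge0.
apply: (@le_trans _ _ (expR `|x| ^+ m)).
  apply: lerXn2r; rewrite ?nnegrE ?expR_ge0//.
  by have := expR_ge1Dx `|x|; lra.
rewrite -expRM_natl ler_expR; apply: ler_wpM2r => //.
by rewrite (ler_nat R m 4).
Qed.

Lemma itg_pow (m : nat) : (m <= 4)%N -> itg gam (fun x : R => x ^+ m).
Proof.
move=> m4; apply: (itg_le _ _ (itg_powabs m4)); first exact: measurable_funX.
by move=> x; rewrite normrX.
Qed.

Lemma itg_id : itg gam (fun x : R => x).
Proof. exact: (@itg_pow 1). Qed.

Lemma mpres_opp : mpres gam gam (fun x : Rm => - x : Rm).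
Proof.
have m1 : (0:R) ^+ 2 + 1 ^+ 2 = 1 by rewrite expr0n expr1n add0r.
have m2 : (-1:R) ^+ 2 + 0 ^+ 2 = 1 by rewrite sqrrN expr0n expr1n addr0.
apply: Ex_mpres; first exact: oppr_measurable.
move=> F bF.
have := @Ex_refl2 R (-1) 0 (fun a _ => F a) m2.
have b : bm (fun p : Rm * Rm => F p.1) by apply: (bm_comp bF); exact: measurable_fst.
move=> /(_ b); have -> : Ex gam (fun a : R => Ex gam (fun=> F a)) = Ex gam F.
  by apply: eq_Ex => a; exact: Ex_cst.
move=> <-; apply: eq_Ex => x; rewrite -[LHS](Ex_cst gam); apply: eq_Ex => y.
by congr F; ring.
Qed.

Lemma Ex_odd (m : nat) : (m <= 4)%N -> odd m -> Ex gam (fun x : R => x ^+ m) = 0.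
Proof.
move=> m4 om; have := mpres_Ex mpres_opp (itg_pow m4).
rewrite (@eq_Ex _ _ _ gam _ (fun x : R => - x ^+ m)); last first.
  by move=> x; rewrite -[LHS]/((- x) ^+ m) exprNn -signr_odd om expr1 mulN1r.
by rewrite ExN ?itg_pow//; lra.
Qed.

Definition tayC : R := (expR 1 + 1) * Ex gam (fun x : R => expR (4 * `|x|)).

Lemma tayC_ge0 : 0 <= tayC.
Proof.
apply: mulr_ge0; first by rewrite addr_ge0 ?expR_ge0.
by apply: Ex_ge0 => x; exact: expR_ge0.
Qed.

(** B need not be continuous: after Cameron-Martin the parameter t occurs in the weight only. *)
Lemma Ex_taylor_small B (M : R) (t : R) : measurable_fun [set: R] B -> (forall x, `|B x| <= M) ->
  `|t| <= 1 ->
  `|Ex gam (fun x => B (x + t)) -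
    (Ex gam B + t * Ex gam (fun x => B x * x) + t ^+ 2 * (Ex gam (fun x => B x * ((x ^+ 2 - 1) / 2))))|
   <= tayC * M * `|t| ^+ 3.
Proof.
move=> mB BM t1.
have bB : bm B by split => //; exists M.
have M0 : 0 <= M by apply: le_trans (BM 0).
rewrite cameron_martin//.
have i0 : itg gam B by exact: bm_itg.
have i1 : itg gam (fun x => B x * x) by apply: itg_bmM => //; exact: itg_id.
have iq : itg gam (fun x : R => (x ^+ 2 - 1) / 2).
  apply: (@eq_itg _ _ _ gam (fun x => 2^-1 * (x ^+ 2 - 1))); first by move=> x; rewrite mulrC.
  by apply: itgZ; apply: itgB; [exact: itg_pow|exact: itg_cst].
have i2 : itg gam (fun x => B x * ((x ^+ 2 - 1) / 2)) by exact: itg_bmM.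
rewrite -ExZ// -ExZ// -ExD//; last exact: itgZ.
have i12 : itg gam (fun x => B x + t * (B x * x)) by apply: itgD => //; exact: itgZ.
rewrite -ExD//; last exact: itgZ.
have i3 : itg gam (fun x => B x + t * (B x * x) + t ^+ 2 * (B x * ((x ^+ 2 - 1) / 2))).
  by apply: itgD => //; exact: itgZ.
have i4 := itg_bm_cmw t bB.
rewrite -ExB//; apply: (le_trans (Ex_norm (itgB i4 i3))).
have -> : tayC * M * `|t| ^+ 3 = Ex gam (fun x : R => (M * ((expR 1 + 1) * `|t| ^+ 3)) * expR (4 * `|x|)).
  by rewrite ExZ; [rewrite /tayC; ring|exact: itg_exp4].
apply: Ex_le; [exact/itg_norm/itgB|by apply: itgZ; exact: itg_exp4|move=> x].
rewrite (_ : _ - _ = B x * (cmw t x - (1 + t * x + t ^+ 2 * ((x ^+ 2 - 1) / 2)))); last by ring.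
rewrite normrM -[leRHS]mulrA; apply: ler_pM => //.
exact: cmw_taylor.
Qed.

(** The variance is read off from the expansion: for [B = 1] the shifted mean does not depend on t,
    so the coefficient of [t^2], here [(E x^2 - 1) / 2], is at most a multiple of t for every small
    t. *)
Lemma Ex_sqr : Ex gam (fun x : R => x ^+ 2) = 1.
Proof.
have H t : `|t| <= 1 -> `|t ^+ 2 * ((Ex gam (fun x : R => x ^+ 2) - 1) / 2)| <= tayC * `|t| ^+ 3.
  move=> t1; have := @Ex_taylor_small (fun=> 1) 1 t (measurable_cst _) (fun=> _) t1.
  rewrite normr1 !Ex_cst mulr1 => /(_ (fun=> lexx _)).
  rewrite (@eq_Ex _ _ _ gam (fun x : R => 1 * x) (fun x => x ^+ 1)); last by move=> x; rewrite mul1r expr1.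
  rewrite (@Ex_odd 1)// mulr0 addr0.
  rewrite (@eq_Ex _ _ _ gam (fun x : R => 1 * ((x ^+ 2 - 1) / 2)) (fun x => 2^-1 * (x ^+ 2 - 1))); last by move=> x; rewrite mul1r mulrC.
  rewrite ExZ; last by apply: itgB; [exact: itg_pow|exact: itg_cst].
  rewrite ExB; [|exact: itg_pow|exact: itg_cst].
  rewrite Ex_cst opprD addrA subrr sub0r normrN.
  by rewrite [2^-1 * _]mulrC.
apply/eqP; rewrite -subr_eq0; set q := _ - 1; apply: contraT => q0.
have q0' : 0 < `|q| by rewrite normr_gt0.
have T0 := tayC_ge0.
(* Small enough for [|q| / 2 <= tayC * t] to fail. *)
pose t : R := Num.min 1 (`|q| / (4 * (tayC + 1))).
have t0 : 0 < t by rewrite lt_min ltr01 divr_gt0//; lra.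
have t1 : t <= 1 by rewrite ge_min lexx.
have tq : t * (4 * (tayC + 1)) <= `|q|.
  by rewrite -ler_pdivlMr; [rewrite ge_min lexx orbT|lra].
have := H t; rewrite (gtr0_norm t0) => /(_ t1).
rewrite normrM (ger0_norm (sqr_ge0 t)) normrM (ger0_norm (_ : 0 <= 2^-1))//.
have t2 : 0 < t ^+ 2 by exact: exprn_gt0.
rewrite (_ : tayC * t ^+ 3 = t ^+ 2 * (tayC * t)); last by ring.
rewrite ler_pM2l//.
nra.
Qed.

(** Enlarges [tayC] so as to cover |t| > 1, where the shifted mean and the three terms of the
    polynomial are bounded by [M |t|^3] times 1, 1, [E|x|] and 1. *)
Definition tayK : R := tayC + 2 + Ex gam (fun x : R => `|x|) + 1.

Lemma Ex_abs_ge0 : 0 <= Ex gam (fun x : R => `|x|).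
Proof. exact: Ex_ge0. Qed.

(** The bound has to hold for every real t because it is later averaged over a Gaussian t. *)
Lemma Ex_taylor B (M : R) : measurable_fun [set: R] B -> (forall x, `|B x| <= M) ->
  exists c : R * R * R, forall t,
  `|Ex gam (fun x => B (x + t)) - (c.1.1 + t * c.1.2 + t ^+ 2 * c.2)| <= tayK * M * `|t| ^+ 3.
Proof.
move=> mB BM.
exists (Ex gam B, Ex gam (fun x => B x * x), Ex gam (fun x => B x * ((x ^+ 2 - 1) / 2))) => t /=.
have M0 : 0 <= M by apply: le_trans (BM 0).
have A0 := Ex_abs_ge0; have T0 := tayC_ge0.
have t3 : 0 <= `|t| ^+ 3 by exact: exprn_ge0.
have [t1|t1] := leP `|t| 1.
  apply: (le_trans (Ex_taylor_small mB BM t1)).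
  by apply: ler_wpM2r => //; apply: ler_wpM2r => //; rewrite /tayK; lra.
have b0 : `|Ex gam B| <= M by exact: Ex_bound.
have b1 : `|Ex gam (fun x => B (x + t))| <= M.
  apply: Ex_bound => //; exact: (measurableT_comp mB (measurable_shift t)).
have bB : bm B by split => //; exists M.
have i1 : itg gam (fun x => B x * x) by apply: itg_bmM => //; exact: itg_id.
have iq : itg gam (fun x : R => (x ^+ 2 - 1) / 2).
  apply: (@eq_itg _ _ _ gam (fun x => 2^-1 * (x ^+ 2 - 1))); first by move=> x; rewrite mulrC.
  by apply: itgZ; apply: itgB; [exact: itg_pow|exact: itg_cst].
have iab : itg gam (fun x : R => `|x|) by exact: (@itg_powabs 1).
have i2 : itg gam (fun x => B x * ((x ^+ 2 - 1) / 2)) by exact: itg_bmM.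
have b2 : `|Ex gam (fun x => B x * x)| <= M * Ex gam (fun x : R => `|x|).
  apply: (le_trans (Ex_norm i1)); rewrite -ExZ//.
  apply: Ex_le; [exact: itg_norm|exact: itgZ|move=> x].
  by rewrite normrM; apply: ler_wpM2r.
have b3 : `|Ex gam (fun x => B x * ((x ^+ 2 - 1) / 2))| <= M.
  apply: (le_trans (Ex_norm i2)).
  (* [|x^2 - 1| / 2] is at most [(x^2 + 1) / 2], which has mean 1. *)
  have -> : M = Ex gam (fun x : R => (M / 2) * (x ^+ 2 + 1)).
    rewrite ExZ; last by apply: itgD; [exact: itg_pow|exact: itg_cst].
    rewrite ExD; [|exact: itg_pow|exact: itg_cst].
    by rewrite Ex_sqr Ex_cst; field.
  apply: Ex_le; [exact: itg_norm|apply: itgZ; apply: itgD; [exact: itg_pow|exact: itg_cst]|move=> x].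
  rewrite normrM -mulrA; apply: ler_pM => //.
  rewrite normrM (ger0_norm (_ : 0 <= 2^-1))// mulrC ler_wpM2l//.
  by apply: (le_trans (ler_normB _ _)); rewrite normr1 ger0_norm ?sqr_ge0.
apply: (le_trans (ler_normB _ _)).
have b4 : `|Ex gam B + t * Ex gam (fun x => B x * x) + t ^+ 2 * Ex gam (fun x => B x * ((x ^+ 2 - 1) / 2))|
   <= M + `|t| * (M * Ex gam (fun x : R => `|x|)) + `|t| ^+ 2 * M.
  apply: (le_trans (ler_normD _ _)); apply: lerD.
    apply: (le_trans (ler_normD _ _)); apply: lerD => //.
    by rewrite normrM; apply: ler_wpM2l.
  by rewrite normrM normrX; apply: ler_wpM2l => //; exact: exprn_ge0.
apply: (le_trans (lerD b1 b4)).
have p1 : 1 <= `|t| ^+ 3 by exact: exprn_ege1 (ltW t1).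
have p2 : `|t| <= `|t| ^+ 3 by rewrite exprS ler_peMr// exprn_ege1 ?ltW.
have p3 : `|t| ^+ 2 <= `|t| ^+ 3 by rewrite [leRHS]exprSr ler_peMr ?exprn_ge0// ltW.
rewrite /tayK.
have MA : 0 <= M * Ex gam (fun x : R => `|x|) by exact: mulr_ge0.
have q1 : M * 1 <= M * `|t| ^+ 3 by exact: ler_wpM2l.
have q2 := ler_wpM2r MA p2.
have q3 := ler_wpM2r M0 p3.
have q4 : 0 <= tayC * M * `|t| ^+ 3 by apply: mulr_ge0 => //; exact: mulr_ge0.
lra.
Qed.

Lemma Ex_shift_lip B (t : R) : measurable_fun [set: R] B -> (forall x, `|B x| <= 1) ->
  `|Ex gam (fun x => B (x + t)) - Ex gam B| <= (tayC + 2) * `|t|.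
Proof.
move=> mB B1; have T0 := tayC_ge0.
have bB : bm B by split => //; exists 1.
have [t1|t1] := leP `|t| 1; last first.
  apply: (@le_trans _ _ (1 + 1)).
    apply: (le_trans (ler_normB _ _)); apply: lerD; apply: Ex_bound => //.
    exact: (measurableT_comp mB (measurable_shift t)).
  nra.
rewrite cameron_martin//.
have i4 := itg_bm_cmw t bB.
have i0 : itg gam B by exact: bm_itg.
rewrite -ExB//; apply: (le_trans (Ex_norm (itgB i4 i0))).
apply: (@le_trans _ _ (tayC * `|t|)); last by apply: ler_wpM2r => //; lra.
have -> : tayC * `|t| = Ex gam (fun x : R => ((expR 1 + 1) * `|t|) * expR (4 * `|x|)).
  by rewrite ExZ; [rewrite /tayC; ring|exact: itg_exp4].
apply: Ex_le; [exact/itg_norm/itgB|by apply: itgZ; exact: itg_exp4|move=> x].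
rewrite (_ : _ - _ = B x * (cmw t x - 1)); last by ring.
rewrite normrM -[leRHS]mul1r; apply: ler_pM => //.
apply: (le_trans (cmw_lip x t1)).
by apply: ler_wpM2r; [exact: expR_ge0|apply: ler_wpM2r => //; lra].
Qed.

(** * Two-point averages against Gaussian averages *)

Section Rademacher.
Variables (Psi : R -> R) (c0 c1 c2 K : R).
Hypothesis bPsi : bm Psi.
Hypothesis PsiT : forall t, `|Psi t - (c0 + t * c1 + t ^+ 2 * c2)| <= K * `|t| ^+ 3.
Variable t : R.
Hypothesis t0 : 0 <= t.

(** The summand 1 pays for the error of the two-point average, the moment for that of the Gaussian
    average. *)
Definition mom3 : R := 1 + Ex gam (fun x : R => `|x| ^+ 3).
Definition mom4 : R := 1 + Ex gam (fun x : R => `|x| ^+ 4).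

Let bPt : bm (fun x : R => Psi (t * x)).
Proof. by apply: (bm_comp bPsi); exact: measurable_funM. Qed.

(** Both averages have the main term [c0 + t^2 * c2], since the Gaussian has mean 0 and variance
    1. *)
Lemma rademacher_even :
  `|(Psi t + Psi (- t)) / 2 - Ex gam (fun x => Psi (t * x))| <= K * mom3 * t ^+ 3.
Proof.
have h1 := PsiT t; have h2 := PsiT (- t).
rewrite normrN (ger0_norm t0) sqrrN in h2; rewrite (ger0_norm t0) in h1.
have i3 : itg gam (fun x : R => `|x| ^+ 3) by exact: itg_powabs.
have iq : itg gam (fun x : R => c0 + (t * c1) * x + (t ^+ 2 * c2) * x ^+ 2).
  apply: itgD; last by apply: itgZ; exact: itg_pow.
  by apply: itgD; [exact: itg_cst|apply: itgZ; exact: itg_id].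
have Eq : Ex gam (fun x : R => c0 + (t * c1) * x + (t ^+ 2 * c2) * x ^+ 2) = c0 + t ^+ 2 * c2.
  rewrite ExD; [|by apply: itgD; [exact: itg_cst|apply: itgZ; exact: itg_id]|by apply: itgZ; exact: itg_pow].
  rewrite ExD; [|exact: itg_cst|by apply: itgZ; exact: itg_id].
  rewrite Ex_cst ExZ ?itg_id// ExZ ?itg_pow// Ex_sqr (@Ex_odd 1)//; ring.
have h3 : `|Ex gam (fun x => Psi (t * x)) - (c0 + t ^+ 2 * c2)| <= K * t ^+ 3 * Ex gam (fun x : R => `|x| ^+ 3).
  rewrite -Eq -ExB//; last exact: bm_itg.
  apply: (le_trans (Ex_norm (itgB (bm_itg gam bPt) iq))).
  rewrite -ExZ//; apply: Ex_le; [by apply/itg_norm/itgB => //; exact: bm_itg|exact: itgZ|move=> x].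
  rewrite (_ : _ - _ = Psi (t * x) - (c0 + (t * x) * c1 + (t * x) ^+ 2 * c2)); last by ring.
  by apply: (le_trans (PsiT (t * x))); rewrite normrM (ger0_norm t0) exprMn mulrA.
rewrite /mom3.
move: h1 h2 h3; rewrite !ler_norml => /andP[? ?] /andP[? ?] /andP[? ?].
by apply/andP; split; lra.
Qed.

(** Both quantities have the main term [t * c1], since the Gaussian has variance 1 and its odd
    moments vanish. *)
Lemma rademacher_odd :
  `|(Psi t - Psi (- t)) / 2 - Ex gam (fun x => x * Psi (t * x))| <= K * mom4 * t ^+ 3.
Proof.
have h1 := PsiT t; have h2 := PsiT (- t).
rewrite normrN (ger0_norm t0) sqrrN in h2; rewrite (ger0_norm t0) in h1.
have i4 : itg gam (fun x : R => `|x| ^+ 4) by exact: itg_powabs.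
have iP : itg gam (fun x : R => x * Psi (t * x)).
  apply: (@eq_itg _ _ _ gam (fun x => Psi (t * x) * x)); first by move=> x; rewrite mulrC.
  by apply: itg_bmM => //; exact: itg_id.
have i12 : itg gam (fun x : R => c0 * x ^+ 1 + (t * c1) * x ^+ 2).
  by apply: itgD; apply: itgZ; exact: itg_pow.
have iq : itg gam (fun x : R => c0 * x ^+ 1 + (t * c1) * x ^+ 2 + (t ^+ 2 * c2) * x ^+ 3).
  by apply: itgD => //; apply: itgZ; exact: itg_pow.
have Eq : Ex gam (fun x : R => c0 * x ^+ 1 + (t * c1) * x ^+ 2 + (t ^+ 2 * c2) * x ^+ 3) = t * c1.
  rewrite ExD//; last by apply: itgZ; exact: itg_pow.
  rewrite ExD; [|by apply: itgZ; exact: itg_pow|by apply: itgZ; exact: itg_pow].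
  rewrite !ExZ ?itg_pow// Ex_sqr (@Ex_odd 1)// (@Ex_odd 3)//; ring.
have h3 : `|Ex gam (fun x => x * Psi (t * x)) - (t * c1)| <= K * t ^+ 3 * Ex gam (fun x : R => `|x| ^+ 4).
  rewrite -Eq -ExB//.
  apply: (le_trans (Ex_norm (itgB iP iq))).
  rewrite -ExZ//; apply: Ex_le; [by apply/itg_norm/itgB|exact: itgZ|move=> x].
  rewrite (_ : _ - _ = x * (Psi (t * x) - (c0 + (t * x) * c1 + (t * x) ^+ 2 * c2))); last by ring.
  rewrite normrM.
  apply: (le_trans (ler_wpM2l (normr_ge0 x) (PsiT (t * x)))).
  rewrite normrM (ger0_norm t0) exprMn.
  by rewrite le_eqVlt; apply/orP; left; apply/eqP; ring.
rewrite /mom4.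
move: h1 h2 h3; rewrite !ler_norml => /andP[? ?] /andP[? ?] /andP[? ?].
by apply/andP; split; lra.
Qed.

End Rademacher.

(** A translate of the Gaussian law has a density with respect to it, so shifts preserve null
    sets. *)
Lemma gam_shift_null (A : R -> Prop) (a : R) : {ae gam, forall x, A x} ->
  {ae gam, forall x, A (x + a)}.
Proof.
move=> [N [mN N0 AN]].
have mNa : measurable ((fun x : Rm => (x + a)%R : Rm) @^-1` N).
  by rewrite -[X in measurable X]setTI; exact: measurable_shift.
exists ((fun x : Rm => (x + a)%R : Rm) @^-1` N); split => //; last by move=> x /= ?; apply: AN.
apply: etrans (Ex_indic gam mNa) _.
have bN : bm (\1_N : R -> R) by exact: bm_indic.
have := cameron_martin a bN; rewrite /= => E.
rewrite (_ : Ex _ _ = 0)//; transitivity (Ex gam (fun x => (\1_N (x + a) : R))) => //.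
rewrite E -(Ex_cst gam 0); apply: Ex_ae.
- by apply: itg_measurable; exact: (itg_bm_cmw a bN).
- exact: measurable_cst.
- exists N; split => // x /= /eqP; rewrite indicE; case: (boolP (x \in N)); first by rewrite inE.
  by rewrite mul0r eqxx.
Qed.

End Gauss1D.

(** * Noise operator and stability form *)

Section TDot.
Context {R : realType} {k : nat}.
Implicit Types u v w : k.-tuple R.

Lemma tnth_tadd u v i : tnth (tadd u v) i = tnth u i + tnth v i.
Proof. by rewrite tnth_mktuple. Qed.

Lemma tnth_tscale (a : R) u i : tnth (tscale a u) i = a * tnth u i.
Proof. by rewrite tnth_mktuple. Qed.

Lemma tdotC u v : tdot u v = tdot v u.
Proof. by apply: eq_bigr => i _; rewrite mulrC. Qed.

Lemma tdotDl u v w : tdot (tadd u v) w = tdot u w + tdot v w.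
Proof. by rewrite /tdot -big_split /=; apply: eq_bigr => i _; rewrite tnth_tadd mulrDl. Qed.

Lemma tdotZl (a : R) u w : tdot (tscale a u) w = a * tdot u w.
Proof. by rewrite /tdot big_distrr /=; apply: eq_bigr => i _; rewrite tnth_tscale mulrA. Qed.

Lemma tdotDr u v w : tdot w (tadd u v) = tdot w u + tdot w v.
Proof. by rewrite tdotC tdotDl !(tdotC w). Qed.

Lemma tdotZr (a : R) u w : tdot w (tscale a u) = a * tdot w u.
Proof. by rewrite tdotC tdotZl (tdotC w). Qed.

Lemma tdot_ge0 u : 0 <= tdot u u.
Proof. by apply: sumr_ge0 => i _; rewrite -expr2 sqr_ge0. Qed.

Lemma tdot_eq0 u : tdot u u = 0 -> forall i, tnth u i = 0.
Proof.
move=> /eqP; rewrite psumr_eq0; last by move=> i _; rewrite -expr2 sqr_ge0.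
by move=> /allP H i; have := H i; rewrite mem_index_enum -expr2 sqrf_eq0 => /(_ isT)/eqP.
Qed.

Lemma tdot_AMGM u v : 2 * tdot u v <= tdot u u + tdot v v.
Proof.
have := tdot_ge0 (tadd u (tscale (-1) v)).
by rewrite !(tdotDl, tdotDr, tdotZl, tdotZr) (tdotC v u); lra.
Qed.

Lemma ball_coord u i : in_ball u -> `|tnth u i| <= 1.
Proof.
move=> u1; rewrite -(@expr_le1 _ 2)// -normrX ger0_norm ?sqr_ge0//.
apply: le_trans u1; rewrite /tdot (bigD1 i)//= expr2 lerDl.
by apply: sumr_ge0 => l _; rewrite -expr2 sqr_ge0.
Qed.

Lemma ball_dot_abs u v : in_ball u -> in_ball v -> `|tdot u v| <= 1.
Proof.
rewrite /in_ball => u1 v1; have := tdot_AMGM u v; have := tdot_AMGM u (tscale (-1) v).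
by rewrite !(tdotZl, tdotZr) ler_norml => *; apply/andP; split; lra.
Qed.

Lemma ball_convex (a b : R) u v : 0 <= a -> 0 <= b -> a + b = 1 -> in_ball u -> in_ball v ->
  in_ball (tadd (tscale a u) (tscale b v)).
Proof.
rewrite /in_ball => a0 b0 ab u1 v1; have := tdot_AMGM u v.
rewrite !(tdotDl, tdotDr, tdotZl, tdotZr) (tdotC v u) => h.
have bE : b = 1 - a by lra.
have h1 : a * b * (2 * tdot u v) <= a * b * (tdot u u + tdot v v) by apply: ler_wpM2l => //; exact: mulr_ge0.
have h2 : a * tdot u u <= a by rewrite ler_piMr.
have h3 : b * tdot v v <= b by rewrite ler_piMr.
subst b; nra.
Qed.

Lemma ball_zero : in_ball ([tuple (0:R) | i < k]).
Proof. by rewrite /in_ball /tdot big1 ?ler01// => i _; rewrite tnth_mktuple mul0r. Qed.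

End TDot.

Section BV.
Context d (T : measurableType d) (R : realType) (k : nat).
Implicit Types f g : T -> k.-tuple R.

Definition bv f := forall i, bm (fun x => tnth (f x) i).

Lemma bv_measurable f : bv f -> measurable_fun setT f.
Proof. by move=> bf; apply/measurable_fun_tnthP => i; have [] := bf i. Qed.

Lemma bv_add f g : bv f -> bv g -> bv (fun x => tadd (f x) (g x)).
Proof. by move=> bf bg i; apply: eq_bm (bmD (bf i) (bg i)) => x; rewrite tnth_tadd. Qed.

Lemma bv_scale (a : R) f : bv f -> bv (fun x => tscale a (f x)).
Proof. by move=> bf i; apply: eq_bm (bmZ a (bf i)) => x; rewrite tnth_tscale. Qed.

Lemma bv_smul (a : T -> R) f : bm a -> bv f -> bv (fun x => tscale (a x) (f x)).
Proof. by move=> ba bf i; apply: eq_bm (bmM ba (bf i)) => x; rewrite tnth_tscale. Qed.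

Lemma bv_cst (c : k.-tuple R) : bv (fun=> c).
Proof. by move=> i; exact: bm_cst. Qed.

Lemma bm_tdot f g : bv f -> bv g -> bm (fun x => tdot (f x) (g x)).
Proof. by move=> bf bg; apply: bm_sum => i; exact: bmM. Qed.

End BV.

Lemma bv_comp d d' (T1 : measurableType d) (T2 : measurableType d') (R : realType) k
    (f : T2 -> k.-tuple R) (h : T1 -> T2) :
  bv f -> measurable_fun setT h -> bv (fun x => f (h x)).
Proof. by move=> bf mh i; exact: (bm_comp (bf i) mh). Qed.

Lemma ball_valued_bv (R : realType) n k (f : n.-tuple R -> k.-tuple R) : ball_valued f -> bv f.
Proof.
move=> [mf fb] i; split; first exact: measurable_tnth_comp.
by exists 1 => x; exact: ball_coord.
Qed.

Section Operators.
Context {R : realType} {n k : nat}.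
Variable P : probability (n.-tuple R) R.
Hypothesis gP : std_gaussian P.
Local Notation X := (n.-tuple R).
Local Notation Y := (k.-tuple R).
Implicit Types (f g h : X -> Y) (c : 'I_n -> R).

(* With c constantly equal to rho, stab c f f is the paper's noise stability of f,
   and stab c f g = <f, noise_op c g> in L2. *)
Definition noise_op c f (x : X) : Y :=
  [tuple Ex P (fun z => tnth (f (mix c (co c) x z)) i) | i < k].
Definition stab c f g : R := corr_mean P c (fun x y => tdot (f x) (g y)).
Definition mean f : Y := [tuple Ex P (fun x => tnth (f x) i) | i < k].

Lemma bm_dot2 f g : bv f -> bv g -> bm (fun p : X * X => tdot (f p.1) (g p.2)).
Proof.
move=> bf bg; apply: (bm_tdot (f := fun p : X * X => f p.1) (g := fun p : X * X => g p.2)).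
  exact: (bv_comp bf measurable_fst).
exact: (bv_comp bg measurable_snd).
Qed.

Lemma bv_noise_op c f : bv f -> bv (noise_op c f).
Proof.
move=> bf i.
apply: (@eq_bm _ _ _ (fun x => Ex P (fun z => tnth (f (mix c (co c) x z)) i))).
  by move=> x; rewrite tnth_mktuple.
apply: (@bm_Ex _ _ _ _ _ P (fun x z => tnth (f (mix c (co c) x z)) i)).
by apply: (bm_comp (bf i)); measur.
Qed.

Lemma bm_corr_mean c f g : bv f -> bv g ->
  bm (fun p : X * X => tdot (f p.1) (g (mix c (co c) p.1 p.2))).
Proof.
by move=> bf bg; apply: (@bm_comp2 _ _ _ _ _ _ _ (fun x y => tdot (f x) (g y)) _ _ (bm_dot2 bf bg)); measur.
Qed.

Lemma Ex_tdot_l d (T : measurableType d) (Q : probability T R) (u : Y) (F : T -> Y) : bv F ->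
  Ex Q (fun z => tdot u (F z)) = tdot u [tuple Ex Q (fun z => tnth (F z) i) | i < k].
Proof.
move=> bF; rewrite /tdot Ex_sum; last by move=> i; apply: itgZ; apply: bm_itg; exact: bF.
apply: eq_bigr => i _; rewrite tnth_mktuple ExZ//.
by apply: bm_itg; exact: bF.
Qed.

Lemma stab_noise_op c f g : bv f -> bv g -> stab c f g = Ex P (fun x => tdot (f x) (noise_op c g x)).
Proof.
move=> bf bg; rewrite /stab /corr_mean.
rewrite (@Ex_prod _ _ _ _ _ P P (fun x z => tdot (f x) (g (mix c (co c) x z))) (bm_corr_mean c bf bg)).
apply: eq_Ex => x; apply: Ex_tdot_l.
by apply: (bv_comp bg); measur.
Qed.

Lemma stab_sym c f g : (forall i, 0 <= c i <= 1) -> bv f -> bv g -> stab c f g = stab c g f.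
Proof.
move=> c01 bf bg; rewrite /stab (corr_mean_sym gP c01 (bm_dot2 bf bg)).
by apply: eq_Ex => p; rewrite tdotC.
Qed.

(** The inner product of two averages is an average over two independent noises around the same x,
    which [corr_mean_mul] evaluates. *)
Lemma noise_op_noise_op c d' f g : (forall i, 0 <= c i <= 1) -> (forall i, 0 <= d' i <= 1) ->
  bv f -> bv g ->
  Ex P (fun x => tdot (noise_op c f x) (noise_op d' g x)) = stab (fun i => c i * d' i) f g.
Proof.
move=> c01 d01 bf bg; rewrite /stab -(corr_mean_mul gP c01 d01 (bm_dot2 bf bg)).
apply: eq_Ex => x.
rewrite tdotC -Ex_tdot_l; last by apply: (bv_comp bf); measur.
apply: eq_Ex => z; rewrite tdotC -Ex_tdot_l//.
by apply: (bv_comp bg); measur.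
Qed.

(** The operator with correlations c is the square of the one with correlations [sqrt c], so the
    form is a squared L2 norm. *)
Lemma stab_ge0 c f : (forall i, 0 <= c i <= 1) -> bv f -> 0 <= stab c f f.
Proof.
move=> c01 bf.
have s01 i : 0 <= Num.sqrt (c i) <= 1.
  have /andP[c0 c1] := c01 i.
  by rewrite sqrtr_ge0/= -sqrtr1 ler_wsqrtr.
have -> : stab c f f = stab (fun i => Num.sqrt (c i) * Num.sqrt (c i)) f f.
  congr (stab _ f f); apply/funext => i; rewrite -expr2 sqr_sqrtr//.
  by have /andP[] := c01 i.
rewrite -noise_op_noise_op//; apply: Ex_ge0 => x; exact: tdot_ge0.
Qed.

Lemma stab_addr c f g h : bv f -> bv g -> bv h ->
  stab c h (fun x => tadd (f x) (g x)) = stab c h f + stab c h g.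
Proof.
move=> bf bg bh; rewrite /stab /corr_mean -ExD; [|apply: bm_itg; exact: bm_corr_mean|apply: bm_itg; exact: bm_corr_mean].
by apply: eq_Ex => p; rewrite tdotDr.
Qed.

Lemma stab_scaler c (a : R) f h : bv f -> bv h ->
  stab c h (fun x => tscale a (f x)) = a * stab c h f.
Proof.
move=> bf bh; rewrite /stab /corr_mean -ExZ; last by apply: bm_itg; exact: bm_corr_mean.
by apply: eq_Ex => p; rewrite tdotZr.
Qed.

Lemma stab_addl c f g h : bv f -> bv g -> bv h ->
  stab c (fun x => tadd (f x) (g x)) h = stab c f h + stab c g h.
Proof.
move=> bf bg bh; rewrite /stab /corr_mean -ExD; [|apply: bm_itg; exact: bm_corr_mean|apply: bm_itg; exact: bm_corr_mean].
by apply: eq_Ex => p; rewrite tdotDl.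
Qed.

Lemma stab_scalel c (a : R) f h : bv f -> bv h ->
  stab c (fun x => tscale a (f x)) h = a * stab c f h.
Proof.
move=> bf bh; rewrite /stab /corr_mean -ExZ; last by apply: bm_itg; exact: bm_corr_mean.
by apply: eq_Ex => p; rewrite tdotZl.
Qed.

Lemma stab_quad c (a : R) f g : (forall i, 0 <= c i <= 1) -> bv f -> bv g ->
  stab c (fun x => tadd (f x) (tscale a (g x))) (fun x => tadd (f x) (tscale a (g x))) =
  stab c f f + 2 * a * stab c f g + a ^+ 2 * stab c g g.
Proof.
move=> c01 bf bg; have bag := bv_scale a bg.
rewrite stab_addl//; last exact: bv_add.
rewrite !stab_addr// stab_scaler// stab_scalel// stab_scaler// stab_scalel//.
by rewrite (stab_sym c01 bg bf); ring.
Qed.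

Lemma stab_cstr c (m : Y) f : (forall i, 0 <= c i <= 1) -> bv f ->
  stab c f (fun=> m) = tdot (mean f) m.
Proof.
move=> c01 bf; rewrite stab_noise_op//; last exact: bv_cst.
rewrite tdotC -Ex_tdot_l//; apply: eq_Ex => x; rewrite tdotC; congr (tdot _ _).
by apply: eq_from_tnth => i; rewrite tnth_mktuple Ex_cst.
Qed.

(** Pair with a constant unit vector: the operator is symmetric and fixes constants. *)
Lemma mean_noise_op c f : (forall i, 0 <= c i <= 1) -> bv f -> mean (noise_op c f) = mean f.
Proof.
move=> c01 bf; apply: eq_from_tnth => i.
pose e := [tuple (j == i)%:R : R | j < k].
have E (v : Y) : tdot e v = tnth v i.
  rewrite /tdot (bigD1 i)//= tnth_mktuple eqxx mul1r big1 ?addr0// => j /negbTE ji.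
  by rewrite tnth_mktuple ji mul0r.
rewrite -!E [RHS]tdotC -(stab_cstr e c01 bf) stab_sym//; last exact: bv_cst.
rewrite stab_noise_op//; last exact: bv_cst.
by rewrite Ex_tdot_l//; exact: bv_noise_op.
Qed.

Definition cst_corr (rho : R) : 'I_n -> R := fun=> rho.

Lemma noise_stabE (rho : R) f : bv f -> noise_stab P rho f = (stab (cst_corr rho) f f)%:E.
Proof.
move=> bf; rewrite /stab /corr_mean -ExE; last by apply: bm_itg; exact: bm_corr_mean.
apply: eq_integral => p _; congr (tdot _ (f _))%:E.
by apply: eq_from_tnth => i; rewrite tnth_mix tnth_tadd !tnth_tscale.
Qed.

Lemma mean_zeroE f : bv f -> mean_zero P f <-> forall i, tnth (mean f) i = 0.
Proof.
move=> bf; split => H i.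
  by apply: EFin_inj; rewrite tnth_mktuple -ExE//; apply: bm_itg; exact: bf.
rewrite ExE; last by apply: bm_itg; exact: bf.
by have := H i; rewrite tnth_mktuple => ->.
Qed.

Definition adm f := ball_valued f /\ forall i, tnth (mean f) i = 0.

Lemma adm_bv f : adm f -> bv f.
Proof. by move=> [/ball_valued_bv]. Qed.

Lemma optimally_stableE (rho : R) f : optimally_stable P rho f <->
  adm f /\ forall g, adm g -> stab (cst_corr rho) g g <= stab (cst_corr rho) f f.
Proof.
split=> [[bf mf H]|[[bf mf] H]].
  have bvf := ball_valued_bv bf.
  split; first by split => //; apply/mean_zeroE.
  move=> g [bg mg]; have bvg := ball_valued_bv bg.
  have := H g bg; rewrite noise_stabE// noise_stabE// lee_fin; apply.
  exact/mean_zeroE.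
have bvf := ball_valued_bv bf; split => //; first exact/mean_zeroE.
move=> g bg mg; have bvg := ball_valued_bv bg.
rewrite noise_stabE// noise_stabE// lee_fin; apply: H; split => //.
exact/mean_zeroE.
Qed.

(** Averaging [2 <m, F> <= |m|^2 + |F|^2], with m the mean of F, gives [2 |m|^2 <= |m|^2 + 1]. *)
Lemma ball_Ex d (T : measurableType d) (Q : probability T R) (F : T -> Y) :
  bv F -> (forall z, in_ball (F z)) -> in_ball [tuple Ex Q (fun z => tnth (F z) i) | i < k].
Proof.
move=> bF F1; rewrite /in_ball; set m := [tuple _ | _ < _].
have : Ex Q (fun z => 2 * tdot m (F z)) <= Ex Q (fun z => tdot m m + tdot (F z) (F z)).
  apply: Ex_le => [||z]; last exact: tdot_AMGM.
    by apply: itgZ; apply: bm_itg; apply: bm_tdot => //; exact: bv_cst.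
  by apply: itgD; [exact: itg_cst|apply: bm_itg; exact: bm_tdot].
rewrite ExZ; last by apply: bm_itg; apply: bm_tdot => //; exact: bv_cst.
rewrite Ex_tdot_l// -/m ExD; [|exact: itg_cst|by apply: bm_itg; exact: bm_tdot].
rewrite Ex_cst => h.
have : Ex Q (fun z => tdot (F z) (F z)) <= 1.
  rewrite -[leRHS](Ex_cst Q); apply: Ex_le => //; last exact: itg_cst.
  by apply: bm_itg; exact: bm_tdot.
by move: h; lra.
Qed.

Lemma adm_noise_op c f : (forall i, 0 <= c i <= 1) -> adm f -> adm (noise_op c f).
Proof.
move=> c01 af; have bf := adm_bv af; have [[mf f1] m0] := af; split.
  split; first by apply: bv_measurable; exact: bv_noise_op.
  move=> x; apply: ball_Ex => [|z]; last exact: f1.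
  by apply: (bv_comp bf); measur.
by rewrite mean_noise_op.
Qed.

Lemma adm_convex (a b : R) f g : 0 <= a -> 0 <= b -> a + b = 1 -> adm f -> adm g ->
  adm (fun x => tadd (tscale a (f x)) (tscale b (g x))).
Proof.
move=> a0 b0 ab af ag; have bf := adm_bv af; have bg := adm_bv ag.
have [[mf f1] mf0] := af; have [[mg g1] mg0] := ag; split.
  split; first by apply: bv_measurable; apply: bv_add; exact: bv_scale.
  by move=> x; exact: ball_convex.
move=> i; rewrite tnth_mktuple.
have -> : Ex P (fun x => tnth (tadd (tscale a (f x)) (tscale b (g x))) i) =
  Ex P (fun x => a * tnth (f x) i + b * tnth (g x) i).
  by apply: eq_Ex => x; rewrite tnth_tadd !tnth_tscale.
have iF := bm_itg P (bf i); have iG := bm_itg P (bg i).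
rewrite ExD; [|exact: itgZ|exact: itgZ].
have := mf0 i; have := mg0 i; rewrite !tnth_mktuple => eg ef.
by rewrite !ExZ// ef eg !mulr0 addr0.
Qed.

Lemma stab_le1 c f : adm f -> stab c f f <= 1.
Proof.
move=> af; have bf := adm_bv af; rewrite /stab /corr_mean -[leRHS](Ex_cst (P \x P)%E).
apply: Ex_le; [by apply: bm_itg; exact: bm_corr_mean|exact: itg_cst|].
move=> p; have [[_ f1] _] := af; exact: (le_trans (ler_norm _) (ball_dot_abs _ _)).
Qed.

End Operators.

(** * Optimal maps are unimodular *)

Section GamSets.
Context {R : realType}.
Local Notation gam := (@gam R).
Local Notation leb := (@lebesgue_measure R).

Lemma gam_set1 (a : R) : gam [set a] = 0%E.
Proof.
rewrite gamE; have /null_content_dominatesP := @normal_prob_dominates R 0 1; apply.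
  exact: measurable_set1.
exact: lebesgue_measure_set1.
Qed.

(** [phi] is positive everywhere, so a Gaussian null interval would be Lebesgue null. *)
Lemma gam_itv_gt0 (a b : R) : a < b -> gam (`]a, b]%classic : set R) <> 0%E.
Proof.
move=> ab g0.
have mI : measurable (`]a, b]%classic : set R) by exact: measurable_itv.
have mi : measurable_fun [set: R] (fun x : R => (\1_(`]a, b]%classic : set R) x : R)%:E).
  by apply/measurable_EFinP; exact: measurable_indic.
have := @integral_gam R (fun x => (\1_(`]a, b]%classic : set R) x : R)%:E) mi (fun=> _).
have -> : (\int[gam]_x (\1_(`]a, b]%classic : set R) x : R)%:E = 0)%E.
  rewrite (@integral_indic _ _ _ gam setT measurableT); last exact: mI.
  by rewrite setIT.
move=> /(_ _)/esym H.
have {}H : (\int[leb]_x `|(\1_(`]a, b]%classic : set R) x : R)%:E * (phi x)%:E|)%E = 0%E.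
  rewrite -[RHS]H; last by move=> x; rewrite lee_fin.
  by apply: eq_integral => x _; rewrite gee0_abs// mule_ge0// lee_fin phi_ge0.
have mp : measurable_fun [set: R] (fun x => (\1_(`]a, b]%classic : set R) x : R)%:E * (phi x)%:E)%E.
  by apply: emeasurable_funM => //; apply/measurable_EFinP; exact: measurable_phi.
have /(ae_eq_integral_abs leb measurableT mp) [N [mN N0 sN]] := H.
have : (leb (`]a, b]%classic : set R) <= leb N)%E.
  apply: le_measure; rewrite ?inE//.
  move=> x xI; apply: sN => /= /(_ I) /eqP.
  rewrite -EFinM eqe indicE mem_set// mul1r => /eqP p0.
  by have := phi_gt0 x; rewrite p0 ltxx.
rewrite N0 lebesgue_measure_itv /= lte_fin ab -EFinD lee_fin; lra.
Qed.

End GamSets.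

Section UnitVec.
Context {R : realType} {k : nat}.
Definition ev (j : 'I_k) : k.-tuple R := [tuple (l == j)%:R : R | l < k].

Lemma tdot_ev j (v : k.-tuple R) : tdot (ev j) v = tnth v j.
Proof.
rewrite /tdot (bigD1 j)//= tnth_mktuple eqxx mul1r big1 ?addr0// => l /negbTE lj.
by rewrite tnth_mktuple lj mul0r.
Qed.

Lemma ev_ev j : tdot (ev j) (ev j) = 1.
Proof. by rewrite tdot_ev tnth_mktuple eqxx. Qed.

End UnitVec.

Section UnitModulus.
Context {R : realType} {n k : nat}.
Variable P : probability (n.-tuple R) R.
Hypothesis gP : std_gaussian P.
Local Notation gam := (@gam R).
Local Notation X := (n.-tuple R).
Local Notation Y := (k.-tuple R).

Lemma mpres_coord (i : 'I_n) : mpres P gam (fun x : X => tnth x i).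
Proof.
apply: Ex_mpres; first exact: measurable_tnth.
move=> F bF.
have b : bm (fun x : X => F (tnth x i)) by apply: (bm_comp bF); exact: measurable_tnth.
rewrite -(Ex_resample i gP b) -[RHS](Ex_cst P); apply: eq_Ex => x.
by apply: eq_Ex => a; rewrite tnth_upd eqxx.
Qed.

Variables (rho : R) (rho0 : 0 < rho) (rho1 : rho < 1).
Variables (i0 : 'I_n) (j0 : 'I_k).

Let c : 'I_n -> R := cst_corr rho.
Let c01 i : 0 <= c i <= 1. Proof. by rewrite /c /cst_corr !ltW. Qed.

(** The indicator of a half-line. Its noisy version [W] is strictly increasing, which yields an
    explicit function in the range of the noise operator all of whose level sets are null. *)
Let hs (a : R) : R := \1_(`]0, +oo[%classic : set R) a.
Let W (a : R) : R := Ex gam (fun z : R => hs (rho * a + co c i0 * z)).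

Let bm_hs : bm hs.
Proof. by apply: bm_indic; exact: measurable_itv. Qed.

Let co_gt0 : 0 < co c i0.
Proof. by rewrite /co sqrtr_gt0 subr_gt0 /c /cst_corr expr_lt1// ltW. Qed.

Let bW : bm W.
Proof.
apply: (@bm_Ex _ _ _ _ _ gam (fun a z => hs (rho * a + co c i0 * z))).
by apply: (bm_comp bm_hs); measur.
Qed.

Let W01 a : 0 <= W a <= 1.
Proof.
apply/andP; split; first by apply: Ex_ge0 => z; rewrite /hs indicE.
rewrite -[leRHS](Ex_cst gam); apply: Ex_le; last by move=> z; rewrite /hs indicE; case: (_ \in _).
  by apply: bm_itg; apply: (bm_comp bm_hs); measur.
exact: itg_cst.
Qed.

(** Raising a lowers the threshold on z; the difference is the mass of a nondegenerate interval. *)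
Let W_mono a b : a < b -> W a < W b.
Proof.
move=> ab; rewrite -subr_gt0.
have bh x : bm (fun z : R => hs (rho * x + co c i0 * z)) by apply: (bm_comp bm_hs); measur.
rewrite /W -ExB; [|exact: (bm_itg gam (bh b))|exact: (bm_itg gam (bh a))].
have cg := co_gt0.
pose l := - (rho * b) / co c i0; pose u := - (rho * a) / co c i0.
have lu : l < u by rewrite ltr_pM2r ?invr_gt0// ltrN2 ltr_pM2l.
have E : Ex gam (fun z : R => hs (rho * b + co c i0 * z) - hs (rho * a + co c i0 * z)) =
  Ex gam (\1_(`]l, u]%classic : set R)).
  apply: eq_Ex => z; rewrite /hs !indicE !mem_setE !in_itv /= !andbT.
  rewrite /l /u ltr_pdivrMr// ler_pdivlMr//.
  have rab : rho * a < rho * b by rewrite ltr_pM2l.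
  case: ltP => h1; case: ltP => h2; case: ltP => h3; case: leP => h4 //=; lra.
rewrite E lt_def; apply/andP; split; last by apply: Ex_ge0 => x; rewrite indicE.
apply/eqP => E0; apply: (gam_itv_gt0 lu).
by apply: etrans (Ex_indic gam _) _; [exact: measurable_itv|rewrite E0].
Qed.

(** A strictly increasing function takes the value [w] at one point at most, and points are Gaussian
    null. *)
Lemma W_ae (w : R) : {ae P, forall x : X, W (tnth x i0) != w}.
Proof.
suff H0 : {ae gam, forall a, W a != w} by exact: (mpres_ae (mpres_coord i0) H0).
have [[a Wa]|H] := pselect (exists a, W a = w); last first.
  by apply: aeW => x; apply/eqP => Wx; apply: H; exists x.
exists [set a]; split; [exact: measurable_set1|exact: gam_set1|].
move=> x /= /negP; rewrite negbK => /eqP Wx; apply/eqP.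
case: (ltgtP x a) => // /W_mono; rewrite Wx Wa ltxx //.
Qed.

Let psi (x : X) : Y := tscale (hs (tnth x i0)) (ev j0).

Let bpsi : bv psi.
Proof.
apply: bv_smul; last exact: bv_cst.
by apply: (bm_comp bm_hs); exact: measurable_tnth.
Qed.

Let Tpsi x : noise_op P c psi x = tscale (W (tnth x i0)) (ev j0).
Proof.
apply: eq_from_tnth => l; rewrite tnth_mktuple tnth_tscale mulrC.
rewrite -ExZ; last by apply: bm_itg; apply: (bm_comp bm_hs); measur.
have b : bm (fun a : R => tnth (ev j0 : Y) l * hs (rho * tnth x i0 + co c i0 * a)).
  by apply: bmZ; apply: (bm_comp bm_hs); measur.
rewrite -[RHS](mpres_Ex (mpres_coord i0) (bm_itg gam b)).
by apply: eq_Ex => z; rewrite tnth_tscale tnth_mix mulrC.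
Qed.

(* The perturbation (1 - |f|^2)(W(x_i0) - wb) e_j0, with wb chosen to keep the mean
   zero, is admissible in both directions, so its stability vanishes.  By
   Cauchy-Schwarz it is then orthogonal to W(x_i0) e_j0, the noisy half-space. *)
Lemma opt_unit (f : X -> Y) : adm P f -> (forall g : X -> Y, adm P g -> stab P c g g <= stab P c f f) ->
  {ae P, forall x, tdot (f x) (f x) = 1}.
Proof.
move=> af fopt; have bf := adm_bv af; have [[mf f1] f0] := af.
pose a x := 1 - tdot (f x) (f x).
have a0 x : 0 <= a x by rewrite subr_ge0; exact: f1.
have a1 x : a x <= 1 by rewrite lerBlDr lerDl tdot_ge0.
have ba : bm a by apply: bmB; [exact: bm_cst|exact: bm_tdot].
suff : {ae P, forall x, a x = 0} by apply: filterS => x; rewrite /a; lra.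
have [Ea0|Ea0] := eqVneq (Ex P a) 0; first by apply: Ex_eq0_ae => //; exact: bm_itg.
have bWx : bm (fun x : X => W (tnth x i0)) by apply: (bm_comp bW); exact: measurable_tnth.
pose wb := Ex P (fun x => a x * W (tnth x i0)) / Ex P a.
have Ea : 0 < Ex P a by rewrite lt_def Ea0 Ex_ge0.
have iaW : itg P (fun x => a x * W (tnth x i0)) by apply: bm_itg; exact: bmM.
have wb01 : 0 <= wb <= 1.
  apply/andP; split.
    by apply: divr_ge0; [apply: Ex_ge0 => x; rewrite mulr_ge0//; have /andP[] := W01 (tnth x i0)|exact: ltW].
  rewrite ler_pdivrMr// mul1r; apply: Ex_le => //; first exact: bm_itg.
  by move=> x; rewrite ler_piMr//; have /andP[] := W01 (tnth x i0).
pose v x := a x * (W (tnth x i0) - wb).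
have bv_ : bm v by apply: bmM => //; apply: bmB => //; exact: bm_cst.
have va x : `|v x| <= a x.
  rewrite normrM (ger0_norm (a0 x)) ler_piMr// ler_norml.
  have /andP[? ?] := W01 (tnth x i0); move: wb01 => /andP[? ?].
  by apply/andP; split; lra.
have Ev : Ex P v = 0.
  rewrite /v (@eq_Ex _ _ _ P _ (fun x => a x * W (tnth x i0) - wb * a x)); last by move=> x; ring.
  rewrite ExB//; last by apply: itgZ; exact: bm_itg.
  by rewrite ExZ; [rewrite /wb divfK// subrr|exact: bm_itg].
pose ph x : Y := tscale (v x) (ev j0).
have bph : bv ph by apply: bv_smul => //; exact: bv_cst.
(* With [|s| <= 1/4] the squared length grows by at most [2 a / 4 + a / 4], within the room a left
   by [|f|^2 = 1 - a]. *)
have admpm (s : R) : `|s| <= 4^-1 -> adm P (fun x => tadd (f x) (tscale s (ph x))).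
  move=> s4; have bfs := bv_add bf (bv_scale s bph); split; first split.
  - exact: bv_measurable.
  - move=> x; rewrite /in_ball !(tdotDl, tdotDr, tdotZl, tdotZr, tdotC (ev j0) (f x)).
    rewrite ev_ev tdotC tdot_ev.
    have fj := ball_coord j0 (f1 x).
    have sv : `|s * v x| <= 4^-1 * a x by rewrite normrM; apply: ler_pM.
    have q1 : `|s * v x * tnth (f x) j0| <= 4^-1 * a x.
      by rewrite normrM; apply: le_trans sv; rewrite ler_piMr.
    have q2 : (s * v x) ^+ 2 <= 4^-1 * a x.
      have : `|s * v x| ^+ 2 <= 4^-1 * a x.
        by rewrite expr2; have := a1 x; have := a0 x; have : 0 <= `|s * v x| by []; move: sv; nra.
      by rewrite -normrX ger0_norm ?sqr_ge0.
    move: q1; rewrite ler_norml => /andP[_ q1].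
    have : a x = 1 - tdot (f x) (f x) by [].
    have := a0 x; move: q2; rewrite expr2; lra.
  - move=> i; rewrite tnth_mktuple.
    rewrite (@eq_Ex _ _ _ P _ (fun x => tnth (f x) i + (s * tnth (ev j0 : Y) i) * v x)); last first.
      by move=> x; rewrite tnth_tadd !tnth_tscale; ring.
    rewrite ExD; [|by apply: bm_itg; exact: bf|by apply: itgZ; exact: bm_itg].
    rewrite ExZ; last exact: bm_itg.
    by rewrite Ev mulr0 addr0; have := f0 i; rewrite tnth_mktuple.
(* Adding the inequalities for the two signs cancels the cross term and leaves a nonnegative form
   that is at most 0. *)
have J0 : stab P c ph ph = 0.
  have Jge := stab_ge0 gP c01 bph.
  have h1 := fopt _ (admpm 4^-1 _); have h2 := fopt _ (admpm (- 4^-1) _).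
  rewrite stab_quad// in h1; rewrite stab_quad// in h2.
  move: h1 h2; rewrite normrN ger0_norm// lexx => /(_ isT) h1 /(_ isT) h2.
  move: h1 h2; rewrite sqrrN; set b := stab P c f ph; set q := stab P c ph ph in Jge *; set e := 4^-1 ^+ 2.
  have e0 : 0 < e :> R by rewrite exprn_gt0.
  have : 0 <= e * q by rewrite mulr_ge0// ltW.
  move=> eq0 h1 h2; have : e * q = 0 by lra.
  by move=> /eqP; rewrite mulf_eq0 gt_eqF//= => /eqP.
have B0 : stab P c ph psi = 0.
  (* An affine function of s that is nonnegative everywhere has slope 0: otherwise the s chosen
     below would give the value -1. *)
  have H (s : R) : 0 <= stab P c psi psi + 2 * s * stab P c psi ph.
    have := stab_ge0 gP c01 (bv_add bpsi (bv_scale s bph)).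
    by rewrite stab_quad// J0 mulr0 addr0.
  rewrite stab_sym//; set b := stab P c psi ph in H *; set q := stab P c psi psi in H.
  apply/eqP; apply: contraT => bn0.
  have := H (- (q + 1) / (2 * b)).
  have -> : 2 * (- (q + 1) / (2 * b)) * b = - (q + 1) by field.
  by rewrite opprD addrA subrr; lra.
(* As [E v = 0], pairing v with [W] or with [W - wb] gives the same value, and the second pairing
   has a nonnegative integrand. *)
have : Ex P (fun x => a x * (W (tnth x i0) - wb) ^+ 2) = 0.
  transitivity (Ex P (fun x => v x * W (tnth x i0)) - wb * Ex P v).
    rewrite -ExZ; last exact: bm_itg.
    rewrite -ExB; [|by apply: bm_itg; exact: bmM|by apply: itgZ; exact: bm_itg].
    by apply: eq_Ex => x; rewrite /v; ring.
  rewrite Ev mulr0 subr0 -[RHS]B0 stab_noise_op//; apply: eq_Ex => x.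
  by rewrite Tpsi /ph tdotZl tdotZr ev_ev mulr1.
move=> /(Ex_eq0_ae _ _) H.
have {}H : {ae P, forall x, a x * (W (tnth x i0) - wb) ^+ 2 = 0}.
  apply: H => [|x]; last by rewrite mulr_ge0// sqr_ge0.
  apply: bm_itg; apply: bmM => //.
  have b1 : bm (fun x : X => W (tnth x i0) - wb) by apply: bmB => //; exact: bm_cst.
  by apply: eq_bm (bmM b1 b1) => x; rewrite expr2.
apply: filterS2 H (W_ae wb) => x /eqP; rewrite mulf_eq0 sqrf_eq0 => /orP[/eqP//|/eqP Wx /eqP[]].
exact: subr0_eq Wx.
Qed.

End UnitModulus.

(** * Second variation *)

Section Competitor.
Context {R : realType} {n k : nat}.
Variable P : probability (n.-tuple R) R.
Hypothesis gP : std_gaussian P.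
Local Notation X := (n.-tuple R).
Local Notation Y := (k.-tuple R).

(** Subtracting the mean m and dividing by [1 + M], with M the l1 norm of m, makes g admissible at a
    cost linear in M. *)
Lemma opt_recenter (c : 'I_n -> R) (f g : X -> Y) : (forall i, 0 <= c i <= 1) ->
  adm P f -> (forall g : X -> Y, adm P g -> stab P c g g <= stab P c f f) -> ball_valued g ->
  stab P c g g <= stab P c f f + (3 + k%:R) * \sum_i `|tnth (mean P g) i|.
Proof.
move=> c01 af fopt [mg g1]; have bg := ball_valued_bv (conj mg g1).
set m := mean P g; set M := \sum_i _.
have M0 : 0 <= M by exact: sumr_ge0.
have m1 i : `|tnth m i| <= 1.
  rewrite tnth_mktuple; apply: Ex_bound; first by have [] := bg i.
  by move=> x; exact: ball_coord.
have Mk : M <= k%:R.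
  apply: (@le_trans _ _ (\sum_(i < k) 1)); first exact: ler_sum.
  by rewrite sumr_const card_ord.
have mm : tdot m m <= M.
  apply: ler_sum => i _; apply: (le_trans (ler_norm _)); rewrite normrM.
  by rewrite ler_piMr.
pose g' x := tscale (1 + M)^-1 (tadd (g x) (tscale (-1) m)).
have bgm : bv (fun x => tadd (g x) (tscale (-1) m)).
  by apply: bv_add => //; exact: bv_cst.
have M1 : 0 < 1 + M by lra.
have ag' : adm P g'.
  split; first split.
  - by apply: bv_measurable; exact: bv_scale.
  - move=> x; rewrite /in_ball /g' tdotZl tdotZr mulrA -expr2 exprVn.
    rewrite mulrC ler_pdivrMr ?exprn_gt0// mul1r.
    rewrite !(tdotDl, tdotDr, tdotZl, tdotZr) (tdotC m (g x)).
    have gm : `|tdot (g x) m| <= M.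
      apply: (le_trans (ler_norm_sum _ _ _)); apply: ler_sum => i _; rewrite normrM.
      by rewrite ler_piMl//; exact: ball_coord.
    have gg := g1 x; rewrite /in_ball in gg.
    move: gm; rewrite ler_norml => /andP[gm1 gm2].
    have := sqr_ge0 M; rewrite sqrrD expr1n mul1r.
    have mM : tdot m m <= M ^+ 2.
      rewrite /M expr2 mulr_suml /tdot; apply: ler_sum => i _.
      apply: (le_trans (ler_norm _)); rewrite normrM; apply: ler_wpM2l => //.
      by rewrite (bigD1 i)//= lerDl; exact: sumr_ge0.
    by rewrite -mulr_natl; lra.
  - move=> i; rewrite tnth_mktuple.
    rewrite (@eq_Ex _ _ _ P _ (fun x => (1 + M)^-1 * (tnth (g x) i - tnth m i))); last first.
      by move=> x; rewrite tnth_tscale tnth_tadd tnth_tscale mulN1r.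
    have ig : itg P (fun x => tnth (g x) i) by apply: bm_itg; exact: bg.
    rewrite ExZ; last by apply: itgB => //; exact: itg_cst.
    rewrite ExB//; last exact: itg_cst.
    by rewrite Ex_cst /m tnth_mktuple subrr mulr0.
have := fopt _ ag'.
rewrite /g' stab_scalel//; last exact: bv_scale.
rewrite stab_scaler// stab_quad//; last exact: bv_cst.
rewrite !stab_cstr//; last exact: bv_cst.
have -> : mean P (fun=> m) = m :> Y.
  by apply: eq_from_tnth => i; rewrite tnth_mktuple Ex_cst.
rewrite -/m mulrA -expr2 exprVn mulrC ler_pdivrMr ?exprn_gt0// => h.
have J1 := stab_le1 c af; have J0 := stab_ge0 gP c01 (adm_bv af).
set J := stab P c f f in h J1 J0 *; set G := stab P c g g in h *.
(* The scaling costs [2 M + M^2] and the subtraction [|m|^2 <= M]; with [M <= k] the total is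
   [(3 + k) M]. *)
have h2 : J * (1 + M) ^+ 2 <= J + (2 * M + M ^+ 2).
  rewrite sqrrD expr1n mul1r -mulr_natl.
  have : J * (2 * M + M ^+ 2) <= 2 * M + M ^+ 2.
    by rewrite ler_piMl// addr_ge0 ?sqr_ge0// mulr_ge0.
  by lra.
have h3 : M ^+ 2 <= k%:R * M by rewrite expr2 ler_wpM2r.
by rewrite sqrrN expr1n in h; lra.
Qed.

End Competitor.

(** * Shrunk and shifted copies of a map *)

Section Variation.
Context {R : realType} {n k : nat}.
Variable P : probability (n.-tuple R) R.
Hypothesis gP : std_gaussian P.
Local Notation gam := (@gam R).
Local Notation Rm := (measurableTypeR R).
Local Notation X := (n.-tuple R).
Local Notation Y := (k.-tuple R).
Variables (rho : R) (rho0 : 0 < rho) (rho1 : rho < 1) (j : 'I_n).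
Variable f : X -> Y.
Hypothesis ballf : ball_valued f.

Definition cj (r : R) : 'I_n -> R := fun i => if i == j then r else rho.

Let bf : bv f := ball_valued_bv ballf.

Section Step.
Variables (t s : R).
Hypothesis t0 : 0 <= t.
Hypothesis s2 : 2^-1 <= s.
Hypothesis st : s ^+ 2 + t ^+ 2 = 1.

(** Were [tau] equal to t times an independent standard Gaussian, [s * x_j + tau] would again be
    standard. Here [tau] is a number, so the result is a genuine competitor. *)
Definition shrink_shift (tau : R) (x : X) : Y := f (upd x j (s * tnth x j + tau)).

Let s0 : 0 < s. Proof. by apply: lt_le_trans s2; rewrite invr_gt0. Qed.

Lemma ball_shrink_shift tau : ball_valued (shrink_shift tau).
Proof.
have [mf f1] := ballf; split; last by move=> x; exact: f1.
by apply: (measurableT_comp mf); measur.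
Qed.

Definition chi (i : 'I_k) (tau : R) : R := Ex P (fun x => tnth (shrink_shift tau x) i).

(** Freezing the j-th coordinate exhibits [chi] as a Gaussian average of a bounded function shifted
    by [tau / s], since [s * x + tau = s * (x + tau / s)]. *)
Let Bch (i : 'I_k) (v : R) : R := Ex P (fun x => tnth (f (upd x j (s * v))) i).

Let bBch i : bm (Bch i).
Proof.
apply: (@bm_Ex _ _ _ _ _ P (fun (v : Rm) x => tnth (f (upd x j (s * v))) i)).
by apply: (bm_comp (bf i)); measur.
Qed.

Let chiE i tau : chi i tau = Ex gam (fun v => Bch i (v + tau / s)).
Proof.
rewrite /chi.
have b : bm (fun x => tnth (shrink_shift tau x) i) by have [] := ball_valued_bv (ball_shrink_shift tau) i.
rewrite -(Ex_resample j gP b).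
have b2 : bm (fun p : X * Rm => tnth (shrink_shift tau (upd p.1 j p.2)) i).
  by apply: (bm_comp b); measur.
rewrite (@Ex_exch _ _ _ _ _ P gam (fun x a => tnth (shrink_shift tau (upd x j a)) i) b2).
apply: eq_Ex => v; apply: eq_Ex => x; rewrite /shrink_shift upd_upd tnth_upd eqxx.
by congr (tnth (f (upd x j _)) i); field; rewrite gt_eqF.
Qed.

(** The factor 8 is [2^3], from [s >= 1/2]. *)
Let invs3 (tau : R) : `|tau / s| ^+ 3 <= 8 * `|tau| ^+ 3.
Proof.
rewrite normrM exprMn mulrC ler_wpM2r ?exprn_ge0//.
rewrite normfV exprVn (gtr0_norm s0) -[8]invrK lef_pV2 ?posrE ?exprn_gt0 ?invr_gt0//.
have -> : 8^-1 = 2^-1 ^+ 3 :> R by rewrite exprVn; congr (_^-1); ring.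
by apply: lerXn2r; rewrite ?nnegrE ?invr_ge0// ltW.
Qed.

Let tayK0 : 0 <= tayK (R := R).
Proof. by rewrite /tayK; have := @tayC_ge0 R; have := @Ex_abs_ge0 R; lra. Qed.

Let chi_taylor i : exists c : R * R * R, forall tau,
  `|chi i tau - (c.1.1 + tau * c.1.2 + tau ^+ 2 * c.2)| <= (8 * tayK (R := R)) * `|tau| ^+ 3.
Proof.
have B1 v : `|Bch i v| <= 1.
  apply: Ex_bound; last by move=> x; apply: ball_coord; have [_] := ballf.
  by have [] : bm (fun x => tnth (f (upd x j (s * v))) i) by apply: (bm_comp (bf i)); measur.
have [c Hc] := Ex_taylor (proj1 (bBch i)) B1.
exists (c.1.1, c.1.2 / s, c.2 / s ^+ 2) => tau /=; rewrite chiE.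
have := Hc (tau / s); rewrite mulr1 => h.
rewrite (_ : c.1.1 + _ + _ = c.1.1 + tau / s * c.1.2 + (tau / s) ^+ 2 * c.2); last first.
  by field; rewrite gt_eqF.
apply: (le_trans h); rewrite [8 * _]mulrC -mulrA; apply: ler_wpM2l => //; exact: invs3.
Qed.

Let bchi i : bm (chi i).
Proof.
apply: (@bm_Ex _ _ _ _ _ P (fun (v : Rm) x => tnth (shrink_shift v x) i)).
by apply: (bm_comp (bf i)); measur.
Qed.

Let Cs (i : 'I_n) : R := if i == j then s else 1.
Let Ss (i : 'I_n) : R := if i == j then t else 0.

Let CS i : Cs i ^+ 2 + Ss i ^+ 2 = 1.
Proof. by rewrite /Cs /Ss; case: eqP => // _; rewrite expr1n expr0n addr0. Qed.

Let mixE x z : mix Cs Ss x z = upd x j (s * tnth x j + t * tnth z j).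
Proof.
apply: eq_from_tnth => l; rewrite tnth_mix tnth_upd /Cs /Ss.
by case: eqP => [->//|_]; rewrite mul1r mul0r addr0.
Qed.

(** Under Gaussian shifts the j-th coordinate is partially resampled and keeps its law. *)
Let Ex_chi i : Ex gam (fun a => chi i (t * a)) = tnth (mean P f) i.
Proof.
have b : bm (fun a : Rm => chi i (t * a)) by apply: (bm_comp (bchi i)); measur.
rewrite -(mpres_Ex (mpres_coord gP j) (bm_itg gam b)) /chi tnth_mktuple.
have b2 : bm (fun p : X * X => tnth (f (mix Cs Ss p.1 p.2)) i).
  by apply: (bm_comp (bf i)); measur.
rewrite -(mpres_Ex (mpres_mix gP CS) (bm_itg P (bf i))).
rewrite (Ex_fub2 P P b2); apply: eq_Ex => z; apply: eq_Ex => x.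
by rewrite /= mixE.
Qed.

Let itg_coord (l : 'I_n) : itg P (fun x : X => tnth x l).
Proof. exact: (mpres_itg (mpres_coord gP l) itg_id). Qed.

(** For the reflected pair (y, w) one has [z_j = t * y_j - s * w_j], and f is evaluated at y. The
    mean of [f_i(y) * y_j] vanishes by hypothesis, that of [f_i(y) * w_j] by independence. *)
Let Ex_chi1 i : Ex P (fun x => tnth (f x) i * tnth x j) = 0 -> tnth (mean P f) i = 0 ->
  Ex gam (fun a => a * chi i (t * a)) = 0.
Proof.
move=> m1 m0.
have b : bm (fun a : Rm => chi i (t * a)) by apply: (bm_comp (bchi i)); measur.
have i1 : itg gam (fun a : R => a * chi i (t * a)).
  apply: (@eq_itg _ _ _ gam (fun a => chi i (t * a) * a)); first by move=> x; rewrite mulrC.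
  by apply: itg_bmM => //; exact: itg_id.
rewrite -(mpres_Ex (mpres_coord gP j) i1).
have iz : itg (P \x P)%E (fun p : X * X => tnth p.2 j).
  exact: (mpres_itg (mpres_snd P P) (itg_coord j)).
have ix : itg (P \x P)%E (fun p : X * X => tnth p.1 j).
  exact: (mpres_itg (mpres_fst P P) (itg_coord j)).
have bfx : bm (fun p : X * X => tnth (f p.1) i) by apply: (bm_comp (bf i)); measur.
have ifx := itg_bmM bfx ix.
have ifz := itg_bmM bfx iz.
pose H (p : X * X) := t * (tnth (f p.1) i * tnth p.1 j) - s * (tnth (f p.1) i * tnth p.2 j).
have iH : itg (P \x P)%E H by apply: itgB; exact: itgZ.
have EH : Ex (P \x P)%E H = 0.
  rewrite ExB; [|exact: itgZ|exact: itgZ]; rewrite !ExZ//.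
  rewrite (Ex_fub_itg ifx); last by move=> x /=; exact: itg_cst.
  rewrite (@eq_Ex _ _ _ P _ (fun x => tnth (f x) i * tnth x j)); last by move=> x /=; exact: Ex_cst.
  rewrite m1 mulr0 sub0r (Ex_fub_itg ifz); last by move=> x /=; apply: itgZ; exact: itg_coord.
  rewrite (@eq_Ex _ _ _ P _ (fun=> 0)) ?Ex_cst ?mulr0 ?oppr0// => x /=.
  rewrite ExZ; last exact: itg_coord.
  by rewrite (mpres_Ex (mpres_coord gP j) (@itg_id R)) (@Ex_odd R 1)// mulr0.
rewrite -[RHS]EH -(mpres_Ex (mpres_refl gP CS) iH).
have bm2 : bm (fun p : X * X => tnth (f (mix Cs Ss p.1 p.2)) i) by apply: (bm_comp (bf i)); measur.
have i3 : itg (P \x P)%E (fun p : X * X => tnth (f (mix Cs Ss p.1 p.2)) i * tnth p.2 j).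
  exact: itg_bmM.
transitivity (Ex (P \x P)%E (fun p : X * X => tnth (f (mix Cs Ss p.1 p.2)) i * tnth p.2 j)).
  have sw : mpres (P \x P)%E (P \x P)%E (fun p : X * X => (p.2, p.1)).
    apply: Ex_mpres; first by measur.
    move=> F bF; rewrite (Ex_fub2 P P bF) Ex_fub//.
    by apply: (bm_comp bF); measur.
  rewrite -(mpres_Ex sw i3) (Ex_fub_itg (mpres_itg sw i3)).
    apply: eq_Ex => z /=; rewrite /chi -ExZ; last first.
      by apply: bm_itg; have [] := ball_valued_bv (ball_shrink_shift (t * tnth z j)) i.
    by apply: eq_Ex => x; rewrite mixE mulrC.
  move=> z; apply: (@eq_itg _ _ _ P (fun x => tnth z j * tnth (f (mix Cs Ss x z)) i)).
    by move=> x; rewrite mulrC.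
  by apply: itgZ; apply: bm_itg; apply: (bm_comp (bf i)); measur.
apply: eq_Ex => -[x z]; rewrite /H /= !tnth_mix /Cs /Ss eqxx.
set y := tnth (f _) _.
transitivity (y * ((s ^+ 2 + t ^+ 2) * tnth z j)); first by rewrite st mul1r.
by ring.
Qed.

Definition chiC : R := 8 * tayK (R := R) * (mom3 (R := R) + mom4 (R := R)).

(** The half-sum and the half-difference over the two signs are each within a cubic error of a
    Gaussian average that vanishes. *)
Lemma mean_shrink_shift i : Ex P (fun x => tnth (f x) i * tnth x j) = 0 -> tnth (mean P f) i = 0 ->
  `|tnth (mean P (shrink_shift t)) i| <= chiC * t ^+ 3 /\ `|tnth (mean P (shrink_shift (- t))) i| <= chiC * t ^+ 3.
Proof.
move=> m1 m0; rewrite !tnth_mktuple -!/(chi i _).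
have [c Hc] := chi_taylor i.
have := rademacher_even (bchi i) Hc t0.
have := rademacher_odd (bchi i) Hc t0.
rewrite Ex_chi1// Ex_chi m0 !subr0.
have -> : chiC * t ^+ 3 = 8 * tayK (R := R) * mom3 (R := R) * t ^+ 3 + 8 * tayK (R := R) * mom4 (R := R) * t ^+ 3.
  by rewrite /chiC; ring.
by rewrite !ler_norml => /andP[? ?] /andP[? ?]; split; apply/andP; split; lra.
Qed.

(** Weights of the symmetric form of the pair: [a^2 + b^2 = 1] and [a^2 - b^2 = rho]. *)
Let a : R := Num.sqrt ((1 + rho) / 2).
Let b : R := Num.sqrt ((1 - rho) / 2).
Let a2 : a ^+ 2 = (1 + rho) / 2.
Proof. by rewrite sqr_sqrtr//; have := rho0; lra. Qed.
Let b2 : b ^+ 2 = (1 - rho) / 2.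
Proof. by rewrite sqr_sqrtr//; have := rho1; lra. Qed.
Let a0 : 0 < a.
Proof. by rewrite sqrtr_gt0; have := rho0; lra. Qed.
Let b0 : 0 <= b. Proof. exact: sqrtr_ge0. Qed.
Let ah : 2^-1 <= a.
Proof.
rewrite -(@ler_pXn2r _ 2)// ?nnegrE ?invr_ge0//; last exact: ltW.
by rewrite a2 exprVn; have := rho0; rewrite -natrX /=; lra.
Qed.

Definition kap (tau : R) : R := stab P (cst_corr rho) (shrink_shift tau) (shrink_shift tau).

Let Xm (u w : X) : X := mix (fun=> a) (fun=> b) u w.
Let Ym (u w : X) : X := mix (fun=> a) (fun=> - b) u w.
(** The stability with the j-th coordinate of the common part u frozen at v. A shift of both points
    by [tau] moves v by [tau / (s * a)]. *)
Let Bk (v : R) : R := Ex P (fun u => Ex P (fun w =>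
  tdot (f (upd (Xm u w) j (s * (a * v + b * tnth w j))))
       (f (upd (Ym u w) j (s * (a * v - b * tnth w j)))))).

Let bm_ff d (T : measurableType d) (h1 h2 : T -> X) : measurable_fun setT h1 ->
  measurable_fun setT h2 -> bm (fun q => tdot (f (h1 q)) (f (h2 q))).
Proof. by move=> m1 m2; apply: bm_tdot; apply: (bv_comp bf). Qed.

Let kap_sym tau : kap tau = Ex P (fun u => Ex P (fun w => tdot (shrink_shift tau (Xm u w)) (shrink_shift tau (Ym u w)))).
Proof.
have bg := ball_valued_bv (ball_shrink_shift tau).
rewrite /kap /stab -(@corr_mean_symform _ _ P gP (fun=> a) (fun=> b) (cst_corr rho)); first last.
- exact: (bm_dot2 bg bg).
- by move=> i; rewrite a2 b2 /cst_corr; field.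
- by move=> i; rewrite a2 b2; field.
- by [].
- by move=> i; exact: ltW.
by apply: (@Ex_prod _ _ _ _ _ P P (fun u w => tdot (shrink_shift tau (Xm u w)) (shrink_shift tau (Ym u w)))); apply: bm_ff; rewrite /Xm /Ym; measur.
Qed.

Let bBk : bm Bk.
Proof.
apply: (@bm_Ex _ _ _ _ _ P (fun (v : Rm) u => Ex P (fun w =>
  tdot (f (upd (Xm u w) j (s * (a * v + b * tnth w j))))
       (f (upd (Ym u w) j (s * (a * v - b * tnth w j))))))).
apply: (@bm_Ex _ _ _ _ _ P (fun (q : Rm * X) w =>
  tdot (f (upd (Xm q.2 w) j (s * (a * q.1 + b * tnth w j))))
       (f (upd (Ym q.2 w) j (s * (a * q.1 - b * tnth w j)))))).
by apply: bm_ff; rewrite /Xm /Ym; measur.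
Qed.

Let kapE tau : kap tau = Ex gam (fun v => Bk (v + tau / (s * a))).
Proof.
rewrite kap_sym.
have bG : bm (fun u => Ex P (fun w => tdot (shrink_shift tau (Xm u w)) (shrink_shift tau (Ym u w)))).
  apply: (@bm_Ex _ _ _ _ _ P (fun u w => tdot (shrink_shift tau (Xm u w)) (shrink_shift tau (Ym u w)))).
  by apply: bm_ff; rewrite /Xm /Ym; measur.
rewrite -(Ex_resample j gP bG).
rewrite (@Ex_exch _ _ _ _ _ P gam (fun u v => Ex P (fun w => tdot (shrink_shift tau (Xm (upd u j v) w)) (shrink_shift tau (Ym (upd u j v) w))))); last first.
  by apply: (bm_comp bG); measur.
apply: eq_Ex => v; apply: eq_Ex => u; apply: eq_Ex => w; rewrite /shrink_shift.
congr (tdot (f _) (f _)); apply: eq_from_tnth => l; rewrite !tnth_upd !tnth_mix !tnth_upd eqxx;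
  case: eqP => // _; field; by rewrite !gt_eqF.
Qed.

(** The constant 64 is 8 for the division by s times 8 for the division by a, both being at least
    1/2. *)
Lemma kap_taylor : exists c : R * R * R, forall tau,
  `|kap tau - (c.1.1 + tau * c.1.2 + tau ^+ 2 * c.2)| <= (64 * tayK (R := R)) * `|tau| ^+ 3.
Proof.
have B1 v : `|Bk v| <= 1.
  apply: Ex_bound; last first.
    move=> u; apply: Ex_bound; last by move=> w; apply: ball_dot_abs; have [_] := ballf.
    apply: proj1 (_ : bm _); by apply: bm_ff; rewrite /Xm /Ym; measur.
  apply: proj1 (_ : bm _); apply: (@bm_Ex _ _ _ _ _ P (fun u w =>
  tdot (f (upd (Xm u w) j (s * (a * v + b * tnth w j))))
       (f (upd (Ym u w) j (s * (a * v - b * tnth w j)))))).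
  by apply: bm_ff; rewrite /Xm /Ym; measur.
have [c Hc] := Ex_taylor (proj1 bBk) B1.
exists (c.1.1, c.1.2 / (s * a), c.2 / (s * a) ^+ 2) => tau /=; rewrite kapE.
have := Hc (tau / (s * a)); rewrite mulr1 => h.
rewrite (_ : c.1.1 + _ + _ = c.1.1 + tau / (s * a) * c.1.2 + (tau / (s * a)) ^+ 2 * c.2); last first.
  by field; rewrite !gt_eqF.
apply: (le_trans h); rewrite [64 * _]mulrC -mulrA; apply: ler_wpM2l => //.
have := invs3 (tau / a).
have -> : tau / a / s = tau / (s * a) by field; rewrite !gt_eqF.
move=> /le_trans; apply.
have -> : 64 = 8 * 8 :> R by ring.
rewrite -mulrA; apply: ler_wpM2l => //.
rewrite normrM exprMn mulrC ler_wpM2r ?exprn_ge0//.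
rewrite normfV exprVn (gtr0_norm a0) -[8]invrK lef_pV2 ?posrE ?exprn_gt0 ?invr_gt0//.
have -> : 8^-1 = 2^-1 ^+ 3 :> R by rewrite exprVn; congr (_^-1); ring.
by apply: lerXn2r; rewrite ?nnegrE ?invr_ge0// ltW.
Qed.

Lemma bm_kap : bm (kap : Rm -> R).
Proof.
apply: (@eq_bm _ _ _ (fun z => Ex P (fun u => Ex P (fun w => tdot (shrink_shift z (Xm u w)) (shrink_shift z (Ym u w)))))).
  by move=> z; rewrite kap_sym.
apply: (@bm_Ex _ _ _ _ _ P (fun (z : Rm) u => Ex P (fun w => tdot (shrink_shift z (Xm u w)) (shrink_shift z (Ym u w))))).
apply: (@bm_Ex _ _ _ _ _ P (fun (q : Rm * X) w => tdot (shrink_shift q.1 (Xm q.2 w)) (shrink_shift q.1 (Ym q.2 w)))).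
by apply: bm_ff; rewrite /Xm /Ym; measur.
Qed.

(** A common Gaussian shift joins the common part of the symmetric form. In coordinate j the
    variance of that part becomes [s^2 a^2 + t^2], while the opposite part keeps [s^2 b^2]; the
    correlation is their difference [s^2 rho + t^2 = rho + t^2 (1 - rho)]. *)
Lemma Ex_kap : Ex gam (fun z => kap (t * z)) = stab P (cj (rho + t ^+ 2 * (1 - rho))) f f.
Proof.
pose a' i := if i == j then s * a else a.
pose b' i := if i == j then s * b else b.
pose t' i := if i == j then t else 0.
pose k' i := Num.sqrt (a' i ^+ 2 + t' i ^+ 2).
have k2 i : a' i ^+ 2 + t' i ^+ 2 = k' i ^+ 2 by rewrite sqr_sqrtr// addr_ge0// sqr_ge0.
have t2 : t ^+ 2 = 1 - s ^+ 2 by rewrite -st; ring.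
rewrite /stab -(@corr_mean_symform _ _ P gP k' b'); first last.
- exact: (bm_dot2 bf bf).
- move=> i; rewrite -k2 /a' /b' /t' /cj; case: eqP => _; last by rewrite a2 b2; field.
  by rewrite !exprMn a2 b2 t2; field.
- move=> i; rewrite -k2 /a' /b' /t'; case: eqP => _; last by rewrite a2 b2; field.
  by rewrite !exprMn a2 b2 t2; field.
- by move=> i; rewrite /b'; case: eqP => // _; rewrite mulr_ge0// ltW.
- by move=> i; exact: sqrtr_ge0.
pose G w y := tdot (f (mix (fun=> 1) b' y w)) (f (mix (fun=> 1) (fun i => - b' i) y w)).
have bG w : bm (G w) by rewrite /G; apply: bm_ff; measur.
have -> : Ex (P \x P)%E (fun p : X * X => tdot (f (mix k' b' p.1 p.2)) (f (mix k' (fun i => - b' i) p.1 p.2))) =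
   Ex P (fun w => Ex P (fun u => G w (scl k' u))).
  have bL : bm (fun p : X * X => tdot (f (mix k' b' p.1 p.2)) (f (mix k' (fun i => - b' i) p.1 p.2))).
    by apply: bm_ff; measur.
  rewrite (Ex_fub2 P P bL); apply: eq_Ex => w; apply: eq_Ex => u; rewrite /G.
  by congr (tdot (f _) (f _)); apply: eq_from_tnth => i; rewrite !tnth_mix tnth_scl mul1r.
have -> : Ex P (fun w => Ex P (fun u => G w (scl k' u))) =
   Ex P (fun w => Ex P (fun u => Ex P (fun z => G w (mix a' t' u z)))).
  by apply: eq_Ex => w; rewrite (Ex_mix_scl gP k2 (bG w)).
pose L (z u w : X) := tdot (shrink_shift (t * tnth z j) (Xm u w)) (shrink_shift (t * tnth z j) (Ym u w)).
have LG z u w : L z u w = G w (mix a' t' u z).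
  rewrite /L /G /shrink_shift; congr (tdot (f _) (f _)); apply: eq_from_tnth => i;
  rewrite tnth_upd !tnth_mix /a' /b' /t'; case: eqP => [->|_]; ring.
have b1' : bm (fun z : Rm => kap (t * z)) by apply: (bm_comp bm_kap); measur.
rewrite -(mpres_Ex (mpres_coord gP j) (bm_itg gam b1')).
transitivity (Ex P (fun z => Ex P (fun u => Ex P (fun w => L z u w)))).
  by apply: eq_Ex => z; rewrite kap_sym.
rewrite (@Ex_exch _ _ _ _ _ P P (fun z u => Ex P (fun w => L z u w))); last first.
  apply: (@bm_Ex _ _ _ _ _ P (fun (q : X * X) w => L q.1 q.2 w)).
  by apply: bm_ff; rewrite /Xm /Ym; measur.
transitivity (Ex P (fun u => Ex P (fun w => Ex P (fun z => L z u w)))).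
  apply: eq_Ex => u; rewrite (@Ex_exch _ _ _ _ _ P P (fun z w => L z u w))//.
  by apply: bm_ff; rewrite /Xm /Ym; measur.
rewrite (@Ex_exch _ _ _ _ _ P P (fun u w => Ex P (fun z => L z u w))); last first.
  apply: (@bm_Ex _ _ _ _ _ P (fun (q : X * X) z => L z q.1 q.2)).
  by apply: bm_ff; rewrite /Xm /Ym; measur.
by apply: eq_Ex => w; apply: eq_Ex => u; apply: eq_Ex => z; rewrite LG.
Qed.

End Step.
End Variation.

(** The decrements of a convex sequence do not increase, so each of the N decrements from N to 2N is
    at most the one just before N. *)
Lemma convex_seq (R : realType) (d : nat -> R) (N : nat) :
  (forall i, 2 * d i.+1 <= d i + d i.+2) -> (0 < N)%N ->
  d N - d (N + N)%N <= N%:R * (d N.-1 - d N).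
Proof.
move=> cvx N0; pose e i := d i - d i.+1.
have e_dec m : e m.+1 <= e m by rewrite /e; have := cvx m; lra.
have e_le m : e (N + m)%N <= e N.-1.
  elim: m => [|m IH]; first by rewrite addn0 -{1}(prednK N0).
  by rewrite addnS; exact: le_trans (e_dec _) IH.
have : forall m, d N - d (N + m)%N <= m%:R * e N.-1.
  elim=> [|m IH]; first by rewrite addn0 subrr mul0r.
  rewrite addnS -natr1 mulrDl mul1r.
  by have := e_le m; rewrite /e in IH *; lra.
by move=> /(_ N); rewrite /e (prednK N0).
Qed.

(** * Independence of an optimal map from a free coordinate *)

Section Independence.
Context {R : realType} {n k : nat}.
Variable P : probability (n.-tuple R) R.
Hypothesis gP : std_gaussian P.
Local Notation gam := (@gam R).
Local Notation Rm := (measurableTypeR R).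
Local Notation X := (n.-tuple R).
Local Notation Y := (k.-tuple R).
Variables (rho : R) (rho0 : 0 < rho) (rho1 : rho < 1) (j : 'I_n) (j0 : 'I_k).
Variable f : X -> Y.
Hypothesis af : adm P f.
Hypothesis fopt : forall g : X -> Y, adm P g -> stab P (cst_corr rho) g g <= stab P (cst_corr rho) f f.
Hypothesis fmom : forall i, Ex P (fun x => tnth (f x) i * tnth x j) = 0.

Let bf : bv f := adm_bv af.
Let D (r : R) : R := stab P (cj rho j r) f f.
Let c01 (i : 'I_n) : 0 <= cst_corr (n := n) rho i <= 1.
Proof. by rewrite /cst_corr !ltW. Qed.

Let D_rho : D rho = stab P (cst_corr rho) f f.
Proof. by congr (stab P _ f f); apply/funext => i; rewrite /cj /cst_corr; case: ifP. Qed.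

(* Rademacher and Gaussian variables have the same first three moments, so the average
   over the shifts t and -t agrees up to O(t^3) with the average over Gaussian shifts,
   which amounts to resampling the j-th coordinate. *)
Lemma second_variation : exists2 C : R, 0 <= C & forall t : R, 0 <= t <= 2^-1 ->
  D (rho + t ^+ 2 * (1 - rho)) <= D rho + C * t ^+ 3.
Proof.
have [bvf f0] := af.
have chiC0 : 0 <= chiC (R := R).
  have A3 : 0 <= mom3 (R := R).
    by rewrite /mom3 addr_ge0//; apply: Ex_ge0 => x; exact: exprn_ge0.
  have A4 : 0 <= mom4 (R := R).
    by rewrite /mom4 addr_ge0//; apply: Ex_ge0 => x; exact: exprn_ge0.
  have T0 : 0 <= tayK (R := R).
    by rewrite /tayK; have := @tayC_ge0 R; have := @Ex_abs_ge0 R; lra.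
  by rewrite /chiC !mulr_ge0// addr_ge0.
have KM : 0 <= 64 * tayK (R := R) * mom3 (R := R).
  have A3 : 0 <= mom3 (R := R).
    by rewrite /mom3 addr_ge0//; apply: Ex_ge0 => x; exact: exprn_ge0.
  have T0 : 0 <= tayK (R := R).
    by rewrite /tayK; have := @tayC_ge0 R; have := @Ex_abs_ge0 R; lra.
  by rewrite !mulr_ge0.
exists (64 * tayK (R := R) * mom3 (R := R) + (3 + k%:R) * (k%:R * chiC (R := R))).
  by rewrite addr_ge0// mulr_ge0// ?addr_ge0// mulr_ge0.
move=> t /andP[t0 t2].
pose s := Num.sqrt (1 - t ^+ 2).
have s20 : 4^-1 <= 1 - t ^+ 2 by nra.
have st : s ^+ 2 + t ^+ 2 = 1 by rewrite sqr_sqrtr; [ring|lra].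
have s2 : 2^-1 <= s.
  rewrite -(@ler_pXn2r _ 2)// ?nnegrE ?invr_ge0 ?sqrtr_ge0//.
  rewrite sqr_sqrtr; last by lra.
  by apply: le_trans s20; rewrite exprVn -natrX.
have [c Hc] := kap_taylor gP rho0 rho1 j bvf s2.
have := rademacher_even (bm_kap gP rho0 rho1 j bvf s) Hc t0.
rewrite (Ex_kap gP rho0 rho1 j bvf s2 st) -/(D _) ler_norml => /andP[h _].
have gle (tau : R) : (forall i, `|tnth (mean P (shrink_shift j f s tau)) i| <= chiC (R := R) * t ^+ 3) ->
  kap P rho j f s tau <= D rho + (3 + k%:R) * (k%:R * chiC (R := R)) * t ^+ 3.
  move=> hm; rewrite D_rho /kap.
  apply: (le_trans (opt_recenter gP c01 af fopt (ball_shrink_shift j bvf s tau))).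
  rewrite lerD2l -mulrA; apply: ler_wpM2l; first by rewrite addr_ge0.
  apply: (@le_trans _ _ (\sum_(i < k) chiC (R := R) * t ^+ 3)); first exact: ler_sum.
  by rewrite sumr_const card_ord -[leLHS]mulr_natl -[leRHS]mulrA.
have gp := gle t (fun i => proj1 (mean_shrink_shift gP bvf t0 s2 st (fmom i) (f0 i))).
have gm := gle (- t) (fun i => proj2 (mean_shrink_shift gP bvf t0 s2 st (fmom i) (f0 i))).
move: h gp gm; rewrite mulrDl.
set kp := kap _ _ _ _ _ t; set km := kap _ _ _ _ _ (- t); lra.
Qed.

(** With [sqrt rho] in the other coordinates, [D (p * q)] is the inner product of two noisy copies
    of f, and [2 <u, v> <= |u|^2 + |v|^2] applies. This is midpoint convexity in the logarithm of
    the correlation. *)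
Lemma D_mid (r s : R) : 0 <= r <= 1 -> 0 <= s <= 1 -> 2 * D (r * s) <= D (r ^+ 2) + D (s ^+ 2).
Proof.
move=> r01 s01.
pose cc (r : R) (i : 'I_n) := if i == j then r else Num.sqrt rho.
have cc01 (q : R) : 0 <= q <= 1 -> forall i, 0 <= cc q i <= 1.
  move=> q01 i; rewrite /cc; case: ifP => // _.
  by rewrite sqrtr_ge0 -sqrtr1 ler_wsqrtr// ltW.
have DD (p q : R) : 0 <= p <= 1 -> 0 <= q <= 1 ->
    D (p * q) = Ex P (fun x => tdot (noise_op P (cc p) f x) (noise_op P (cc q) f x)).
  move=> p01 q01; rewrite (noise_op_noise_op gP (cc01 _ p01) (cc01 _ q01) bf bf); congr (stab P _ f f).
  apply/funext => i; rewrite /cj /cc; case: ifP => // _.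
  by rewrite -expr2 sqr_sqrtr// ltW.
rewrite (expr2 r) (expr2 s) (DD r s r01 s01) (DD r r r01 r01) (DD s s s01 s01).
have bT q := bv_noise_op P (cc q) bf.
have bTT p q := bm_itg P (bm_tdot (bT p) (bT q)).
rewrite -(ExZ 2 (bTT r s)) -(ExD (bTT r r) (bTT s s)).
apply: Ex_le; [exact: (itgZ 2 (bTT r s))|exact: (itgD (bTT r r) (bTT s s))|].
by move=> x; exact: tdot_AMGM.
Qed.

(* By convexity of i |-> D(eta^(2 i)) with eta^(2 N) = rho, a drop from D(rho) to
   D(rho^2) gives an increase of order 1/N from D(rho) to D(rho^(1 - 1/N)).  This is
   an increase of order t^2, against the bound of order t^3. *)
Lemma D_collapse : D rho <= D (rho ^+ 2).
Proof.
have [C C0 HC] := second_variation.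
pose L := - ln rho; have L0 : 0 < L by rewrite oppr_gt0 ln_lt0// rho0.
pose Q := L / (1 - rho); have r1 : 0 < 1 - rho by rewrite subr_gt0.
have Q0 : 0 < Q by exact: divr_gt0.
rewrite leNgt; apply/negP => Dlt; pose del := D rho - D (rho ^+ 2).
have del0 : 0 < del by rewrite subr_gt0.
(* For such N, [del <= N C t^3] with [t^2 <= Q / N]; squaring bounds N. The condition [4 Q <= N]
   ensures [t <= 1/2]. *)
have key (N : nat) : (0 < N)%N -> 4 * Q <= N%:R -> del ^+ 2 * N%:R <= (C * Q) ^+ 2 * Q.
  move=> N0 NQ; have N0' : 0 < N%:R :> R by rewrite ltr0n.
  (* That is, [rho^(1 / (2 N))]. *)
  pose eta := expR (- L / (2 * N%:R)).
  have e0 : 0 < eta by exact: expR_gt0.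
  have e1 : eta <= 1 by rewrite expR_le1 mulNr oppr_le0 divr_ge0 ?mulr_ge0// ltW.
  have en01 m : 0 <= eta ^+ m <= 1.
    apply/andP; split; first by apply: exprn_ge0; exact: ltW.
    by apply: exprn_ile1 => //; exact: ltW.
  have e2N : eta ^+ (2 * N) = rho.
    rewrite /eta -expRM_natl natrM.
    rewrite (_ : 2 * N%:R * (- L / (2 * N%:R)) = ln rho); first by rewrite lnK// posrE.
    by rewrite /L; field; rewrite gt_eqF.
  pose d i := D (eta ^+ (2 * i)).
  have cvx i : 2 * d i.+1 <= d i + d i.+2.
    have e1n : (i + i.+2 = 2 * i.+1)%N by rewrite mul2n -addnn addnS addSn.
    have := D_mid (en01 i) (en01 i.+2).
    by rewrite -exprD -!exprM e1n (mulnC i 2) (mulnC i.+2 2).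
  have := convex_seq cvx N0; rewrite {1 2}/d mulnDr exprD e2N -expr2 -/del => hdel.
  have rp : d N.-1 = D (rho + (eta ^+ (2 * N.-1) - rho)) by rewrite /d addrCA subrr addr0.
  have e2 : eta ^+ 2 = expR (- (L / N%:R)).
    by rewrite /eta -expRM_natl; congr expR; field; rewrite gt_eqF.
  (* The step from [rho] to [rho^(1 - 1/N)] has length at most [L / N], because
     [1 - exp (- y) <= y]. *)
  have gap : eta ^+ (2 * N.-1) - rho <= L / N%:R.
    rewrite -e2N -{2}(prednK N0) mulnS exprD e2 -[X in X - _]mul1r -mulrBl.
    have E := expR_ge1Dx (- (L / N%:R)).
    have /andP[p0 p1] := en01 (2 * N.-1)%N.
    have LN : 0 <= L / N%:R by rewrite divr_ge0 ?ltW.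
    have E1 : 0 <= 1 - expR (- (L / N%:R)) by rewrite subr_ge0 expR_le1 oppr_le0.
    nra.
  have gap0 : 0 <= eta ^+ (2 * N.-1) - rho.
    rewrite subr_ge0 -e2N; apply: ler_wiXn2l => //; first exact: ltW.
    by rewrite leq_mul2l leq_pred.
  (* Chosen so that [rho + t^2 (1 - rho)] is exactly [eta^(2 (N - 1))]. *)
  pose t := Num.sqrt ((eta ^+ (2 * N.-1) - rho) / (1 - rho)).
  have t2E : t ^+ 2 = (eta ^+ (2 * N.-1) - rho) / (1 - rho).
    by rewrite sqr_sqrtr// divr_ge0// ltW.
  have t2 : t ^+ 2 <= Q / N%:R.
    rewrite t2E /Q mulrAC; apply: ler_wpM2r => //; by rewrite invr_ge0 ltW.
  have t0 : 0 <= t by exact: sqrtr_ge0.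
  have QN : Q / N%:R <= 4^-1 by rewrite ler_pdivrMr// mulrC ler_pdivlMr// mulrC.
  have t12 : t <= 2^-1.
    rewrite -(@ler_pXn2r _ 2)// ?nnegrE ?invr_ge0//.
    by apply: (le_trans t2); apply: (le_trans QN); rewrite exprVn -natrX.
  have := HC t; rewrite t0 t12 => /(_ isT).
  rewrite t2E divfK ?gt_eqF// -rp => h3.
  have h4 : del <= N%:R * (C * t ^+ 3).
    apply: (le_trans hdel); apply: ler_wpM2l; first exact: ltW.
    by rewrite /d e2N -/(d _); lra.
  have h5 : del <= C * Q * t.
    apply: (le_trans h4).
    rewrite (_ : N%:R * (C * t ^+ 3) = (C * t) * (N%:R * t ^+ 2)); last by ring.
    rewrite (_ : C * Q * t = (C * t) * Q); last by ring.
    by apply: ler_wpM2l; [exact: mulr_ge0|rewrite mulrC -ler_pdivlMr].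
  have h6 : del ^+ 2 <= (C * Q * t) ^+ 2.
    have cq0 : 0 <= C * Q * t by apply: mulr_ge0 => //; apply: mulr_ge0 => //; exact: ltW.
    by apply: lerXn2r; [rewrite nnegrE ltW|rewrite nnegrE|exact: h5].
  rewrite -ler_pdivlMr//; apply: (le_trans h6).
  rewrite -[leRHS]mulrA [leLHS]exprMn.
  by apply: ler_wpM2l; [exact: sqr_ge0|exact: t2].
(* Any N above B contradicts [key]. *)
pose B := (C * Q) ^+ 2 * Q / del ^+ 2 + 4 * Q.
have A0 : 0 <= (C * Q) ^+ 2 * Q / del ^+ 2.
  by apply: divr_ge0; [apply: mulr_ge0; [exact: sqr_ge0|exact: ltW]|exact: sqr_ge0].
have B0 : 0 <= B by rewrite /B; lra.
have [N NB] : exists N : nat, B < N%:R by exists (Num.bound B); exact: archi_boundP.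
have N0 : (0 < N)%N by rewrite -(ltr0n R); exact: le_lt_trans NB.
have := key N N0; have -> : 4 * Q <= N%:R by move: NB; rewrite /B; lra.
move=> /(_ isT).
have d2 : 0 < del ^+ 2 by exact: exprn_gt0.
rewrite mulrC -ler_pdivlMr//; move: NB; rewrite /B.
by move=> hN1 hN2; lra.
Qed.

(** Noise in coordinate j only. The square root makes an application to both arguments of the form
    multiply the j-th correlation by [rho]. *)
Let e (i : 'I_n) : R := if i == j then Num.sqrt rho else 1.
Let e01 i : 0 <= e i <= 1.
Proof.
rewrite /e; case: ifP => _; last by rewrite ler01 lexx.
by rewrite sqrtr_ge0 -sqrtr1 ler_wsqrtr// ltW.
Qed.

Let fbar : X -> Y := noise_op P e f.
Let bfbar : bv fbar. Proof. exact: bv_noise_op. Qed.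

Lemma J_fbar : stab P (cst_corr rho) fbar fbar = D (rho ^+ 2).
Proof.
rewrite stab_noise_op// (noise_op_noise_op gP e01 c01 bf bfbar).
have ec01 i : 0 <= e i * cst_corr (n := n) rho i <= 1.
  have /andP[? ?] := e01 i; have /andP[? ?] := c01 i.
  by rewrite mulr_ge0//= mulr_ile1.
rewrite (stab_sym gP ec01 bf bfbar) (stab_noise_op P _ bfbar bf) (noise_op_noise_op gP e01 ec01 bf bf); congr (stab P _ f f).
apply/funext => i; rewrite /cj /e /cst_corr; case: ifP => _; last by rewrite !mul1r.
by rewrite mulrA -expr2 sqr_sqrtr ?expr2// ltW.
Qed.

(** By [D_collapse] the averaged map is at least as stable as f, hence optimal itself, and
    [opt_unit] applies to it. *)
Lemma fbar_unit : {ae P, forall x, tdot (fbar x) (fbar x) = 1}.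
Proof.
apply: (opt_unit gP rho0 rho1 j j0); first exact: adm_noise_op.
move=> g ag; apply: (le_trans (fopt ag)); rewrite -/fbar J_fbar -D_rho.
exact: D_collapse.
Qed.

Let sg : R := Num.sqrt (1 - rho).
Let sg0 : 0 < sg. Proof. by rewrite sqrtr_gt0 subr_gt0. Qed.
Let mv (x : X) (a : R) : X := upd x j (Num.sqrt rho * tnth x j + sg * a).

Let mixE x z : mix e (co e) x z = mv x (tnth z j).
Proof.
apply: eq_from_tnth => l; rewrite tnth_mix tnth_upd /co /e; case: eqP => [->|_].
  by rewrite sqr_sqrtr// ltW.
by rewrite mul1r expr1n subrr sqrtr0 mul0r addr0.
Qed.

Let mmv : measurable_fun setT (fun p : X * Rm => mv p.1 p.2).
Proof. by rewrite /mv; measur. Qed.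

Lemma Ex_coord2 (G : X -> R -> R) : bm (fun p : X * Rm => G p.1 p.2) ->
  Ex (P \x P)%E (fun p => G p.1 (tnth p.2 j)) = Ex (P \x gam)%E (fun p => G p.1 p.2).
Proof.
move=> bG.
have bG2 : bm (fun p : X * X => G p.1 (tnth p.2 j)) by apply: (bm_comp2 bG); measur.
rewrite (@Ex_prod _ _ _ _ _ P P (fun x z => G x (tnth z j)) bG2) (Ex_prod P gam bG).
apply: eq_Ex => x.
have iG : itg gam (G x) by apply: bm_itg; exact: (bm_section1 x bG).
exact: (mpres_Ex (mpres_coord gP j) iG).
Qed.

Let mpres_mv : mpres (P \x gam)%E P (fun p => mv p.1 p.2).
Proof.
apply: Ex_mpres; first exact: mmv.
move=> F bF.
rewrite -(mpres_Ex (mpres_mix gP (fun i => co2 (e01 i))) (bm_itg P bF)).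
have bG : bm (fun p : X * Rm => F (mv p.1 p.2)) by exact: (bm_comp bF mmv).
rewrite -(@Ex_coord2 (fun x a => F (mv x a)) bG).
by apply: eq_Ex => p; rewrite mixE.
Qed.

Let tsub (u v : Y) : Y := tadd u (tscale (-1) v).
Let tsub0 u v : tdot (tsub u v) (tsub u v) = 0 -> u = v.
Proof.
move=> /tdot_eq0 H; apply: eq_from_tnth => i; have := H i.
by rewrite tnth_tadd tnth_tscale mulN1r => /subr0_eq.
Qed.

(* A ball-valued function with unimodular conditional mean equals that mean. *)
Let f_fbar : {ae (P \x gam)%E, forall p, f (mv p.1 p.2) = fbar p.1}.
Proof.
have b1 : bv (fun p : X * Rm => f (mv p.1 p.2)) by exact: (bv_comp bf mmv).
have b2 : bv (fun p : X * Rm => fbar p.1) by apply: (bv_comp bfbar); measur.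
have bG : bm (fun p : X * Rm => tdot (tsub (f (mv p.1 p.2)) (fbar p.1)) (tsub (f (mv p.1 p.2)) (fbar p.1))).
  by apply: bm_tdot; apply: bv_add => //; exact: bv_scale.
suff H : Ex (P \x gam)%E (fun p : X * Rm => tdot (tsub (f (mv p.1 p.2)) (fbar p.1)) (tsub (f (mv p.1 p.2)) (fbar p.1))) = 0.
  have := Ex_eq0_ae (bm_itg _ bG) (fun p => tdot_ge0 _) H.
  by apply: filterS => p; exact: tsub0.
apply/eqP; rewrite eq_le; apply/andP; split; last by apply: Ex_ge0 => p; exact: tdot_ge0.
have i11 := bm_itg (P \x gam)%E (bm_tdot b1 b1).
have i12 := bm_itg (P \x gam)%E (bm_tdot b2 b1).
have i22 := bm_itg (P \x gam)%E (bm_tdot b2 b2).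
rewrite (@eq_Ex _ _ _ (P \x gam)%E _ (fun p => tdot (f (mv p.1 p.2)) (f (mv p.1 p.2))
   - 2 * tdot (fbar p.1) (f (mv p.1 p.2)) + tdot (fbar p.1) (fbar p.1))); last first.
  by move=> p; rewrite /tsub !(tdotDl, tdotDr, tdotZl, tdotZr) (tdotC (f _) (fbar _)); ring.
rewrite ExD//; last by apply: itgB => //; exact: itgZ.
rewrite ExB//; last exact: itgZ.
rewrite ExZ//.
have E22 : Ex P (fun x => tdot (fbar x) (fbar x)) = 1.
  rewrite -(Ex_cst P 1); apply: Ex_ae fbar_unit; last exact: measurable_cst.
  by have [] := bm_tdot bfbar bfbar.
have -> : Ex (P \x gam)%E (fun p => tdot (fbar p.1) (fbar p.1)) = 1.
  by rewrite -E22; apply: (mpres_Ex (mpres_fst P gam) (bm_itg P (bm_tdot bfbar bfbar))).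
have -> : Ex (P \x gam)%E (fun p => tdot (fbar p.1) (f (mv p.1 p.2))) = 1.
  rewrite -(@Ex_coord2 (fun x a => tdot (fbar x) (f (mv x a)))); last exact: bm_tdot.
  rewrite -E22 -(stab_noise_op P e bfbar bf) /stab /corr_mean.
  by apply: eq_Ex => p; rewrite mixE.
have : Ex (P \x gam)%E (fun p => tdot (f (mv p.1 p.2)) (f (mv p.1 p.2))) <= 1.
  rewrite -[leRHS](Ex_cst (P \x gam)%E); apply: Ex_le => //; first exact: itg_cst.
  by move=> p; have [[_ f1] _] := af; exact: f1.
lra.
Qed.

(** The partial average with the contribution of x_j erased: coordinate j is drawn from N(0, sg^2)
    whatever x_j is. *)
Let h0 (x : X) : Y := [tuple Ex gam (fun a => tnth (f (upd x j (sg * a))) i) | i < k].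

Let bh0 : bv h0.
Proof.
move=> i; apply: (@eq_bm _ _ _ (fun x => Ex gam (fun a => tnth (f (upd x j (sg * a))) i))).
  by move=> x; rewrite tnth_mktuple.
apply: (@bm_Ex _ _ _ _ _ gam (fun x (a : Rm) => tnth (f (upd x j (sg * a))) i)).
by apply: (bm_comp (bf i)); measur.
Qed.

Let h0_upd x a : h0 (upd x j a) = h0 x.
Proof.
by apply: eq_from_tnth => i; rewrite !tnth_mktuple; apply: eq_Ex => b; rewrite upd_upd.
Qed.

(** For almost every x, f equals [fbar x] at almost every resampling a. Translating a, which
    preserves null sets, cancels the contribution [sqrt rho * x_j]. *)
Let fbar_h0 : {ae P, forall x, fbar x = h0 x}.
Proof.
apply: filterS (ae_fub f_fbar) => x /= Hx.
apply: eq_from_tnth => i; rewrite [in RHS]tnth_mktuple -[LHS](Ex_cst gam).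
apply: Ex_ae; first exact: measurable_cst.
  by have [] : bm (fun a : Rm => tnth (f (upd x j (sg * a))) i) by apply: (bm_comp (bf i)); measur.
have := gam_shift_null (- (Num.sqrt rho * tnth x j) / sg) Hx.
apply: (@filterS _ _ (ae_filter_ringOfSetsType gam)) => a /= <-; rewrite /mv; congr (tnth (f (upd x j _)) i).
by field; rewrite gt_eqF.
Qed.

(** The point [mv x a] has law P, so the claim may be tested there: f equals [fbar x], which is
    [h0 x], and [h0] does not see the change of coordinate j. *)
Let f_h0 : {ae P, forall x, f x = h0 x}.
Proof.
have bG : bm (fun x => tdot (tsub (f x) (h0 x)) (tsub (f x) (h0 x))).
  by apply: bm_tdot; apply: bv_add => //; exact: bv_scale.
suff H : Ex P (fun x => tdot (tsub (f x) (h0 x)) (tsub (f x) (h0 x))) = 0.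
  have := Ex_eq0_ae (bm_itg _ bG) (fun p => tdot_ge0 _) H.
  by apply: filterS => p; exact: tsub0.
rewrite -(mpres_Ex mpres_mv (bm_itg _ bG)) -(Ex_cst (P \x gam)%E 0).
apply: Ex_ae; [by have [] := bm_comp bG mmv|exact: measurable_cst|].
move: f_fbar (mpres_ae (mpres_fst P gam) fbar_h0).
apply: (@filterS2 _ _ (ae_filter_ringOfSetsType (P \x gam)%E)) => p H1 H2.
rewrite H1 H2 /mv h0_upd.
by rewrite !(tdotDl, tdotDr, tdotZl, tdotZr); ring.
Qed.

Lemma opt_indep : {ae (P \x P)%E, forall p, f p.1 = f (upd p.1 j (tnth p.2 j))}.
Proof.
pose C (i : 'I_n) : R := if i == j then 0 else 1.
pose S (i : 'I_n) : R := if i == j then 1 else 0.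
have CS i : C i ^+ 2 + S i ^+ 2 = 1.
  by rewrite /C /S; case: eqP => _; rewrite expr1n expr0n ?addr0 ?add0r.
move: (mpres_ae (mpres_fst P P) f_h0) (mpres_ae (mpres_mix gP CS) f_h0).
apply: (@filterS2 _ _ (ae_filter_ringOfSetsType (P \x P)%E)) => p -> .
have -> : mix C S p.1 p.2 = upd p.1 j (tnth p.2 j).
  apply: eq_from_tnth => l; rewrite tnth_mix tnth_upd /C /S.
  by case: eqP => [->|_]; rewrite !(mul0r, mul1r) ?add0r ?addr0.
by move=> ->; rewrite h0_upd.
Qed.

End Independence.

(** * Existence of optimal maps *)

Section L1Complete.
Context d (T : measurableType d) (R : realType).
Variable Q : probability T R.
Variable F : nat -> T -> R.
Hypothesis mF : forall r, measurable_fun setT (F r).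
Hypothesis F1 : forall r x, `|F r x| <= 1.
Hypothesis Fcauchy : forall r, Ex Q (fun x => `|F r.+1 x - F r x|) <= 2^-1 ^+ r.

Let bdelta r : bm (fun x => `|F r.+1 x - F r x|).
Proof.
split; first by apply: measurableT_comp => //; exact: measurable_funB.
exists 2 => x; rewrite normr_id; apply: (le_trans (ler_normB _ _)).
by have := F1 r x; have := F1 r.+1 x; lra.
Qed.

Let geo_le2 N : \sum_(0 <= r < N) (2^-1 ^+ r : R) <= 2.
Proof.
suff -> : \sum_(0 <= r < N) (2^-1 ^+ r : R) = 2 - 2 * 2^-1 ^+ N.
  by rewrite gerBl mulr_ge0// exprn_ge0.
elim: N => [|N IH]; first by rewrite big_nil expr0; ring.
by rewrite big_nat_recr//= IH exprS; field.
Qed.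

(** The increments are summable in mean, hence almost everywhere absolutely summable, and the
    sequence telescopes. *)
Lemma L1_fast_cvg : {ae Q, forall x, cvgn (fun r => F r x)}.
Proof.
pose u r x := (`|F r.+1 x - F r x|)%:E.
have mu r : measurable_fun setT (u r) by apply/measurable_EFinP; have [] := bdelta r.
have u0 r x : (0 <= u r x)%E by rewrite lee_fin.
have mS : measurable_fun setT (fun x => \sum_(r <oo) u r x)%E.
  by apply: ge0_emeasurable_sum => // r x _ _; exact: u0.
have iS : Q.-integrable setT (fun x => \sum_(r <oo) u r x)%E.
  apply/integrableP; split => //.
  have -> : (\int[Q]_x `|\sum_(r <oo) u r x| = \int[Q]_x \sum_(r <oo) u r x)%E.
    by apply: eq_integral => x _; rewrite gee0_abs//; apply: nneseries_ge0 => r _ _; exact: u0.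
  rewrite integral_nneseries//.
  apply: (@le_lt_trans _ _ 2%:E); last exact: ltry.
  apply: lime_le.
    by apply: is_cvg_nneseries => r _ _; apply: integral_ge0 => x _; exact: u0.
  apply: nearW => N.
  have -> : (\sum_(0 <= r < N) \int[Q]_x u r x = (\sum_(0 <= r < N) Ex Q (fun x => `|F r.+1 x - F r x|))%:E)%E.
    rewrite -sumEFin; apply: eq_bigr => r _.
    by rewrite -ExE//; apply: bm_itg; exact: bdelta.
  rewrite lee_fin; apply: (le_trans _ (geo_le2 N)); exact: ler_sum.
have := integrable_ae measurableT iS; apply: filterS => x /(_ I) fin.
have cs : cvgn (series (fun r => `|F r.+1 x - F r x|)).
  apply: nondecreasing_is_cvgn.
    by apply/nondecreasing_seqP => N; rewrite seriesEnat /= big_nat_recr//= lerDl.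
  exists (fine (\sum_(r <oo) u r x)%E) => _ [N _ <-].
  rewrite -lee_fin fineK//.
  apply: (le_trans _ (@nneseries_lim_ge _ (fun r => u r x) xpredT 0%N N _)) => //.
  by rewrite seriesEnat /= -sumEFin.
have cs' : cvgn (series (fun r => F r.+1 x - F r x)).
  by apply: normed_cvg; exact: cs.
have -> : (fun r => F r x) = (fun r => series (fun r => F r.+1 x - F r x) r + F 0%N x).
  apply/funext => N; rewrite seriesEnat /= telescope_sumr//.
  by rewrite subrK.
apply: is_cvgD => //; exact: is_cvg_cst.
Qed.

(** The upper limit serves as a measurable limit that is defined also at points without
    convergence. *)
Lemma measurable_limsup : measurable_fun setT (fun x => limn_sup (fun r => F r x)).
Proof.
apply: (@measurable_fun_limn_sup _ _ _ setT (fun r x => F r x)) => //.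
- move=> x _; exists 1 => _ [r _ <-]; by have := F1 r x; rewrite ler_norml => /andP[].
- move=> x _; exists (-1) => _ [r _ <-]; by have := F1 r x; rewrite ler_norml => /andP[].
Qed.

Lemma cvg_limsup : {ae Q, forall x, F r x @[r --> \oo] --> limn_sup (fun r => F r x)}.
Proof.
apply: filterS L1_fast_cvg => x cx.
by rewrite cvg_limn_supE.
Qed.

End L1Complete.

Lemma cvgn_sum (R : realType) (I : finType) (f : I -> nat -> R) (l : I -> R) :
  (forall i, f i r @[r --> \oo] --> l i) ->
  \sum_i f i r @[r --> \oo] --> \sum_i l i.
Proof.
move=> cf; suff H (s : seq I) : \sum_(i <- s) f i r @[r --> \oo] --> \sum_(i <- s) l i by exact: H.
elim: s => [|i s IH].
  by under eq_fun do rewrite big_nil; rewrite big_nil; exact: cvg_cst.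
under eq_fun do rewrite big_cons; rewrite big_cons; apply: cvgD => //.
Qed.

Lemma cvgn_tdot (R : realType) k (u_ v_ : nat -> k.-tuple R) (u v : k.-tuple R) :
  (forall i, tnth (u_ r) i @[r --> \oo] --> tnth u i) ->
  (forall i, tnth (v_ r) i @[r --> \oo] --> tnth v i) ->
  tdot (u_ r) (v_ r) @[r --> \oo] --> tdot u v.
Proof.
move=> cu cv; apply: (@cvgn_sum _ _ (fun i r => tnth (u_ r) i * tnth (v_ r) i)) => i.
by apply: cvgM.
Qed.

(** * A linear functional attains its maximum on the admissible maps *)

Section LinMax.
Context {R : realType} {n k : nat}.
Variable P : probability (n.-tuple R) R.
Local Notation X := (n.-tuple R).
Local Notation Y := (k.-tuple R).
Variables (u : X -> Y) (m : R).
Hypothesis bu : bv u.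
Let ell (h : X -> Y) : R := Ex P (fun x => tdot (h x) (u x)).
Let nrm (h : X -> Y) : R := Ex P (fun x => tdot (h x) (h x)).
Hypothesis approx : forall eps : R, 0 < eps -> exists2 h, adm P h & m - eps <= ell h.

Let C (eps : R) (h : X -> Y) : Prop := adm P h /\ m - eps <= ell h.
Let nrmset (eps : R) : set R := [set nrm h | h in C eps].

Let itg_nrm (h : X -> Y) : adm P h -> itg P (fun x => tdot (h x) (h x)).
Proof. by move=> ah; apply: bm_itg; apply: bm_tdot; exact: adm_bv ah. Qed.

Let nrm_ge0 (h : X -> Y) : 0 <= nrm h.
Proof. by apply: Ex_ge0 => x; exact: tdot_ge0. Qed.

Let nrm_le1 (h : X -> Y) : adm P h -> nrm h <= 1.
Proof.
move=> ah; rewrite -[leRHS](Ex_cst P); apply: Ex_le; [exact: itg_nrm|exact: itg_cst|].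
by move=> x; have [[_ h1] _] := ah; exact: h1.
Qed.

Let hasinf (eps : R) : 0 < eps -> has_inf (nrmset eps).
Proof.
move=> e0; split.
  by have [h ah hm] := approx e0; exists (nrm h); exists h.
by exists 0 => _ [h _ <-].
Qed.

(* Near-maximizers of nearly minimal norm form an L2-Cauchy sequence by the
   parallelogram identity. *)
Let Ie (eps : R) : R := inf (nrmset eps).
Let Iset : set R := [set Ie eps | eps in [set eps : R | 0 < eps]].

Let Ie_le1 (eps : R) : 0 < eps -> Ie eps <= 1.
Proof.
move=> e0; have [h ah hm] := approx e0.
apply: le_trans (nrm_le1 ah); apply: ge_inf; first by have [] := hasinf e0.
by exists h.
Qed.

Let hassup : has_sup Iset.
Proof.
split; first by exists (Ie 1); exists 1 => //=.
by exists 1 => _ [eps /= e0 <-]; exact: Ie_le1.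
Qed.

Let Iinf : R := sup Iset.

(** For each precision: a tolerance within which all near-maximizers have squared norm almost [Iinf]
    or more, and one of them with squared norm hardly larger. *)
Let key (delta : R) : 0 < delta -> exists p : R * (X -> Y),
  [/\ 0 < p.1 <= delta, forall h', C p.1 h' -> Iinf - delta <= nrm h',
      C p.1 p.2 & nrm p.2 <= Iinf + delta].
Proof.
move=> d0.
have [_ [e0 /= e0p <-] he0] := sup_adherent d0 hassup.
pose eps := Num.min e0 delta.
have ep : 0 < eps by rewrite lt_min e0p.
have lower h' : C eps h' -> Iinf - delta <= nrm h'.
  move=> [ah' lh']; apply: (le_trans (ltW he0)).
  apply: ge_inf; first by have [] := hasinf e0p.
  exists h' => //; split => //; apply: le_trans lh'.
  by rewrite lerD2l lerN2 ge_min lexx.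
have [_ [h Ch <-] hh] := inf_adherent d0 (hasinf ep).
exists (eps, h); split => //=; first by rewrite ep ge_min lexx orbT.
apply: (le_trans (ltW hh)); rewrite lerD2r.
by apply: ub_le_sup; [have [] := hassup|exists eps].
Qed.

(** The parallelogram identity turns errors [dl r] into a squared distance of at most
    [8 * dl r = 4^-r]. *)
Let dl (r : nat) : R := 4^-1 ^+ r / 8.
Let dl0 r : 0 < dl r. Proof. by rewrite divr_gt0// exprn_gt0. Qed.
Let dlS r : dl r.+1 <= dl r.
Proof.
rewrite /dl exprS; apply: ler_wpM2r => //; rewrite ler_piMl ?exprn_ge0//.
by rewrite invf_le1// ler1n.
Qed.

Lemma linear_max : exists2 f : X -> Y, adm P f & m <= ell f.
Proof.
have [p Hp] := choice (fun r => key (dl0 r)).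
pose h r := (p r).2.
have ah r : adm P (h r) by have [_ _ []] := Hp r.
have bh r := adm_bv (ah r).
have h1 r x : in_ball (h r x) by have [[_]] := ah r.
have dist r : Ex P (fun x => tdot (tadd (h r.+1 x) (tscale (-1) (h r x))) (tadd (h r.+1 x) (tscale (-1) (h r x)))) <= 4^-1 ^+ r.
  pose md x := tadd (tscale 2^-1 (h r.+1 x)) (tscale 2^-1 (h r x)).
  have amd : adm P md by apply: adm_convex => //; field.
  have lmd : ell md = (ell (h r.+1) + ell (h r)) / 2.
    have i1 := bm_itg P (bm_tdot (bh r.+1) bu); have i2 := bm_itg P (bm_tdot (bh r) bu).
    rewrite /ell -ExD// mulrC -ExZ; last exact: itgD.
    by apply: eq_Ex => x; rewrite tdotDl !tdotZl mulrDr.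
  have nmd : Iinf - dl r <= nrm md.
    have [/andP[e0 e1] low [_ l0] _] := Hp r.
    have [/andP[f0 f1] low' [_ l1] _] := Hp r.+1.
    (* The midpoint is a near-maximizer for the larger of the two tolerances. *)
    have [le|lt] := leP (p r.+1).1 (p r).1.
      by apply: low; split => //; rewrite lmd; move: l0 l1; rewrite -/(h _); lra.
    apply: (@le_trans _ _ (Iinf - dl r.+1)); first by rewrite lerD2l lerN2.
    by apply: low'; split => //; rewrite lmd; move: l0 l1; rewrite -/(h _); lra.
  have -> : Ex P (fun x => tdot (tadd (h r.+1 x) (tscale (-1) (h r x))) (tadd (h r.+1 x) (tscale (-1) (h r x)))) =
    2 * nrm (h r.+1) + 2 * nrm (h r) - 4 * nrm md.
    have i1 := itg_nrm (ah r.+1); have i2 := itg_nrm (ah r); have i3 := itg_nrm amd.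
    rewrite /nrm -!ExZ// -ExD; [|exact: itgZ|exact: itgZ].
    rewrite -ExB; [|by apply: itgD; exact: itgZ|exact: itgZ].
    apply: eq_Ex => x; rewrite /md !(tdotDl, tdotDr, tdotZl, tdotZr) (tdotC (h r x) (h r.+1 x)).
    by field.
  have [_ _ _ n0] := Hp r; have [_ _ _ n1] := Hp r.+1.
  have := dlS r; move: n0 n1; rewrite -!/(h _) /dl; set q := 4^-1 ^+ r; set q' := 4^-1 ^+ r.+1 => n0 n1 qq.
  by move: nmd; rewrite /dl -/q; lra.
have bhi r i : bm (fun x => tnth (h r x) i) := bh r i.
have mhi i r : measurable_fun setT (fun x => tnth (h r x) i) by have [] := bhi r i.
have hi1 i r x : `|tnth (h r x) i| <= 1 by exact: ball_coord.
have L1 i r : Ex P (fun x => `|tnth (h r.+1 x) i - tnth (h r x) i|) <= 2^-1 ^+ r.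
  have bd : bm (fun x => tnth (h r.+1 x) i - tnth (h r x) i) by exact: bmB.
  have bdd : bv (fun x => tadd (h r.+1 x) (tscale (-1) (h r x))).
    by apply: bv_add => //; exact: bv_scale.
  have i2 := bm_itg P (bm_tdot bdd bdd).
  (* [|y| <= (2^-r + 2^r * y^2) / 2], weighted so that the squared distance [4^-r] yields [2^-r]. *)
  apply: (@le_trans _ _ (Ex P (fun x => 2^-1 * 2^-1 ^+ r + (2^-1 * 2 ^+ r) * tdot (tadd (h r.+1 x) (tscale (-1) (h r x))) (tadd (h r.+1 x) (tscale (-1) (h r x)))))).
    apply: Ex_le; [exact/itg_norm/bm_itg|by apply: itgD; [exact: itg_cst|exact: itgZ]|].
    move=> x; set y := _ - _.
    have yt : y ^+ 2 <= tdot (tadd (h r.+1 x) (tscale (-1) (h r x))) (tadd (h r.+1 x) (tscale (-1) (h r x))).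
      rewrite /tdot (bigD1 i)//= tnth_tadd tnth_tscale mulN1r -/y -expr2 lerDl.
      by apply: sumr_ge0 => l _; rewrite -expr2 sqr_ge0.
    have p2 : 0 < 2 ^+ r :> R by exact: exprn_gt0.
    have am : `|y| <= 2^-1 * 2^-1 ^+ r + (2^-1 * 2 ^+ r) * y ^+ 2.
      have yy : y ^+ 2 = `|y| ^+ 2 by rewrite -normrX ger0_norm ?sqr_ge0.
      have := sqr_ge0 (2^-1 ^+ r - `|y|); rewrite yy exprVn.
      move=> h0; rewrite -(ler_pM2l p2).
      have -> : 2 ^+ r * (2^-1 * (2 ^+ r)^-1 + 2^-1 * 2 ^+ r * `|y| ^+ 2) = 2^-1 * (1 + (2 ^+ r * `|y|) ^+ 2) :> R.
        by field; rewrite gt_eqF.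
      by have := sqr_ge0 (2 ^+ r * `|y| - 1); lra.
    apply: (le_trans am); rewrite lerD2l; apply: ler_wpM2l; last exact: yt.
    by apply: mulr_ge0 => //; exact: ltW.
  rewrite ExD; [|exact: itg_cst|exact: itgZ]; rewrite Ex_cst ExZ//.
  have p2 : 0 < 2 ^+ r :> R by exact: exprn_gt0.
  apply: (@le_trans _ _ (2^-1 * 2^-1 ^+ r + 2^-1 * 2 ^+ r * 4^-1 ^+ r)).
    rewrite lerD2l; apply: ler_wpM2l; last exact: dist.
    by apply: mulr_ge0 => //; exact: ltW.
  have -> : 4^-1 ^+ r = (2 ^+ r)^-1 * (2 ^+ r)^-1 :> R.
    rewrite -invfM -exprMn exprVn; congr (_ ^+ r)^-1; ring.
  rewrite exprVn le_eqVlt; apply/orP; left; apply/eqP; field.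
  by rewrite gt_eqF.
pose G x : Y := [tuple limn_sup (fun r => tnth (h r x) i) | i < k].
have cvG : {ae P, forall x, forall i, tnth (h r x) i @[r --> \oo] --> tnth (G x) i}.
  apply: filter_forall => i.
  apply: filterS (cvg_limsup (mhi i) (hi1 i) (L1 i)) => x.
  by rewrite tnth_mktuple.
have mG i : measurable_fun setT (fun x => tnth (G x) i).
  have := measurable_limsup (mhi i) (hi1 i).
  by congr (measurable_fun _ _); apply/funext => x; rewrite tnth_mktuple.
have mGG : measurable_fun setT (fun x => tdot (G x) (G x)).
  by apply: measurable_sum => i; apply: measurable_funM.
pose B := [set x | tdot (G x) (G x) <= 1].
have mB : measurable B.
  rewrite (_ : B = (fun x => tdot (G x) (G x)) @^-1` (`]-oo, 1]%classic)).
    by rewrite -[X in measurable X]setTI; apply: mGG => //; exact: measurable_itv.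
  by apply/seteqP; split => x /=; rewrite in_itv.
(* The limit is set to 0 where it leaves the ball, a null set, so that f is ball-valued
   everywhere. *)
pose f x : Y := tscale (\1_B x) (G x).
have fB x : in_ball (f x).
  rewrite /in_ball tdotZl tdotZr indicE; case: (boolP (x \in B)) => [|_]; last by rewrite !mul0r.
  by rewrite inE /B /= !mul1r.
have mf : measurable_fun setT f.
  apply/measurable_fun_tnthP => i.
  rewrite (_ : _ \o _ = fun x => \1_B x * tnth (G x) i); last first.
    by apply/funext => x /=; rewrite tnth_tscale.
  by apply: measurable_funM => //; exact: measurable_indic.
have bf : bv f by exact: ball_valued_bv.
have cvf : {ae P, forall x, forall i, tnth (h r x) i @[r --> \oo] --> tnth (f x) i}.
  apply: filterS cvG => x cx i.
  suff xB : B x by rewrite /f tnth_tscale indicE mem_set// mul1r; exact: cx.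
  have : tdot (h r x) (h r x) @[r --> \oo] --> tdot (G x) (G x).
    exact: cvgn_tdot.
  move=> ct; rewrite /B /= -(cvg_lim (@Rhausdorff R) ct).
  by apply: limr_le; [apply/cvg_ex; eexists; exact: ct|apply: nearW => r; exact: h1].
exists f.
  split; first by split.
  move=> i; rewrite tnth_mktuple.
  have ct : Ex P (fun x => tnth (h r x) i) @[r --> \oo] --> Ex P (fun x => tnth (f x) i).
    apply: (@Ex_dct _ _ _ P (fun r x => tnth (h r x) i) _ 1) => //.
      exact: measurable_tnth_comp.
    by apply: filterS cvf => x; apply.
  apply/esym; rewrite -(cvg_lim (@Rhausdorff R) ct).
  apply/esym/cvg_lim => //; apply: cvg_near_cst; apply: nearW => r.
  by have [_ /(_ i)] := ah r; rewrite tnth_mktuple.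
have bhu r := bm_tdot (bh r) bu.
have [D HD] : exists D, forall x i, `|tnth (u x) i| <= D.
  have [D HD] := choice (fun i => (bu i).2).
  exists (\sum_i `|D i|) => x i; apply: (le_trans (HD i x)).
  by apply: (le_trans (ler_norm _)); rewrite (bigD1 i)//= lerDl sumr_ge0.
have ct : ell (h r) @[r --> \oo] --> ell f.
  apply: (@Ex_dct _ _ _ P (fun r x => tdot (h r x) (u x)) _ (k%:R * D)).
  - by move=> r; have [] := bhu r.
  - by have [] := bm_tdot bf bu.
  - move=> r x; apply: (le_trans (ler_norm_sum _ _ _)).
    rewrite mulr_natl -[k in _ *+ k]card_ord -sumr_const; apply: ler_sum => i _.
    by rewrite normrM -[leRHS]mul1r; apply: ler_pM.
  - apply: filterS cvf => x cx; apply: (@cvgn_tdot _ _ (h ^~ x) (fun=> u x)) => // i.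
    exact: cvg_cst.
have cd : (m - dl r) @[r --> \oo] --> m.
  rewrite -[X in _ --> X]subr0; apply: cvgB; first exact: cvg_cst.
  rewrite -(mul0r 8^-1); apply: cvgM; last exact: cvg_cst.
  by apply: cvg_expr; rewrite ger0_norm// invf_lt1// ltr1n.
rewrite -(cvg_lim (@Rhausdorff R) cd) -(cvg_lim (@Rhausdorff R) ct).
apply: ler_lim; [apply/cvg_ex; eexists; exact: cd|apply/cvg_ex; eexists; exact: ct|].
apply: nearW => r; have [/andP[e0 e1] _ [_ l0] _] := Hp r.
by rewrite -/(h r) in l0; lra.
Qed.

End LinMax.

(** * Lipschitz bound for the noise operator *)

Section Lipschitz.
Context {R : realType} {n : nat}.
Variable P : probability (n.-tuple R) R.
Hypothesis gP : std_gaussian P.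
Local Notation gam := (@gam R).
Local Notation Rm := (measurableTypeR R).
Local Notation X := (n.-tuple R).
Variables (rho : R) (rho0 : 0 <= rho) (rho1 : rho < 1).
Let c : 'I_n -> R := cst_corr rho.
Let sg : R := Num.sqrt (1 - rho ^+ 2).
Let sg0 : 0 < sg. Proof. by rewrite sqrtr_gt0 subr_gt0 expr_lt1. Qed.

Variable F : X -> R.
Hypothesis mF : measurable_fun setT F.
Hypothesis F1 : forall x, `|F x| <= 1.
Let bF : bm F. Proof. by split => //; exists 1. Qed.
Let Phi (x : X) : R := Ex P (fun z => F (mix c (co c) x z)).

Definition lipK : R := (tayC (R := R) + 2) / sg.

Lemma lipK_ge0 : 0 <= lipK.
Proof. by apply: divr_ge0; [rewrite addr_ge0 ?tayC_ge0|exact: ltW]. Qed.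

(** Moving [x_l] by [a - b] amounts to shifting the noise coordinate [z_l] by [rho * (a - b) / sg],
    which [Ex_shift_lip] controls. *)
Let lip1 x l (a b : R) : `|Phi (upd x l a) - Phi (upd x l b)| <= lipK * `|a - b|.
Proof.
pose B z v := F (upd (mix c (co c) x z) l (sg * v + rho * b)).
pose t := rho * (a - b) / sg.
have PE (e : R) : Phi (upd x l e) = Ex P (fun z => Ex gam (fun v => F (upd (mix c (co c) x z) l (sg * v + rho * e)))).
  have b1 : bm (fun z => F (mix c (co c) (upd x l e) z)) by apply: (bm_comp bF); measur.
  rewrite /Phi -(Ex_resample l gP b1); apply: eq_Ex => z; apply: eq_Ex => v; congr (F _).
  apply: eq_from_tnth => i; rewrite tnth_upd !tnth_mix !tnth_upd; case: eqP => // _.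
  by rewrite addrC /co.
have bP (e : R) : bm (fun z => Ex gam (fun v => F (upd (mix c (co c) x z) l (sg * v + rho * e)))).
  apply: (@bm_Ex _ _ _ _ _ gam (fun z (v : Rm) => F (upd (mix c (co c) x z) l (sg * v + rho * e)))).
  by apply: (bm_comp bF); measur.
rewrite !PE -ExB; [|exact: bm_itg|exact: bm_itg].
apply: Ex_bound; first by have [] := bmB (bP a) (bP b).
move=> z.
have -> : Ex gam (fun v => F (upd (mix c (co c) x z) l (sg * v + rho * a))) = Ex gam (fun v => B z (v + t)).
  apply: eq_Ex => v; congr (F (upd _ _ _)); rewrite /t; field.
  by rewrite gt_eqF.
have mB : measurable_fun [set: R] (B z) by rewrite /B; apply: (measurableT_comp mF); measur.
apply: (le_trans (Ex_shift_lip t mB (fun v => F1 _))).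
rewrite /lipK -mulrA; apply: ler_wpM2l; first by rewrite addr_ge0 ?tayC_ge0.
rewrite /t !normrM normfV (gtr0_norm sg0) [leRHS]mulrC; apply: ler_wpM2r.
  by rewrite invr_ge0 ltW.
by rewrite ler_piMl// ger0_norm// ltW.
Qed.

Lemma noise_op_lip x y : `|Phi x - Phi y| <= lipK * \sum_l `|tnth x l - tnth y l|.
Proof.
(* Coordinates are changed from x to y one at a time. *)
pose hyb m : X := [tuple if (l < m)%N then tnth y l else tnth x l | l < n].
pose s (m : nat) : R := \sum_(l < n | (l < m)%N) `|tnth x l - tnth y l|.
have H m : (m <= n)%N -> `|Phi x - Phi (hyb m)| <= lipK * s m.
  elim: m => [_|m IH mn].
    rewrite (_ : hyb 0%N = x); last by apply: eq_from_tnth => l; rewrite tnth_mktuple.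
    by rewrite subrr normr0 mulr_ge0 ?lipK_ge0// sumr_ge0.
  pose i := Ordinal mn.
  have E (l : 'I_n) : (l < m.+1)%N = (l == i) || (l < m)%N by rewrite ltnS leq_eqVlt -val_eqE.
  have h1 : hyb m.+1 = upd (hyb m) i (tnth y i).
    apply: eq_from_tnth => l; rewrite tnth_upd !tnth_mktuple E.
    by case: eqP => [->|].
  have h2 : hyb m = upd (hyb m) i (tnth x i).
    apply: eq_from_tnth => l; rewrite tnth_upd !tnth_mktuple.
    by case: eqP => [->|//]; rewrite ltnn.
  have -> : s m.+1 = s m + `|tnth x i - tnth y i|.
    rewrite /s (bigD1 i) /=; last by rewrite ltnSn.
    rewrite addrC; congr (_ + _); apply: eq_bigl => l; rewrite E.
    by case: eqP => [->|] //=; rewrite ?ltnn ?andbT ?andbF.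
  rewrite mulrDr; apply: (le_trans (ler_distD (Phi (hyb m)) _ _)); apply: lerD.
    exact: IH (ltnW mn).
  by rewrite h1 {1}h2; exact: lip1.
have := H n (leqnn n).
rewrite (_ : hyb n = y); last by apply: eq_from_tnth => l; rewrite tnth_mktuple ltn_ord.
by rewrite /s; under eq_bigl do rewrite ltn_ord.
Qed.

End Lipschitz.

Section Tychonoff.
Import ArrowAsProduct.

(** u is a cluster point in a product of copies of [-1, 1]. It is defined on all of I at once and
    approximated infinitely often on each finite set of indices, which replaces a diagonal
    extraction. *)
Lemma tychonoff_cluster (R : realType) (I : eqType) (g : nat -> I -> R) :
  (forall N p, `|g N p| <= 1) ->
  exists2 u : I -> R, forall p, `|u p| <= 1 &
  forall (J : finType) (ps : J -> I) (eps : R) (N0 : nat), 0 < eps ->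
    exists2 N, (N0 <= N)%N & forall r, `|g N (ps r) - u (ps r)| < eps.
Proof.
move=> g1.
pose T := fun _ : I => (R : topologicalType).
pose A : forall i, set (T i) := fun=> `[-1, 1]%classic.
have cA : compact [set f : forall i, T i | forall i, A i (f i)].
  by apply: tychonoff => i; exact: segment_compact.
pose G : nat -> (forall i, T i) := g.
have [|u [Au cu]] := cA (G @ \oo) _.
  exists 0%N => // N _ i; rewrite /A /= in_itv /=.
  by have := g1 N i; rewrite ler_norml.
exists u.
  by move=> p; have := Au p; rewrite /A /= in_itv /= ler_norml.
move=> J ps eps N0 e0.
have FA : (G @ \oo) [set G N | N in [set N | (N0 <= N)%N]].
  by exists N0 => // N /= N0N; exists N.
have FB : nbhs u [set v : forall i, T i | forall r, `|v (ps r) - u (ps r)| < eps].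
  suff H0 : forall r, nbhs u [set v : forall i, T i | `|v (ps r) - u (ps r)| < eps].
    exact: filter_forall H0.
  move=> r.
  have NB (a : R) : nbhs a [set y : R | `|y - a| < eps].
    by apply/nbhs_ballP; exists eps => //= y; rewrite -ball_normE /= distrC.
  exact: (@proj_continuous I T (ps r) u _ (NB (u (ps r)))).
by have [_ [[N N0N <-] H]] := cu _ _ FA FB; exists N.
Qed.

End Tychonoff.

(** * Limits of maximizing sequences *)

Section Existence.
Context {R : realType} {n k : nat}.
Variable P : probability (n.-tuple R) R.
Hypothesis gP : std_gaussian P.
Local Notation X := (n.-tuple R).
Local Notation Y := (k.-tuple R).
Variables (rho : R) (rho0 : 0 <= rho) (rho1 : rho < 1).
Let c : 'I_n -> R := cst_corr rho.
Let c01 i : 0 <= c i <= 1. Proof. by rewrite /c /cst_corr rho0 ltW. Qed.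

Let L : R := lipK rho.
Let L0 : 0 <= L. Proof. exact: lipK_ge0. Qed.

Lemma noise_op_lip_coord (f : X -> Y) i x y : adm P f ->
  `|tnth (noise_op P c f x) i - tnth (noise_op P c f y) i| <= L * \sum_l `|tnth x l - tnth y l|.
Proof.
move=> [[mf f1] _]; rewrite !tnth_mktuple.
apply: (noise_op_lip gP rho0 rho1 (F := fun x => tnth (f x) i)).
  exact: measurable_tnth_comp.
by move=> z; exact: ball_coord.
Qed.

Lemma noise_op_bound (f : X -> Y) i x : adm P f -> `|tnth (noise_op P c f x) i| <= 1.
Proof. by move=> /(adm_noise_op gP c01) [[_ T1] _]; exact: ball_coord. Qed.

(** The rational points listed by their codes; a number that codes no tuple stands for the
    origin. *)
Let pt (r : nat) : X := if unpickle r is Some q then [tuple ratr (tnth (q : n.-tuple rat) l) : R | l < n]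
                        else [tuple 0 | l < n].

Let pt_dense (x : X) (eps : R) : 0 < eps -> exists r, \sum_l `|tnth x l - tnth (pt r) l| <= eps.
Proof.
move=> e0.
pose d : R := eps / n.+1%:R.
have d0 : 0 < d by rewrite divr_gt0.
have pk (l : 'I_n) : exists q : rat, `|tnth x l - ratr q| <= d.
  have [|q] := @rat_in_itvoo R (tnth x l) (tnth x l + d); first by rewrite ltrDl.
  rewrite in_itv /= => /andP[q1 q2]; exists q.
  by rewrite ler_norml; apply/andP; split; lra.
have [q Hq] := choice pk.
exists (pickle [tuple q l | l < n]); rewrite /pt pickleK.
apply: (@le_trans _ _ (\sum_(l < n) d)).
  by apply: ler_sum => l _; rewrite !tnth_mktuple.
rewrite sumr_const card_ord -mulr_natl /d mulrCA ler_piMr//; first exact: ltW.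
by rewrite ler_pdivrMr// mul1r ler_nat.
Qed.

(** The index [jN N] is chosen so that the cluster point is approximated within 1/(N+1) on the first
    N rational points; the common Lipschitz constant spreads convergence to all points. [N <= jN N]
    is enough, so [jN] need not be increasing. *)
Lemma noise_op_subseq (f_ : nat -> X -> Y) : (forall N, adm P (f_ N)) ->
  exists2 jN : nat -> nat, forall N, (N <= jN N)%N &
  exists2 u : X -> Y, bv u & forall x i, tnth (noise_op P c (f_ (jN N)) x) i @[N --> \oo] --> tnth (u x) i.
Proof.
move=> af.
pose g N (p : X * 'I_k) := tnth (noise_op P c (f_ N) p.1) p.2.
have g1 N p : `|g N p| <= 1 by exact: noise_op_bound.
have [u u1 Hu] := tychonoff_cluster g1.
(* The cluster point inherits the Lipschitz bound because two indices can be approximated by the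
   same term. *)
have ulip x y i : `|u (x, i) - u (y, i)| <= L * \sum_l `|tnth x l - tnth y l|.
  apply/ler_addgt0Pr => e e0.
  have e2 : 0 < e / 2 by rewrite divr_gt0.
  have [N _ HN] := Hu _ (fun b : bool => if b then (x, i) else (y, i)) _ 0%N e2.
  have := HN true; have := HN false; rewrite /=.
  have := noise_op_lip_coord i x y (af N); rewrite -/(g N (x, i)) -/(g N (y, i)).
  rewrite !ltr_norml !ler_norml => /andP[? ?] /andP[? ?] /andP[? ?].
  by apply/andP; split; lra.
have pick N : exists j, (N <= j)%N /\ forall (r : 'I_N) i, `|g j (pt r, i) - u (pt r, i)| < N.+1%:R^-1.
  have [|j Nj Hj] := Hu ('I_N * 'I_k)%type (fun q => (pt q.1, q.2)) N.+1%:R^-1 N.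
    by rewrite invr_gt0.
  by exists j; split => // r i; exact: (Hj (r, i)).
have [jN HjN] := choice pick.
exists jN; first by move=> N; have [] := HjN N.
have cv x i : g (jN N) (x, i) @[N --> \oo] --> u (x, i).
  apply/cvgrPdist_le => e e0.
  have L1 : 0 < L + 1 by rewrite ltr_wpDl.
  have e4 : 0 < e / (3 * (L + 1)) by apply: divr_gt0 => //; exact: mulr_gt0.
  have [r Hr] := pt_dense x e4.
  have Hr' : L * \sum_l `|tnth x l - tnth (pt r) l| <= e / 3.
    apply: (le_trans (ler_wpM2l L0 Hr)).
    have -> : e / (3 * (L + 1)) = e / 3 / (L + 1) by field; rewrite gt_eqF.
    have e3 : 0 < e / 3 by rewrite divr_gt0.
    rewrite mulrCA ler_piMr//; first exact: ltW.
    by rewrite ler_pdivrMr// mul1r lerDl.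
  near=> N.
  have rN : (r < N)%N by near: N; exact: nbhs_infty_gt.
  have [_ /(_ (Ordinal rN) i) /= h1] := HjN N.
  have h2 : N.+1%:R^-1 <= e / 3.
    near: N; have [M HM] : exists M : nat, 3 / e < M%:R.
      by exists (Num.bound (3 / e)); apply: archi_boundP; rewrite divr_ge0// ltW.
    exists M => // N /= MN.
    rewrite -[leRHS]invrK lef_pV2 ?posrE ?invr_gt0 ?divr_gt0// invf_div.
    by apply: (le_trans (ltW HM)); rewrite ler_nat; exact: leqW.
  have h3 := ulip x (pt r) i.
  have h4 := noise_op_lip_coord i x (pt r) (af (jN N)).
  rewrite -/(g _ (x, i)) -/(g _ (pt r, i)) in h4.
  apply: (le_trans (ler_distD (u (pt r, i)) _ _)).
  rewrite -[e](_ : e / 3 + (e / 3 + e / 3) = e); last by field.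
  apply: lerD; first exact: le_trans h3 Hr'.
  apply: (le_trans (ler_distD (g (jN N) (pt r, i)) _ _)); apply: lerD.
    by rewrite distrC; exact: le_trans (ltW h1) h2.
  by rewrite distrC; exact: le_trans h4 Hr'.
exists (fun x => [tuple u (x, i) | i < k]); last by move=> x i; rewrite tnth_mktuple; exact: cv.
move=> i; apply: (@eq_bm _ _ _ (fun x => u (x, i))); first by move=> x; rewrite tnth_mktuple.
split; last by exists 1 => x.
apply: (@measurable_fun_cvg _ _ _ setT (fun N x => g (jN N) (x, i))) => //.
by move=> N; have [] := bv_noise_op P c (adm_bv (af (jN N))) i.
Unshelve. all: by end_near. Qed.

Lemma exists_opt : exists2 f : X -> Y, adm P f &
  forall g : X -> Y, adm P g -> stab P c g g <= stab P c f f.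
Proof.
pose S : set R := [set stab P c h h | h in [set h : X -> Y | adm P h]].
have hS : has_sup S.
  split; last by exists 1 => _ [h /= ah <-]; exact: stab_le1.
  exists (stab P c (fun=> [tuple 0 | i < k]) (fun=> [tuple 0 | i < k])); exists (fun=> [tuple 0 | i < k]) => //=.
  split; first by split; [exact: measurable_cst|move=> x; exact: ball_zero].
  by move=> i; rewrite !tnth_mktuple Ex_cst.
pose m := sup S.
have Jm (h : X -> Y) : adm P h -> stab P c h h <= m.
  by move=> ah; apply: ub_le_sup; [have [] := hS|exists h].
suff [f af Jf] : exists2 f : X -> Y, adm P f & m <= stab P c f f.
  by exists f => // g ag; apply: (le_trans (Jm g ag)).
have pick (N : nat) : exists h : X -> Y, adm P h /\ m - N.+1%:R^-1 <= stab P c h h.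
  have [|_ [h /= ah <-] hh] := @sup_adherent _ S N.+1%:R^-1 _ hS; first by rewrite invr_gt0.
  by exists h; split => //; exact: ltW.
have [f_ Hf] := choice pick.
have af N : adm P (f_ N) by have [] := Hf N.
have bf N := adm_bv (af N).
have [jN NjN [u bu cv]] := noise_op_subseq af.
have bT N := bv_noise_op P c (bf N).
have [D HD] : exists D, forall x i, `|tnth (u x) i| <= D.
  have [D HD] := choice (fun i => (bu i).2).
  exists (\sum_i `|D i|) => x i; apply: (le_trans (HD i x)).
  by apply: (le_trans (ler_norm _)); rewrite (bigD1 i)//= lerDl sumr_ge0.
(* The maximizing sequence itself supplies the approximants: its stability is its pairing with its
   own noisy version, and those noisy versions tend to u in mean. *)
have approx (eps : R) : 0 < eps -> exists2 h : X -> Y, adm P h & m - eps <= Ex P (fun x => tdot (h x) (u x)).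
  move=> e0.
  pose dd N i x := `|tnth (u x) i - tnth (noise_op P c (f_ (jN N)) x) i|.
  have bdd N i : bm (dd N i).
    have [mm [B HB]] := bmB (bu i) (bT (jN N) i); split; first exact: measurableT_comp.
    by exists B => x; rewrite /dd normr_id; exact: HB.
  have cE : \sum_i Ex P (dd N i) @[N --> \oo] --> (0 : R).
    have := @cvgn_sum R _ (fun (i : 'I_k) N => Ex P (dd N i)) (fun=> 0).
    rewrite big1//; apply => i.
    rewrite -[X in _ --> X](Ex_cst P 0).
    apply: (@Ex_dct _ _ _ P (fun N x => dd N i x) _ (D + 1)).
    - by move=> N; have [] := bdd N i.
    - exact: measurable_cst.
    - move=> N x; rewrite /dd normr_id; apply: (le_trans (ler_normB _ _)); apply: lerD => //.
      exact: noise_op_bound.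
    - apply: aeW => x; rewrite /dd.
      have : tnth (u x) i - tnth (noise_op P c (f_ (jN N)) x) i @[N --> \oo] --> tnth (u x) i - tnth (u x) i.
        by apply: cvgB; [exact: cvg_cst|exact: cv].
      by rewrite subrr => /cvg_norm; rewrite normr0.
  have e2 : 0 < eps / 2 by rewrite divr_gt0.
  have [N [hN1 hN2]] : exists N, \sum_i Ex P (dd N i) <= eps / 2 /\ N.+1%:R^-1 <= eps / 2.
    move/cvgrPdist_le : cE => /(_ _ e2) [N1 _ HN1].
    have [M HM] : exists M : nat, 2 / eps < M%:R.
      by exists (Num.bound (2 / eps)); apply: archi_boundP; rewrite divr_ge0// ltW.
    exists (maxn N1 M); split.
      have := HN1 (maxn N1 M) (leq_maxl _ _); rewrite sub0r normrN; apply: le_trans.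
      exact: ler_norm.
    rewrite -[leRHS]invrK lef_pV2 ?posrE ?invr_gt0 ?divr_gt0// invf_div.
    by apply: (le_trans (ltW HM)); rewrite ler_nat; apply: leqW; exact: leq_maxr.
  exists (f_ (jN N)) => //.
  have J1 : m - N.+1%:R^-1 <= stab P c (f_ (jN N)) (f_ (jN N)).
    have [_] := Hf (jN N); apply: le_trans; rewrite lerD2l lerN2 lef_pV2 ?posrE//.
    by rewrite ler_nat ltnS; exact: NjN.
  have i1 := bm_itg P (bm_tdot (bf (jN N)) bu).
  have i2 := bm_itg P (bm_tdot (bf (jN N)) (bT (jN N))).
  have i3 := fun i => bm_itg P (bdd N i).
  have : stab P c (f_ (jN N)) (f_ (jN N)) - Ex P (fun x => tdot (f_ (jN N) x) (u x)) <= \sum_i Ex P (dd N i).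
    rewrite stab_noise_op// -ExB// -Ex_sum//.
    apply: Ex_le; [exact: itgB|exact: itg_sum|move=> x].
    rewrite /tdot -sumrB; apply: ler_sum => i _; rewrite -mulrBr.
    apply: (le_trans (ler_norm _)); rewrite normrM distrC ler_piMl//.
    by apply: ball_coord; have [[_]] := af (jN N).
  move=> h; apply: (@le_trans _ _ (stab P c (f_ (jN N)) (f_ (jN N)) - eps / 2)).
    rewrite lerBrDr; apply: le_trans J1; rewrite -addrA lerD2l -lerN2 opprD !opprK.
    rewrite (_ : eps - eps / 2 = eps / 2)//; by field.
  by rewrite lerBlDr addrC -lerBlDr; exact: le_trans h hN1.
have [f afs lf] := linear_max bu approx.
exists f => //.
have bfs := adm_bv afs.
have ct : stab P c f (f_ (jN N)) @[N --> \oo] --> Ex P (fun x => tdot (f x) (u x)).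
  under eq_fun do rewrite stab_noise_op//.
  apply: (@Ex_dct _ _ _ P (fun N x => tdot (f x) (noise_op P c (f_ (jN N)) x)) _ 1).
  - by move=> N; have [] := bm_tdot bfs (bT (jN N)).
  - by have [] := bm_tdot bfs bu.
  - move=> N x; apply: ball_dot_abs; first by have [[_]] := afs.
    by have [[_]] := adm_noise_op gP c01 (af (jN N)).
  - by apply: aeW => x; apply: (@cvgn_tdot _ _ (fun=> f x) (fun N => noise_op P c (f_ (jN N)) x)) => i; [exact: cvg_cst|exact: cv].
(* Together with the lower bound m on the left side, from [linear_max], this gives
   [m <= stab P c f f]. *)
have : Ex P (fun x => tdot (f x) (u x)) <= (stab P c f f + m) / 2.
  rewrite -(cvg_lim (@Rhausdorff R) ct).
  apply: limr_le; first by apply/cvg_ex; eexists; exact: ct.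
  apply: nearW => N.
  have := stab_ge0 gP c01 (bv_add bfs (bv_scale (-1) (bf (jN N)))).
  rewrite stab_quad//; have := Jm _ (af (jN N)).
  by rewrite sqrrN expr1n; lra.
by lra.
Qed.

End Existence.

(** * Rotations and reduction to k coordinates *)

Lemma mpres_prod d1 d2 (T1 : measurableType d1) (T2 : measurableType d2) (R : realType)
  (P : probability T1 R) (Q : probability T2 R) (h : T1 -> T2) :
  mpres P Q h -> mpres (P \x P)%E (Q \x Q)%E (fun p => (h p.1, h p.2)).
Proof.
move=> ph; have [mh _] := ph.
apply: Ex_mpres.
  by apply: measurable_fun_pair; apply: (measurableT_comp mh).
move=> F bF.
have bF1 : bm (fun p : T1 * T1 => F (h p.1, h p.2)).
  by apply: (bm_comp bF); apply: measurable_fun_pair; apply: (measurableT_comp mh).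
rewrite (Ex_fub P P bF1) (Ex_fub Q Q bF).
rewrite -(mpres_Ex ph (bm_itg Q (bm_fub1 Q Q bF))).
by apply: eq_Ex => x; rewrite -(mpres_Ex ph (bm_itg Q (bm_section1 (h x) bF))).
Qed.

Lemma mpres_inv d1 d2 (T1 : measurableType d1) (T2 : measurableType d2) (R : realType)
  (P : {measure set T1 -> \bar R}) (Q : {measure set T2 -> \bar R}) (h : T1 -> T2) (h' : T2 -> T1) :
  mpres P Q h -> measurable_fun setT h' -> cancel h h' -> mpres Q P h'.
Proof.
move=> [mh hE] mh' hK; split => // A mA; rewrite -hE.
  by congr (P _); apply/seteqP; split => x /=; rewrite hK.
by rewrite -[X in measurable X]setTI; exact: mh'.
Qed.

(** * Orthogonal invariance through plane reflections *)

Section Givens.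
Context {R : realType} {n : nat}.
Variable P : probability (n.-tuple R) R.
Hypothesis gP : std_gaussian P.
Local Notation gam := (@gam R).
Local Notation Rm := (measurableTypeR R).
Local Notation X := (n.-tuple R).

Definition mulv (M : 'M[R]_n) (x : X) : X := [tuple \sum_l M i l * tnth x l | i < n].

Lemma tnth_mulv M x i : tnth (mulv M x) i = \sum_l M i l * tnth x l.
Proof. by rewrite tnth_mktuple. Qed.

Lemma measurable_mulv M : measurable_fun setT (mulv M).
Proof.
apply: (@measurable_mktuple _ _ _ _ (fun i x => \sum_l M i l * tnth x l)) => i.
apply: measurable_sum => l; apply: measurable_funM; first exact: measurable_cst.
exact: measurable_tnth.
Qed.

Lemma mulv_mul M N x : mulv (M *m N) x = mulv M (mulv N x).
Proof.
apply: eq_from_tnth => i; rewrite !tnth_mulv.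
under eq_bigr do rewrite mxE mulr_suml.
rewrite exchange_big /=; apply: eq_bigr => l _; rewrite tnth_mulv mulr_sumr.
by apply: eq_bigr => m _; rewrite mulrA.
Qed.

Lemma mulv1 x : mulv 1%:M x = x.
Proof.
apply: eq_from_tnth => i; rewrite tnth_mulv (bigD1 i)//= mxE eqxx mul1r big1 ?addr0// => l li.
by rewrite mxE eq_sym (negbTE li) mul0r.
Qed.

Lemma mulv_inj M N : mulv M =1 mulv N -> M = N.
Proof.
move=> MN; apply/matrixP => i j; have := congr1 (fun x => tnth x i) (MN (ev j)).
rewrite !tnth_mulv (bigD1 j)//= [in RHS](bigD1 j)//= !tnth_mktuple eqxx !mulr1.
by rewrite !big1 ?addr0// => l /negbTE lj; rewrite tnth_mktuple lj mulr0.
Qed.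

(** Orthogonality and invariance are carried together: both are checked on plane reflections and
    pass to products, which avoids a change of variables in n dimensions. *)
Definition gauss_rotation M := orthogonal_mx M /\ mpres P P (mulv M).

Lemma gauss_rotation1 : gauss_rotation 1%:M.
Proof.
split; first by rewrite /orthogonal_mx trmx1 mulmx1.
by rewrite (_ : mulv _ = id); [exact: mpres_id|apply/funext => x; exact: mulv1].
Qed.

Lemma gauss_rotationM M N : gauss_rotation M -> gauss_rotation N -> gauss_rotation (M *m N).
Proof.
move=> [oM pM] [oN pN]; split.
  by rewrite /orthogonal_mx trmx_mul mulmxA -(mulmxA M) oN mulmx1.
rewrite (_ : mulv _ = fun x => mulv M (mulv N x)); first exact: mpres_comp pM pN.
by apply/funext => x; exact: mulv_mul.
Qed.

Section Plane.
Variables (i j : 'I_n) (C S : R).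
Hypothesis ij : i != j.
Hypothesis CS : C ^+ 2 + S ^+ 2 = 1.

Definition plane (x : X) : X :=
  upd (upd x i (C * tnth x i + S * tnth x j)) j (S * tnth x i - C * tnth x j).

Definition planemx : 'M[R]_n := \matrix_(r, s)
  (C * ((r == i)%:R * (s == i)%:R) + S * ((r == i)%:R * (s == j)%:R) +
   (S * ((r == j)%:R * (s == i)%:R) - C * ((r == j)%:R * (s == j)%:R)) +
   ((r != i) && (r != j))%:R * (s == r)%:R).

Let sumd (a : 'I_n) (x : X) : \sum_l (l == a)%:R * tnth x l = tnth x a.
Proof.
rewrite (bigD1 a)//= eqxx mul1r big1 ?addr0// => l /negbTE ->.
by rewrite mul0r.
Qed.

Lemma mulv_plane x : mulv planemx x = plane x.
Proof.
apply: eq_from_tnth => r; rewrite tnth_mulv /plane !tnth_upd.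
transitivity ((r == i)%:R * (C * tnth x i + S * tnth x j) +
  (r == j)%:R * (S * tnth x i - C * tnth x j) + ((r != i) && (r != j))%:R * tnth x r).
  rewrite -(sumd i x) -(sumd j x) -(sumd r x) !mulr_sumr -sumrB -big_split /=.
  rewrite !mulr_sumr -!big_split /=; apply: eq_bigr => l _; rewrite mxE; ring.
have ji : (j == i) = false by rewrite eq_sym (negbTE ij).
have [->|rj] := eqVneq r j; first by rewrite ?ji ?eqxx /=; ring.
by have [->|ri] := eqVneq r i; rewrite ?eqxx ?(negbTE ij) /=; ring.
Qed.

Let plane_plane x : plane (plane x) = x.
Proof.
have E1 : C * (C * tnth x i + S * tnth x j) + S * (S * tnth x i - C * tnth x j) = tnth x i.
  by transitivity ((C ^+ 2 + S ^+ 2) * tnth x i); [ring|rewrite CS mul1r].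
have E2 : S * (C * tnth x i + S * tnth x j) - C * (S * tnth x i - C * tnth x j) = tnth x j.
  by transitivity ((C ^+ 2 + S ^+ 2) * tnth x j); [ring|rewrite CS mul1r].
apply: eq_from_tnth => r; rewrite /plane !tnth_upd (negbTE ij) !eqxx E1 E2.
by case: eqP => [->//|_]; case: eqP => [->|].
Qed.

Let mplane : measurable_fun setT plane.
Proof. by rewrite /plane; measur. Qed.

(** Resampling the two coordinates reduces invariance to that of the planar Gaussian. *)
Lemma gauss_rotation_plane : gauss_rotation planemx.
Proof.
have sym : planemx^T = planemx.
  apply/matrixP => r s; rewrite !mxE; congr (_ + _); first by ring.
  have [->//|rs] := eqVneq r s; by rewrite ?mulr0 // eq_sym (negbTE rs) !mulr0.
split.
  rewrite /orthogonal_mx sym; apply: mulv_inj => x.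
  by rewrite mulv_mul !mulv_plane plane_plane mulv1.
rewrite (_ : mulv _ = plane); last by apply/funext => x; exact: mulv_plane.
apply: (Ex_mpres mplane) => F bF.
have res (G : X -> R) : bm G ->
    Ex P (fun x => Ex gam (fun a => Ex gam (fun b => G (upd (upd x i a) j b)))) = Ex P G.
  move=> bG.
  have b1 : bm (fun x => Ex gam (fun b => G (upd x j b))).
    apply: (@bm_Ex _ _ _ _ _ gam (fun x (b : Rm) => G (upd x j b))).
    by apply: (bm_comp bG); measur.
  by rewrite -(Ex_resample j gP bG) -(Ex_resample i gP b1).
have bFp : bm (fun x => F (plane x)) by exact: (bm_comp bF mplane).
rewrite -(res _ bFp) -(res _ bF); apply: eq_Ex => x.
rewrite -[RHS](@Ex_refl2 R C S (fun a b => F (upd (upd x i a) j b)) CS); last first.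
  by apply: (bm_comp bF); measur.
apply: eq_Ex => a; apply: eq_Ex => b; congr (F _); apply: eq_from_tnth => r.
rewrite /plane !tnth_upd (negbTE ij) !eqxx.
by case: eqP => // _; case: eqP.
Qed.

End Plane.

(* Givens elimination brings A to lower triangular form. *)
Lemma rotate_moments k (A : 'M[R]_(k, n)) : (k <= n)%N -> exists2 M, gauss_rotation M &
  forall (r : 'I_k) (s : 'I_n), (k <= s)%N -> (A *m M^T) r s = 0.
Proof.
move=> kn.
suff H (t : nat) : (t <= k)%N -> exists2 M, gauss_rotation M &
    forall (r : 'I_k) (s : 'I_n), (r < t)%N -> (r < s)%N -> (A *m M^T) r s = 0.
  have [M gM HM] := H k (leqnn k); exists M => // r s ks.
  by apply: HM => //; exact: leq_trans (ltn_ord r) ks.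
elim: t => [_|t IH tk]; first by exists 1%:M => //; exact: gauss_rotation1.
have [M gM HM] := IH (ltnW tk).
pose rt := Ordinal tk; have tn : (t < n)%N by exact: leq_trans tk kn.
pose ct := Ordinal tn.
(* Inner induction: clear row t in columns t + 1 to u - 1 while keeping the zeros of the rows
   above. *)
suff H (u : nat) : (u <= n)%N -> exists2 M, gauss_rotation M &
    (forall (r : 'I_k) (s : 'I_n), (r < t)%N -> (r < s)%N -> (A *m M^T) r s = 0) /\
    (forall s : 'I_n, (t < s < u)%N -> (A *m M^T) rt s = 0).
  have [N gN [H1 H2]] := H n (leqnn n); exists N => // r s.
  rewrite ltnS leq_eqVlt => /orP[/eqP rt_ rs|]; last exact: H1.
  by rewrite (_ : r = rt); [apply: H2; rewrite -rt_ rs ltn_ord|apply/val_inj].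
elim: u => [_|u IHu un].
  by exists M => //; split => // s; rewrite ltn0 andbF.
have [N gN [H1 H2]] := IHu (ltnW un).
have [tu|ut] := ltnP t u; last first.
  exists N => //; split => // s /andP[ts]; rewrite ltnS => su.
  by have := leq_trans ts (leq_trans su ut); rewrite ltnn.
pose cu := Ordinal un.
have ctu : ct != cu by rewrite -val_eqE /= neq_ltn tu.
pose B := A *m N^T.
pose nr := Num.sqrt (B rt ct ^+ 2 + B rt cu ^+ 2).
have nr2 : nr ^+ 2 = B rt ct ^+ 2 + B rt cu ^+ 2 by rewrite sqr_sqrtr// addr_ge0// sqr_ge0.
(* If both entries vanish there is nothing to clear, and any reflection will do. *)
pose C := if nr == 0 then 1 else B rt ct / nr.
pose S := if nr == 0 then 0 else B rt cu / nr.
have CS : C ^+ 2 + S ^+ 2 = 1.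
  rewrite /C /S; case: eqVneq => [_|n0]; first by rewrite expr1n expr0n addr0.
  by rewrite !exprMn -mulrDl -nr2 exprVn divff// sqrf_eq0.
have gG := gauss_rotation_plane ctu CS.
exists (planemx ct cu C S *m N); first exact: gauss_rotationM.
have E (r : 'I_k) (s : 'I_n) : (A *m (planemx ct cu C S *m N)^T) r s =
   tnth (plane ct cu C S [tuple B r l | l < n]) s.
  rewrite trmx_mul mulmxA -/B -mulv_plane// tnth_mulv mxE.
  by apply: eq_bigr => l _; rewrite [(_^T) l s]mxE tnth_mktuple mulrC.
split.
  (* The rows above have zeros in both of the columns being mixed. *)
  move=> r s rt_ rs; rewrite E /plane !tnth_upd !tnth_mktuple /B.
  rewrite (H1 r ct)// (H1 r cu)//; last exact: ltn_trans tu.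
  case: eqP => _; first by rewrite !mulr0 subr0.
  by case: eqP => _; [rewrite !mulr0 addr0|rewrite H1].
move=> s /andP[ts su]; rewrite E /plane !tnth_upd !tnth_mktuple.
have [_|scu] := eqVneq s cu.
  rewrite /C /S; have [n0|n0] := eqVneq nr 0; last by rewrite mulrAC [in X in _ - X]mulrAC (mulrC (B rt cu)) subrr.
  move: nr2; rewrite n0 expr0n /= => /esym/eqP; rewrite paddr_eq0 ?sqr_ge0// !sqrf_eq0.
  by move=> /andP[_ /eqP ->]; rewrite mul0r mulr0 subr0.
have -> : (s == ct) = false by apply/negbTE; rewrite -val_eqE /= neq_ltn ts orbT.
apply: H2; rewrite ts /=.
by move: su; rewrite ltnS leq_eqVlt => /orP[/eqP su|//]; move: scu; rewrite -val_eqE /= su eqxx.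
Qed.

End Givens.

Section Rotation.
Context {R : realType} {n k : nat}.
Variable P : probability (n.-tuple R) R.
Hypothesis gP : std_gaussian P.
Local Notation X := (n.-tuple R).
Local Notation Y := (k.-tuple R).

Lemma mix_mulv (M : 'M[R]_n) (a b : R) x z :
  mulv M (mix (fun=> a) (fun=> b) x z) = mix (fun=> a) (fun=> b) (mulv M x) (mulv M z).
Proof.
apply: eq_from_tnth => i; rewrite tnth_mix !tnth_mulv !mulr_sumr -big_split /=.
by apply: eq_bigr => l _; rewrite tnth_mix; ring.
Qed.

Lemma stab_mulv (M : 'M[R]_n) (rho : R) (f : X -> Y) : mpres P P (mulv M) -> bv f ->
  stab P (cst_corr rho) (fun x => f (mulv M x)) (fun x => f (mulv M x)) = stab P (cst_corr rho) f f.
Proof.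
move=> pM bf; rewrite /stab /corr_mean.
rewrite -(mpres_Ex (mpres_prod pM) (bm_itg _ (bm_corr_mean (cst_corr rho) bf bf))).
apply: eq_Ex => p; congr (tdot _ (f _)).
exact: (mix_mulv M rho (Num.sqrt (1 - rho ^+ 2))).
Qed.

Lemma adm_mulv (M : 'M[R]_n) (f : X -> Y) : mpres P P (mulv M) -> adm P f ->
  adm P (fun x => f (mulv M x)).
Proof.
move=> pM af; have bf := adm_bv af; have [[mf f1] f0] := af; split.
  split; last by move=> x; exact: f1.
  exact: (measurableT_comp mf (measurable_mulv M)).
move=> i; rewrite tnth_mktuple -[RHS](f0 i) tnth_mktuple.
exact: (mpres_Ex pM (bm_itg P (bf i))).
Qed.

(** The law is invariant under M, so x may be replaced by M x; orthogonality turns [M^T M x] back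
    into x. *)
Lemma moment_mulv (M : 'M[R]_n) (f : X -> Y) r s : gauss_rotation P M -> bv f ->
  Ex P (fun x => tnth (f (mulv M^T x)) r * tnth x s) =
  ((\matrix_(i, l) Ex P (fun x => tnth (f x) i * tnth x l)) *m M^T) r s.
Proof.
move=> [oM pM] bf.
have iX l : itg P (fun x : X => tnth x l) by exact: (mpres_itg (mpres_coord gP l) (@itg_id R)).
have ifx r' l : itg P (fun x : X => tnth (f x) r' * tnth x l) by exact: itg_bmM.
have b : bm (fun x => tnth (f (mulv M^T x)) r).
  exact: (bm_comp (bf r) (measurable_mulv M^T)).
rewrite -(mpres_Ex pM (itg_bmM b (iX s))) /=.
transitivity (Ex P (fun x => \sum_l M s l * (tnth (f x) r * tnth x l))).
  apply: eq_Ex => x; rewrite -mulv_mul (mulmx1C oM) mulv1 tnth_mulv mulr_sumr.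
  by apply: eq_bigr => l _; ring.
rewrite Ex_sum; last by move=> l; exact: itgZ.
rewrite mxE; apply: eq_bigr => l _; rewrite ExZ// mulrC.
by rewrite [(_^T) l s]mxE mxE.
Qed.

Lemma mpres_mulvT (M : 'M[R]_n) : gauss_rotation P M -> mpres P P (mulv M^T).
Proof.
move=> [oM pM]; apply: (mpres_inv pM (measurable_mulv M^T)) => x.
by rewrite -mulv_mul (mulmx1C oM) mulv1.
Qed.

End Rotation.

(** * Maps that ignore the coordinates from k on *)

Section Cylinder.
Context {R : realType} {n k : nat}.
Variable P : probability (n.-tuple R) R.
Hypothesis gP : std_gaussian P.
Local Notation X := (n.-tuple R).
Local Notation Y := (k.-tuple R).
Variable f : X -> Y.
Hypothesis ballf : ball_valued f.
Hypothesis indep : forall j : 'I_n, (k <= j)%N ->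
  {ae (P \x P)%E, forall p, f p.1 = f (upd p.1 j (tnth p.2 j))}.

Definition swap_coords (m : nat) (x z : X) : X :=
  [tuple if (k <= l < m)%N then tnth z l else tnth x l | l < n].

(* The sign makes the map a composition of two coordinatewise reflections. *)
Lemma mpres_swap_coords (m : nat) : mpres (P \x P)%E (P \x P)%E
  (fun p => (swap_coords m p.1 p.2,
    [tuple if (k <= l < m)%N then - tnth p.1 l else tnth p.2 l | l < n])).
Proof.
pose S (l : 'I_n) : R := (k <= l < m)%N%:R.
pose C (l : 'I_n) : R := 1 - S l.
have CS i : C i ^+ 2 + S i ^+ 2 = 1.
  by rewrite /C /S; case: (_ && _); rewrite ?subrr ?subr0 expr1n expr0n ?addr0 ?add0r.
have c1 (i : 'I_n) : (fun=> 1 : R) i ^+ 2 + (fun=> 0 : R) i ^+ 2 = 1.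
  by rewrite expr1n expr0n addr0.
have := mpres_comp (mpres_refl gP c1) (mpres_refl gP CS).
congr (mpres _ _ _); apply/funext => -[x z] /=; congr pair; apply: eq_from_tnth => l;
  rewrite !tnth_mix !tnth_mktuple /C /S; case: (_ && _) => /=; ring.
Qed.

(** One coordinate at a time: the hypothesis for coordinate m is transported along
    [mpres_swap_coords m], which leaves that coordinate of both points alone. *)
Lemma indep_swap (m : nat) : (m <= n)%N ->
  {ae (P \x P)%E, forall p, f p.1 = f (swap_coords m p.1 p.2)}.
Proof.
elim: m => [_|m IH mn].
  apply: aeW => p; congr (f _); apply: eq_from_tnth => l.
  by rewrite tnth_mktuple ltn0 andbF.
have {}IH := IH (ltnW mn).
have [km|mk] := leqP k m; last first.
  move: IH; apply: (@filterS _ _ (ae_filter_ringOfSetsType (P \x P)%E)) => p ->.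
  congr (f _); apply: eq_from_tnth => l; rewrite !tnth_mktuple.
  have [kl|//] := leqP k l; have ml := leq_trans mk kl.
  by rewrite /= ltnS [(l < m)%N]ltnNge [(l <= m)%N]leqNgt ml (ltnW ml).
pose j : 'I_n := Ordinal mn.
move: IH (mpres_ae (mpres_swap_coords m) (indep (j := j) km)).
apply: (@filterS2 _ _ (ae_filter_ringOfSetsType (P \x P)%E)) => p -> /= ->.
congr (f _); apply: eq_from_tnth => l; rewrite tnth_upd !tnth_mktuple /= ltnn andbF.
have [->|lj] := eqVneq l j; first by rewrite km ltnSn.
by rewrite ltnS [(l <= m)%N]leq_eqVlt (_ : (l == m :> nat) = false)//; apply/negbTE.
Qed.

(** [nth] is used because l ranges over the n coordinates; its default 0 is never reached. *)
Definition pad (y : Y) (z : X) : X :=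
  [tuple if (l < k)%N then nth 0 y l else tnth z l | l < n].

(** Averaging over the remaining coordinates gives a map that is defined, and ball-valued, at every
    y. *)
Definition cylinder_base (y : Y) : Y := [tuple Ex P (fun z => tnth (f (pad y z)) i) | i < k].

Let measurable_pad : measurable_fun setT (fun p : Y * X => pad p.1 p.2).
Proof.
apply: measurable_mktuple => l; have [lk|kl] := ltnP l k; last by measur.
rewrite (_ : (fun _ => _) = fun p : Y * X => tnth p.1 (Ordinal lk)); first by measur.
by apply/funext => p; rewrite (tnth_nth 0).
Qed.

Lemma ball_cylinder_base : ball_valued cylinder_base.
Proof.
have bf := ball_valued_bv ballf; split.
  apply: bv_measurable => i.
  apply: (@eq_bm _ _ _ (fun y => Ex P (fun z => tnth (f (pad y z)) i))).
    by move=> y; rewrite tnth_mktuple.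
  apply: (@bm_Ex _ _ _ _ _ P (fun y z => tnth (f (pad y z)) i)).
  exact: (bm_comp (bf i) measurable_pad).
move=> y; apply: ball_Ex => [|z]; last by case: ballf.
apply: (bv_comp bf).
exact: (measurableT_comp measurable_pad (measurable_pair1 y)).
Qed.

(** Once all coordinates from k on are replaced by those of z, Fubini fixes x, and averaging over z
    produces the base map. *)
Lemma cylinder (hk : (k <= n)%N) :
  {ae P, forall x, f x = cylinder_base [tuple tnth x (widen_ord hk j) | j < k]}.
Proof.
have bf := ball_valued_bv ballf.
apply: filterS (ae_fub (indep_swap (leqnn n))) => x /= Hx.
apply: eq_from_tnth => i; rewrite tnth_mktuple -[LHS](Ex_cst P).
set y := [tuple _ | _ < _].
apply: Ex_ae; first exact: measurable_cst.
  have [] // : bm (fun z => tnth (f (pad y z)) i).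
  apply: (bm_comp (bf i)); exact: (measurableT_comp measurable_pad (measurable_pair1 y)).
move: Hx; apply: (@filterS _ _ (ae_filter_ringOfSetsType P)) => z ->.
congr (tnth (f _) i); apply: eq_from_tnth => l; rewrite !tnth_mktuple ltn_ord andbT.
have [kl|lk] := leqP k l => //.
rewrite -[nth _ _ _]/(nth 0 y (Ordinal lk)) -tnth_nth tnth_mktuple.
by congr (tnth x _); apply/val_inj.
Qed.

End Cylinder.

Theorem theorem5p1 (R : realType) (n k : nat)
    (P : probability (n.-tuple R) R) :
  (0 < n)%N -> (0 < k)%N -> std_gaussian P ->
  (forall rho : R, 0 <= rho <= 1 ->
     exists f : n.-tuple R -> k.-tuple R, optimally_stable P rho f) /\
  (forall (hk : (k <= n)%N) (rho : R), 0 < rho < 1 ->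
     forall f : n.-tuple R -> k.-tuple R, optimally_stable P rho f ->
     exists (M : 'M[R]_n) (h : k.-tuple R -> k.-tuple R),
       [/\ orthogonal_mx M, ball_valued h &
           {ae P, forall x, f x = h (first_coords hk M x)}]).
Proof.
move=> n0 k0 gP; split.
  move=> rho /andP[rho0]; rewrite le_eqVlt => /predU1P[->|rho1]; last first.
    have [f af fopt] := exists_opt (k := k) gP rho0 rho1.
    by exists f; apply/optimally_stableE.
  (* Every unimodular admissible map is optimal for rho = 1. *)
  have h0 : 0 < 2^-1 :> R by rewrite invr_gt0.
  have h1 : 2^-1 < 1 :> R by lra.
  have [f af fopt] := exists_opt (k := k) gP (ltW h0) h1.
  exists f; apply/optimally_stableE; split => // g ag.
  apply: (le_trans (stab_le1 _ ag)); rewrite le_eqVlt; apply/orP; left; apply/eqP.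
  have funit := opt_unit gP h0 h1 (Ordinal n0) (Ordinal k0) af fopt.
  have bf := adm_bv af.
  rewrite /stab /corr_mean -[LHS](Ex_cst (P \x P)%E).
  apply: Ex_ae; [exact: measurable_cst|by have [] := bm_corr_mean (cst_corr 1) bf bf|].
  move: (mpres_ae (mpres_fst P P) funit).
  apply: (@filterS _ _ (ae_filter_ringOfSetsType (P \x P)%E)) => p fp; rewrite -[LHS]fp.
  (* At correlation 1 the noise has weight 0, so both arguments of the inner product coincide. *)
  congr (tdot _ (f _)); apply: eq_from_tnth => l.
  by rewrite tnth_mix /cst_corr /co expr1n subrr sqrtr0 mul1r mul0r addr0.
move=> hk rho /andP[rho0 rho1] f /optimally_stableE[af fopt].
have bf := adm_bv af.
(* Each component of f contributes one row of first moments; after the rotation the columns from k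
   on vanish, as [opt_indep] requires. *)
have [M gM HM] := rotate_moments gP (\matrix_(i, l) Ex P (fun x => tnth (f x) i * tnth x l)) hk.
have pT := mpres_mulvT gM; have [oM pM] := gM.
pose g x := f (mulv M^T x).
have ag : adm P g by exact: adm_mulv.
have gopt (h : n.-tuple R -> k.-tuple R) : adm P h -> stab P (cst_corr rho) h h <= stab P (cst_corr rho) g g.
  by move=> ah; rewrite (stab_mulv rho pT bf); exact: fopt.
have indep (j : 'I_n) : (k <= j)%N ->
    {ae (P \x P)%E, forall p, g p.1 = g (upd p.1 j (tnth p.2 j))}.
  move=> kj; apply: (opt_indep gP rho0 rho1 (Ordinal k0) ag gopt) => i.
  by rewrite moment_mulv//; exact: HM.
have [bg _] := ag.
exists M, (cylinder_base P g); split => //; first exact: ball_cylinder_base.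
move: (mpres_ae pM (cylinder gP bg indep hk)).
apply: (@filterS _ _ (ae_filter_ringOfSetsType P)) => x /=.
rewrite /g -mulv_mul (mulmx1C oM) mulv1 => ->; congr (cylinder_base _ _ _).
by apply: eq_from_tnth => j; rewrite !tnth_mktuple.
Qed.
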